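(* Let $k$ be a field of prime characteristic $p$, and let $H$ be any finite-dimensional Hopf algebra over $k$ having the local dual Chevalley property or the connected Chevalley property. Then the sequence of indicators $\{\nu_n(H)\}_{n\in\mathbb{Z}}$ is the $p$-pertinent sequence; that is, for every $n\in\mathbb{Z}$, in $k$, $\nu_n(H)=1$ if $p\nmid n$ and $\nu_n(H)=0$ if $p\mid n$.
   Context: Let $H$ be a finite-dimensional Hopf algebra over $k$ with antipode $S$, comultiplication $\Delta(h)=h_{(1)}\otimes h_{(2)}$ (Sweedler notation) and counit $\varepsilon$. Indicators: for an integer $m$, the $m$-th Sweedler power map $P_H^{(m)}:H\to H$ is the $m$-th convolution power of $\mathrm{id}_H$; explicitly, for $m\ge 1$, $P_H^{(0)}(h)=\varepsilon(h)1_H$, $P_H^{(m)}(h)=h_{(1)}\cdots h_{(m)}$, and $P_H^{(-m)}(h)=S(h_{(1)})\cdots S(h_{(m)})$. For $n\in\mathbb{Z}$, the $n$-th indicator is $\nu_n(H)=\mathrm{Tr}\big(S\circ P_H^{(n-1)}:H\to H\big)\in k$, the ordinary trace of a linear operator. The $p$-pertinent sequence is the periodic sequence $\{a_n\}_{n\in\mathbb Z}$ with $a_n=1$ if $p\nmid n$ and $a_n=0$ if $p\mid n$. The coradical $H_0$ of $H$ is the sum of all simple subcoalgebras of $H$. A coalgebra is connected if its coradical is one-dimensional. $H$ has the local dual Chevalley property if $H_0$ is a Hopf subalgebra of $H$ and $H_0$ is a local algebra. $H$ has the connected Chevalley property if the Jacobson radical $J$ of $H$ is a Hopf ideal and the quotient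 $H/J$ is a connected coalgebra.
   Formalization: H is assumed nontrivial (dim H > 1): the trivial Hopf algebra H = k has both Chevalley properties, but ν_n(k) = 1 for every n, also when p divides n, so the claim as worded fails for it. *)

(* Defs.v *)
From HB Require Import structures.
From mathcomp Require Import all_boot all_order all_algebra all_field.
From mathcomp Require Import boolp.
Set Implicit Arguments.
Unset Strict Implicit.
Unset Printing Implicit Defensive.
Import GRing.Theory VectorInternalTheory.
Local Open Scope ring_scope.

(* The library has no tensor product of vector spaces.  For finite-dimensional
   U and V we take matrices of coordinates: u (x) v is the rank-one matrix
   u^T v, and [tlift f] is the linear map induced by a bilinear f (see
   [tlift_tpure] and [tens_ext] for the universal property). *)
Section Tensor.
Variable k : fieldType.

Definition tens (U V : vectType k) : vectType k := 'M[k]_(dim U, dim V).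

Definition tpure (U V : vectType k) (u : U) (v : V) : tens U V :=
  (v2r u)^T *m v2r v.

Definition tlift_fun (U V W : vectType k) (f : U -> V -> W) (t : tens U V) : W :=
  \sum_i \sum_j t i j *: f (r2v (delta_mx 0 i)) (r2v (delta_mx 0 j)).

Lemma tlift_fun_linear (U V W : vectType k) (f : U -> V -> W) :
  linear (tlift_fun f).
Proof.
move=> a s t; rewrite /tlift_fun scaler_sumr -big_split; apply: eq_bigr => i _.
rewrite scaler_sumr -big_split; apply: eq_bigr => j _ /=.
by rewrite !mxE scalerDl scalerA.
Qed.

HB.instance Definition _ (U V W : vectType k) (f : U -> V -> W) :=
  GRing.isLinear.Build k (tens U V) W _ (tlift_fun f) (tlift_fun_linear f).

Definition tlift (U V W : vectType k) (f : U -> V -> W) : 'Hom(tens U V, W) :=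
  linfun (tlift_fun f).

End Tensor.

Notation "u \ox v" := (tpure u v) (at level 40, left associativity).

Section TensorMaps.
Variable k : fieldType.
Implicit Types U V W : vectType k.

Definition tens_map U V U' V' (f : 'Hom(U, U')) (g : 'Hom(V, V')) :
  'Hom(tens U V, tens U' V') := tlift (fun u v => f u \ox g v).

Definition tens_assoc U V W : 'Hom(tens (tens U V) W, tens U (tens V W)) :=
  tlift (fun t w => tlift (fun u v => u \ox (v \ox w)) t).

(* The image of A (x) B in U (x) V, for subspaces A of U and B of V. *)
Definition tens_sub U V (A : {vspace U}) (B : {vspace V}) : {vspace tens U V} :=
  <<[seq u \ox v | u <- vbasis A, v <- vbasis B]>>%VS.

Definition tens_mul (A : falgType k) (s t : tens A A) : tens A A :=
  tlift (fun a b => tlift (fun c d => (a * c) \ox (b * d)) t) s.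

Definition ltrace V (f : 'End(V)) : k :=
  \tr (passmx.mxof (vbasis {:V}) (vbasis {:V}) f).

End TensorMaps.

Section TensorTheory.
Variable k : fieldType.
Implicit Types U V W : vectType k.

Lemma tpureDl U V (a : k) (u u' : U) (v : V) :
  (a *: u + u') \ox v = a *: (u \ox v) + u' \ox v.
Proof. by rewrite /tpure !linearP /= mulmxDl -scalemxAl. Qed.

Lemma tpureDr U V (a : k) (u : U) (v v' : V) :
  u \ox (a *: v + v') = a *: (u \ox v) + u \ox v'.
Proof. by rewrite /tpure !linearP. Qed.

Lemma r2v_sum_delta U (u : U) :
  u = \sum_i v2r u 0 i *: r2v (delta_mx 0 i).
Proof.
rewrite -{1}[u]v2rK {1}[v2r u]row_sum_delta linear_sum.
by apply: eq_bigr => i _; rewrite linearZ.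
Qed.

Lemma tlift_tpure U V W (f : U -> V -> W) :
  (forall v, linear (f^~ v)) -> (forall u, linear (f u)) ->
  forall u v, tlift f (u \ox v) = f u v.
Proof.
move=> fl fr u v; rewrite lfunE /= /tlift_fun.
pose fL v : U -> W := f^~ v.
pose hl v := HB.pack_for {linear U -> W} (fL v)
  (GRing.isLinear.Build k U W _ (fL v) (fl v)).
pose hr u := HB.pack_for {linear V -> W} (f u)
  (GRing.isLinear.Build k V W _ (f u) (fr u)).
have El v' u' : f u' v' = hl v' u' by [].
have Er v' u' : f u' v' = hr u' v' by [].
rewrite [in RHS](r2v_sum_delta u) El linear_sum; apply: eq_bigr => i _.
rewrite linearZ -El [v in RHS](r2v_sum_delta v) Er linear_sum /= scaler_sumr.
apply: eq_bigr => j _; rewrite [X in _ = _ *: X]Er linearZ /= scalerA; congr (_ *: _).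
by rewrite /tpure mxE big_ord1 !mxE.
Qed.

Lemma tens_decomp U V (t : tens U V) :
  t = \sum_i \sum_j t i j *: (r2v (delta_mx 0 i) \ox r2v (delta_mx 0 j)).
Proof.
rewrite {1}[t]matrix_sum_delta; apply: eq_bigr => i _; apply: eq_bigr => j _.
by rewrite /tpure !r2vK trmx_delta mul_delta_mx.
Qed.

Lemma tens_ext U V W (f g : 'Hom(tens U V, W)) :
  (forall u v, f (u \ox v) = g (u \ox v)) -> f = g.
Proof.
move=> fg; apply/lfunP => t; rewrite [t]tens_decomp !linear_sum.
apply: eq_bigr => i _; rewrite !linear_sum; apply: eq_bigr => j _.
by rewrite !linearZ /= fg.
Qed.

Lemma tens_ext3 U V W (X : vectType k) (f g : 'Hom(tens (tens U V) W, X)) :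
  (forall u v w, f ((u \ox v) \ox w) = g ((u \ox v) \ox w)) -> f = g.
Proof.
move=> fg; apply: tens_ext => t w; pose r (s : tens U V) := s \ox w.
have rl : linear r by move=> a x y; apply: tpureDl.
pose R := linfun (HB.pack_for {linear tens U V -> tens (tens U V) W} r
  (GRing.isLinear.Build k (tens U V) (tens (tens U V) W) _ r rl)).
have RE s : R s = s \ox w by rewrite lfunE.
rewrite -RE; suff /lfunP/(_ t): (f \o R = g \o R)%VF by rewrite !comp_lfunE.
by apply: tens_ext => u v; rewrite !comp_lfunE RE.
Qed.

Lemma tens_map_tpure U V U' V' (f : 'Hom(U, U')) (g : 'Hom(V, V')) u v :
  tens_map f g (u \ox v) = f u \ox g v.
Proof.
by apply: tlift_tpure => ? a x y; rewrite linearP ?tpureDl ?tpureDr.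
Qed.

Lemma tens_assoc_tpure U V W (u : U) (v : V) (w : W) :
  tens_assoc U V W ((u \ox v) \ox w) = u \ox (v \ox w).
Proof.
have E (w' : W) (u' : U) (v' : V) :
    tlift (fun u v => u \ox (v \ox w')) (u' \ox v') = u' \ox (v' \ox w').
  by apply: tlift_tpure => ? a x y; rewrite ?tpureDl ?tpureDr.
rewrite /tens_assoc tlift_tpure //= => [w'|t] a x y; first exact: linearP.
pose g (w' : W) := tlift (fun (u : U) (v : V) => u \ox (v \ox w')).
suff /lfunP/(_ t): g (a *: x + y) = a *: g x + g y.
  by rewrite add_lfunE scale_lfunE.
by apply: tens_ext => u' v'; rewrite add_lfunE scale_lfunE !E !tpureDr.
Qed.

Lemma tens_map_comp U V U' V' U2 V2 (f' : 'Hom(U', U2)) (g' : 'Hom(V', V2))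
    (f : 'Hom(U, U')) (g : 'Hom(V, V')) :
  (tens_map f' g' \o tens_map f g)%VF = tens_map (f' \o f)%VF (g' \o g)%VF.
Proof. by apply: tens_ext => u v; rewrite comp_lfunE !tens_map_tpure !comp_lfunE. Qed.

End TensorTheory.

Section Families.
Variables (k : fieldType) (V : vectType k).
Implicit Types (P : {vspace V} -> Prop) (U : {vspace V}).

Lemma sumv_family_ex P : exists U, forall x,
  x \in U <-> exists2 s : seq {vspace V},
                forall D, D \in s -> P D & x \in (\sum_(D <- s) D)%VS.
Proof.
have [U [[s Ps ->] maxU]] : exists U,
    (exists2 s : seq {vspace V}, forall D, D \in s -> P D
                                 & U = (\sum_(D <- s) D)%VS)
    /\ forall D, P D -> (D <= U)%VS.
  suff sum_ind n U : (exists2 s : seq {vspace V}, forall D, D \in s -> P D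
                                 & U = (\sum_(D <- s) D)%VS) ->
      (\dim {:V} - \dim U < n)%N -> exists U,
      (exists2 s : seq {vspace V}, forall D, D \in s -> P D
                                 & U = (\sum_(D <- s) D)%VS)
      /\ forall D, P D -> (D <= U)%VS.
    by apply: (sum_ind _ 0%VS) (ltnSn _); exists [::]; rewrite ?big_nil.
  elim: n U => // n IHn U [s Ps ->] ltn.
  have [maxU|] := pselect (forall D, P D -> (D <= \sum_(D <- s) D)%VS).
    by exists (\sum_(D <- s) D)%VS; split=> //; exists s.
  case/existsNP=> D /not_implyP[PD /negP nD].
  apply: (IHn (\sum_(D <- D :: s) D)%VS).
    by exists (D :: s) => // E; rewrite inE => /orP[/eqP->|/Ps].
  have lt: (\dim (\sum_(D <- s) D) < \dim (\sum_(D <- D :: s) D))%N.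
    rewrite big_cons ltn_neqAle dimvS ?addvSr // andbT.
    apply: contra nD => dimE.
    have: (\sum_(D <- s) D == D + \sum_(D <- s) D)%VS by rewrite eqEdim addvSr -(eqP dimE) leqnn.
    by move/eqP->; apply: addvSl.
  rewrite ltnS in ltn; apply: leq_trans ltn.
  by rewrite ltn_sub2l // (leq_trans lt) // dimvS ?subvf.
exists (\sum_(D <- s) D)%VS => x; split=> [xU|[s' Ps' xs']]; first by exists s.
apply: subvP xs'; rewrite big_seq; apply: (big_ind (fun A => A <= \sum_(D <- s) D)%VS) => [|A B|D /Ps'/maxU //].
  exact: sub0v.
by rewrite subv_add => -> ->.
Qed.

Definition sumv_family P : {vspace V} := sval (cid (sumv_family_ex P)).

Lemma mem_sumv_family P x :
  x \in sumv_family P <-> exists2 s : seq {vspace V},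
    forall D, D \in s -> P D & x \in (\sum_(D <- s) D)%VS.
Proof. exact: (svalP (cid (sumv_family_ex P))). Qed.

(* The intersection, obtained as the sum of all common subspaces. *)
Definition capv_family P : {vspace V} :=
  sumv_family (fun U => forall D, P D -> (U <= D)%VS).

Lemma mem_capv_family P x :
  x \in capv_family P <-> forall D, P D -> x \in D.
Proof.
rewrite /capv_family mem_sumv_family; split=> [[s sP xs] D PD|xP].
  apply: subvP xs; rewrite big_seq; apply: (big_ind (fun A => A <= D)%VS) => [|A B|E /sP]; last exact.
    exact: sub0v.
  by rewrite subv_add => -> ->.
exists [:: <[x]>%VS] => [E|]; last by rewrite big_seq1 memv_line.
by rewrite inE => /eqP-> D /xP; rewrite -memvE.
Qed.

End Families.

Record coalgebra (k : fieldType) (C : vectType k) := Coalgebra {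
  comul : 'Hom(C, tens C C);
  counit : 'Hom(C, k^o);
  comul_assoc : (tens_assoc C C C \o tens_map comul \1 \o comul)%VF
                = (tens_map \1 comul \o comul)%VF;
  counitl : forall x, tlift (fun a b => (counit a : k) *: b) (comul x) = x;
  counitr : forall x, tlift (fun a b => (counit b : k) *: a) (comul x) = x
}.

Section Coalgebra.
Variables (k : fieldType) (C : vectType k) (cC : coalgebra C).

Definition subcoalgebra (D : {vspace C}) : bool :=
  (comul cC @: D <= tens_sub D D)%VS.

Definition simple_subcoalgebra (D : {vspace C}) : Prop :=
  [/\ subcoalgebra D, D <> 0%VS
    & forall E, subcoalgebra E -> (E <= D)%VS -> E = 0%VS \/ E = D].

Definition coradical : {vspace C} := sumv_family simple_subcoalgebra.

Definition connected_coalgebra : Prop := \dim coradical = 1%N.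

Definition coideal (I : {vspace C}) : bool :=
  (comul cC @: I <= tens_sub I fullv + tens_sub fullv I)%VS
  && (I <= lker (counit cC))%VS.

End Coalgebra.

(* The quotient C / I is modelled on the complement I^C, through which the
   projection [quo_proj] along I identifies C / I with a vectType. *)
Section Quotient.
Variables (k : fieldType) (C : vectType k) (I : {vspace C}).

Definition quo_space : vectType k := subvs_of (I^C)%VS.

Definition quo_proj : 'Hom(C, quo_space) :=
  (linfun (vsproj (I^C)%VS) \o daddv_pi (I^C)%VS I)%VF.

Definition quo_repr : 'Hom(quo_space, C) := linfun vsval.

Lemma quo_reprK x : quo_proj (quo_repr x) = x.
Proof.
rewrite comp_lfunE !lfunE /= daddv_pi_id ?subvsP ?vsvalK //.
by rewrite capvC capv_compl.
Qed.

Lemma quo_projB x : x - quo_repr (quo_proj x) \in I.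
Proof.
rewrite comp_lfunE !lfunE /= vsprojK ?memv_pi //.
have cIC : (I^C :&: I = 0)%VS by rewrite capvC capv_compl.
have xCI : x \in (I^C + I)%VS by rewrite addvC addv_complf memvf.
by rewrite -{1}(daddv_pi_add cIC xCI) addrC addKr memv_pi.
Qed.

Lemma quo_proj_ker : lker quo_proj = I.
Proof.
apply/vspaceP => x; rewrite memv_ker; apply/eqP/idP => [x0|xI].
  by have := quo_projB x; rewrite x0 linear0 subr0.
have cIC : (I :&: I^C = 0)%VS by rewrite capv_compl.
have xCI : x \in (I^C + I)%VS by rewrite addvC addv_complf memvf.
have cIC' : (I^C :&: I = 0)%VS by rewrite capvC.
have := daddv_pi_add cIC' xCI; rewrite (daddv_pi_id cIC xI).
move/(canRL (addrK _)); rewrite subrr => E.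
by rewrite comp_lfunE E linear0.
Qed.

Variables (cC : coalgebra C) (coI : coideal cC I).

Definition quo_comul : 'Hom(quo_space, tens quo_space quo_space) :=
  (tens_map quo_proj quo_proj \o comul cC \o quo_repr)%VF.

Definition quo_counit : 'Hom(quo_space, k^o) := (counit cC \o quo_repr)%VF.

Lemma quo_comulE :
  (quo_comul \o quo_proj = tens_map quo_proj quo_proj \o comul cC)%VF.
Proof.
apply/lfunP => x; rewrite !comp_lfunE; apply/esym/eqP.
rewrite -subr_eq0 -!linearB -memv_ker /=.
have /andP[/subvP coI1 _] := coI.
suff /subvP H : (tens_sub I fullv + tens_sub fullv I
              <= lker (tens_map quo_proj quo_proj))%VS.
  by apply/H/coI1/memv_img; rewrite -(comp_lfunE (linfun (vsproj _))); apply: quo_projB.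
have kI u : u \in I -> quo_proj u = 0.
  by rewrite -{1}quo_proj_ker memv_ker => /eqP.
rewrite subv_add; apply/andP; split; apply/span_subvP => w;
  case/allpairsP=> -[u v] /= [/vbasis_mem uI /vbasis_mem vI ->];
  rewrite memv_ker tens_map_tpure.
  by rewrite (kI u uI) /tpure !linear0 mul0mx.
by rewrite (kI v vI) /tpure !linear0.
Qed.

Lemma quo_counitE : (quo_counit \o quo_proj = counit cC)%VF.
Proof.
apply/lfunP => x; rewrite !comp_lfunE; apply/esym/eqP.
have /andP[_ /subvP coI2] := coI.
by rewrite -subr_eq0 -!linearB -memv_ker; apply/coI2; rewrite -(comp_lfunE (linfun (vsproj _))); apply: quo_projB.
Qed.

Lemma quo_proj_epi (W : vectType k) (f g : 'Hom(quo_space, W)) :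
  (f \o quo_proj = g \o quo_proj)%VF -> f = g.
Proof.
move=> /lfunP fg; apply/lfunP => x; have := fg (quo_repr x).
by rewrite (comp_lfunE f) (comp_lfunE g) quo_reprK.
Qed.

Lemma quo_comul_assoc :
  (tens_assoc _ _ _ \o tens_map quo_comul \1 \o quo_comul)%VF
  = (tens_map \1 quo_comul \o quo_comul)%VF.
Proof.
move: quo_comulE (@quo_proj_epi).
move: quo_comul quo_proj => D pi DE epi; apply: epi.
rewrite -!comp_lfunA DE.
rewrite [in LHS](comp_lfunA (tens_map _ _)) [in RHS](comp_lfunA (tens_map _ _)).
rewrite !tens_map_comp DE !comp_lfun1l.
have -> : tens_map (tens_map pi pi \o comul cC)%VF pi
   = (tens_map (tens_map pi pi) pi \o tens_map (comul cC) \1)%VF.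
  by rewrite tens_map_comp comp_lfun1r.
have -> : tens_map pi (tens_map pi pi \o comul cC)%VF
   = (tens_map pi (tens_map pi pi) \o tens_map \1 (comul cC))%VF.
  by rewrite tens_map_comp comp_lfun1r.
rewrite -[in RHS]comp_lfunA -comul_assoc !comp_lfunA.
congr (_ \o _ \o _)%VF; apply: tens_ext3 => u v w; rewrite !comp_lfunE.
by rewrite !(tens_map_tpure, tens_assoc_tpure).
Qed.

Lemma quo_counitl x :
  tlift (fun a b => (quo_counit a : k) *: b) (quo_comul x) = x.
Proof.
have Bl (D : vectType k) (e : 'Hom(D, k^o)) (v : D) :
    linear (fun u => (e u : k) *: v).
  by move=> a y z; rewrite linearP scalerDl scalerA.
have Br (D : vectType k) (e : 'Hom(D, k^o)) (u : D) :
    linear (fun v : D => (e u : k) *: v).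
  by move=> a y z; rewrite scalerDr !scalerA mulrC.
pose T (D : vectType k) (e : 'Hom(D, k^o)) : 'Hom(tens D D, D) :=
  tlift (fun a b => (e a : k) *: b).
suff /lfunP/(_ x) : (T _ quo_counit \o quo_comul)%VF = \1%VF.
  by rewrite comp_lfunE id_lfunE.
move: quo_comulE quo_counitE (@quo_proj_epi).
move: quo_comul quo_counit quo_proj => D e pi DE eE epi; apply: epi.
rewrite -comp_lfunA DE comp_lfunA comp_lfun1l.
have -> : (T _ e \o tens_map pi pi = pi \o T _ (counit cC))%VF.
  apply: tens_ext => u v.
  rewrite !comp_lfunE tens_map_tpure !tlift_tpure //; try exact: Bl; try exact: Br.
  by rewrite linearZ -eE comp_lfunE.
by apply/lfunP => y; rewrite !comp_lfunE counitl.
Qed.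

Lemma quo_counitr x :
  tlift (fun a b => (quo_counit b : k) *: a) (quo_comul x) = x.
Proof.
have Bl (D : vectType k) (e : 'Hom(D, k^o)) (v : D) :
    linear (fun u => (e u : k) *: v).
  by move=> a y z; rewrite linearP scalerDl scalerA.
have Br (D : vectType k) (e : 'Hom(D, k^o)) (u : D) :
    linear (fun v : D => (e u : k) *: v).
  by move=> a y z; rewrite scalerDr !scalerA mulrC.
pose T (D : vectType k) (e : 'Hom(D, k^o)) : 'Hom(tens D D, D) :=
  tlift (fun a b => (e b : k) *: a).
suff /lfunP/(_ x) : (T _ quo_counit \o quo_comul)%VF = \1%VF.
  by rewrite comp_lfunE id_lfunE.
move: quo_comulE quo_counitE (@quo_proj_epi).
move: quo_comul quo_counit quo_proj => D e pi DE eE epi; apply: epi.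
rewrite -comp_lfunA DE comp_lfunA comp_lfun1l.
have -> : (T _ e \o tens_map pi pi = pi \o T _ (counit cC))%VF.
  apply: tens_ext => u v.
  rewrite !comp_lfunE tens_map_tpure !tlift_tpure //; try exact: Bl; try exact: Br.
  by rewrite linearZ -eE comp_lfunE.
by apply/lfunP => y; rewrite !comp_lfunE counitr.
Qed.

Definition quo_coalgebra : coalgebra quo_space :=
  Coalgebra quo_comul_assoc quo_counitl quo_counitr.

End Quotient.

Definition mul_map (k : fieldType) (A : falgType k) : 'Hom(tens A A, A) :=
  tlift (fun a b : A => a * b).

Definition conv (k : fieldType) (A : falgType k) (cA : coalgebra A)
  (f g : 'End(A)) : 'End(A) := (mul_map A \o tens_map f g \o comul cA)%VF.

Definition conv1 (k : fieldType) (A : falgType k) (cA : coalgebra A) : 'End(A) :=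
  linfun (fun x => (counit cA x : k)%:A).

Record hopf_algebra (k : fieldType) (H : falgType k) := HopfAlgebra {
  hopf_coalgebra :> coalgebra H;
  comul1 : comul hopf_coalgebra 1 = 1 \ox 1;
  comulM : forall x y, comul hopf_coalgebra (x * y)
             = tens_mul (comul hopf_coalgebra x) (comul hopf_coalgebra y);
  counit1 : counit hopf_coalgebra 1 = 1;
  counitM : forall x y, counit hopf_coalgebra (x * y)
              = counit hopf_coalgebra x * counit hopf_coalgebra y;
  antipode : 'End(H);
  antipodel : conv hopf_coalgebra antipode \1%VF = conv1 hopf_coalgebra;
  antipoder : conv hopf_coalgebra \1%VF antipode = conv1 hopf_coalgebra
}.

(* Ideals are taken as k-subspaces; in a unital algebra this is automatic. *)
Section Ideals.
Variables (k : fieldType) (H : falgType k).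
Implicit Types A I M : {vspace H}.

Definition left_ideal A I : bool := (I <= A)%VS && (A * I <= I)%VS.

Definition max_left_ideal A M : Prop :=
  [/\ left_ideal A M, M <> A
    & forall I, left_ideal A I -> (M <= I)%VS -> I = M \/ I = A].

Definition local_algebra A : Prop := exists! M, max_left_ideal A M.

Definition jacobson_radical : {vspace H} :=
  capv_family (max_left_ideal {:H}).

End Ideals.

Section HopfAlgebra.
Variables (k : fieldType) (H : falgType k) (hH : hopf_algebra H).

Definition sweedler_power (m : int) : 'End(H) :=
  match m with
  | Posz n => iter n (conv hH \1%VF) (conv1 hH)
  | Negz n => iter n.+1 (conv hH (antipode hH)) (conv1 hH)
  end.

Definition indicator (n : int) : k :=
  ltrace (antipode hH \o sweedler_power (n - 1))%VF.

Definition hopf_subalgebra (A : {vspace H}) : Prop :=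
  [/\ 1 \in A, (A * A <= A)%VS, subcoalgebra hH A
    & (antipode hH @: A <= A)%VS].

Definition hopf_ideal (I : {vspace H}) : Prop :=
  [/\ ({:H} * I <= I)%VS, (I * {:H} <= I)%VS, coideal hH I
    & (antipode hH @: I <= I)%VS].

Definition local_dual_chevalley : Prop :=
  hopf_subalgebra (coradical hH) /\ local_algebra (coradical hH).

Definition connected_chevalley : Prop :=
  hopf_ideal (jacobson_radical H)
  /\ exists coJ : coideal hH (jacobson_radical H),
       connected_coalgebra (quo_coalgebra coJ).

End HopfAlgebra.

Definition pertinent_seq (p : nat) (n : int) : nat :=
  if (p%:Z %| n)%Z then 0%N else 1%N.

(* Main.v *)
Require Import Defs.
From HB Require Import structures.
From mathcomp Require Import all_boot all_order all_algebra all_field.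
From mathcomp Require Import boolp zify ring.
Set Implicit Arguments.
Unset Strict Implicit.
Unset Printing Implicit Defensive.
Import Order.TTheory GRing.Theory VectorInternalTheory.
Local Open Scope ring_scope.

(** The proof degenerates H, twice, to a commutative Hopf algebra on which the
    indicators can be computed by peeling off primitive elements.

    Degeneration. Let K be a nilpotent Hopf ideal of a finite-dimensional Hopf
    algebra T. In a basis adapted to the K-adic filtration, keeping only the
    structure constants that preserve the degree gives the associated graded
    Hopf algebra, and the trace defining an indicator does not change
    ([indic_adic]). The antipode respects the filtration because it is the
    convolution inverse of the identity and the filtered endomorphisms form a
    finite-dimensional convolution algebra ([antip_filt]). Indicators are also
    unchanged by passing to the dual Hopf algebra ([indic_dual]), which in
    coordinates only exchanges the two families of structure constants.

    Reduction. Suppose that K is nilpotent and that, in the dual of T, the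
    augmentation ideal of the subalgebra K^perp, the dual of T / K, is nilpotent
    too. Then the dual L of the graded algebra gr T is local: its
    augmentation ideal is nilpotent ([local_dual_gr]). In L the difference
    between a coproduct and its flip lies deeper in the filtration by powers of
    the augmentation ideal than expected ([asym_chain]), so the graded algebra
    of L is cocommutative ([gr_local_cocomm]) and its dual A commutative;
    moreover the augmentation ideals of A and of its dual are nilpotent,
    because both are graded with a one-dimensional part of degree zero.

    Computation. If A is not k, it contains a primitive x <> 0
    ([exists_primitive]). Let r be least with x^r = 0. The comultiplication of
    x^r = 0 shows that the binomials C(r, i), 0 < i < r, vanish in k; and A is
    free over k[x], since a functional f with f(x^(r-1) a) = eps(a) turns
    a |-> f(a1) a2 into an operator whose (r-1)-fold commutator with x is the
    identity ([mulx_ker]). A composite P of Sweedler powers satisfies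
    P(x a) = m x P(a) for an integer m, so its trace on A is
    1 + m + ... + m^(r-1) times its trace on A / xA. That sum is 0 if m = 1
    in k and 1 otherwise, and induction on the dimension finishes
    ([comm_trace]). On A the antipode is itself a Sweedler power, the one of
    exponent p^e - 1 with e large ([antip_conv_pow]), so the indicator of index
    n corresponds to m = 1 - n.

    The hypotheses. For the connected Chevalley property take T = H and K the
    Jacobson radical. For the local dual Chevalley property take T = H^* and K
    the functionals vanishing on the coradical H_0, so that K^perp is H_0. The
    required nilpotency comes from two facts: in a finite-dimensional algebra
    an ideal contained in all maximal left ideals is nilpotent
    ([radical_nilpotent]), and in a finite-dimensional coalgebra the
    functionals vanishing on the coradical form a nilpotent ideal of the dual
    algebra ([contraction_chain_nilpotent]). *)

(** * Bialgebras given by structure constants *)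

Section StructureConstants.
Variables (k : fieldType) (n : nat).
Implicit Types (c d : 'I_n -> 'I_n -> 'I_n -> k) (a b : 'rV[k]_n) (t : 'M[k]_n).

(** A family c of constants is read in two ways: [mulv c] is the product with
    e_i e_j = sum_l c i j l e_l, and [comulv c] the coproduct sending e_l to
    sum_(i, j) c i j l e_i (x) e_j, a tensor being the matrix of its
    coordinates. *)
Definition mulmap c t : 'rV[k]_n := \row_l \sum_i \sum_j t i j * c i j l.

Definition mulv c a b : 'rV[k]_n := mulmap c (a^T *m b).

Definition comulv c a : 'M[k]_n := \matrix_(i, j) \sum_l a 0 l * c i j l.

Definition dot a b : k := (a *m b^T) 0 0.

Lemma mulmap_linear c : linear (mulmap c).
Proof.
move=> x s t; apply/rowP => l; rewrite !mxE mulr_sumr -big_split.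
apply: eq_bigr => i _; rewrite mulr_sumr -big_split; apply: eq_bigr => j _.
by rewrite !mxE mulrDl mulrA.
Qed.

HB.instance Definition _ c :=
  GRing.isLinear.Build k 'M[k]_n 'rV[k]_n _ (mulmap c) (mulmap_linear c).

Lemma comulv_linear c : linear (comulv c).
Proof.
move=> x s t; apply/matrixP => i j; rewrite !mxE mulr_sumr -big_split.
by apply: eq_bigr => l _; rewrite !mxE mulrDl mulrA.
Qed.

HB.instance Definition _ c :=
  GRing.isLinear.Build k 'rV[k]_n 'M[k]_n _ (comulv c) (comulv_linear c).

Lemma mulvDl c x a a' b : mulv c (x *: a + a') b = x *: mulv c a b + mulv c a' b.
Proof. by rewrite /mulv linearP /= mulmxDl -scalemxAl linearP. Qed.

Lemma mulvDr c x a b b' : mulv c a (x *: b + b') = x *: mulv c a b + mulv c a b'.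
Proof. by rewrite /mulv mulmxDr -scalemxAr linearP. Qed.

HB.instance Definition _ c a :=
  GRing.isLinear.Build k 'rV[k]_n 'rV[k]_n _ (mulv c a) (fun x => mulvDr c x a).

Definition mulvr c b a := mulv c a b.

Lemma mulvrDl c b : linear (mulvr c b).
Proof. by move=> x a a'; apply: mulvDl. Qed.

HB.instance Definition _ c b :=
  GRing.isLinear.Build k 'rV[k]_n 'rV[k]_n _ (mulvr c b) (mulvrDl c b).

Lemma mulvrE c b a : mulvr c b a = mulv c a b. Proof. by []. Qed.

Lemma mulvZl c x a b : mulv c (x *: a) b = x *: mulv c a b.
Proof. by rewrite -!mulvrE linearZ. Qed.

Lemma mulvE c a b l :
  mulv c a b 0 l = \sum_i \sum_j a 0 i * b 0 j * c i j l.
Proof.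
rewrite mxE; apply: eq_bigr => i _; apply: eq_bigr => j _.
by rewrite !mxE big_ord1 mxE.
Qed.

Lemma mulv_delta c i j l : mulv c (delta_mx 0 i) (delta_mx 0 j) 0 l = c i j l.
Proof.
rewrite mulvE (bigD1 i) //= (bigD1 j) //= !mxE !eqxx !mul1r.
rewrite big1 ?addr0 => [|j' nj]; last by rewrite !mxE (negPf nj) /= mulr0 mul0r.
rewrite big1 ?addr0 // => i' ni; rewrite big1 // => j' _.
by rewrite !mxE (negPf ni) /= !mul0r.
Qed.

Lemma comulv_delta c i j l : comulv c (delta_mx 0 l) i j = c i j l.
Proof.
rewrite mxE (bigD1 l) //= big1 ?addr0 => [|l' nl]; last first.
  by rewrite !mxE (negPf nl) /= mul0r.
by rewrite !mxE !eqxx mul1r.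
Qed.

Lemma dotC a b : dot a b = dot b a.
Proof. by rewrite /dot -[a *m b^T]trmxK trmx_mul trmxK mxE. Qed.

Lemma mul_dot a b : a *m b^T = (dot a b)%:M. Proof. exact: mx11_scalar. Qed.

Lemma dotE a b : dot a b = \sum_i a 0 i * b 0 i.
Proof. by rewrite /dot mxE; apply: eq_bigr => i _; rewrite mxE. Qed.

Lemma dotDl x a a' b : dot (x *: a + a') b = x * dot a b + dot a' b.
Proof. by rewrite /dot mulmxDl -scalemxAl !mxE. Qed.

Lemma dotDr x a b b' : dot a (x *: b + b') = x * dot a b + dot a b'.
Proof. by rewrite dotC dotDl !(dotC _ a). Qed.

Lemma dot0r a : dot a 0 = 0. Proof. by rewrite /dot trmx0 mulmx0 mxE. Qed.

Lemma dotZr x a b : dot a (x *: b) = x * dot a b.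
Proof. by rewrite -[x *: b]addr0 dotDr dot0r addr0. Qed.

Lemma dot_delta a i : dot a (delta_mx 0 i) = a 0 i.
Proof.
rewrite dotE (bigD1 i) //= big1 ?addr0 => [|j nj].
  by rewrite mxE !eqxx mulr1.
by rewrite mxE (negPf nj) andbF mulr0.
Qed.

Lemma dot_inj a b : (forall x, dot a x = dot b x) -> a = b.
Proof. by move=> ab; apply/rowP => i; rewrite -!dot_delta ab. Qed.

(** With the pairing [dot], the product read off from c is the convolution
    product dual to the coproduct read off from c. Coassociativity and
    counitality can therefore be stated as properties of a product. *)
Lemma dot_mulv c a b x : dot (mulv c a b) x = dot (a *m comulv c x) b.
Proof.
transitivity (\sum_i \sum_j \sum_l a 0 i * b 0 j * c i j l * x 0 l).
  rewrite dotE; under eq_bigr => l _.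
    rewrite mulvE mulr_suml; under eq_bigr do rewrite mulr_suml.
    over.
  by rewrite exchange_big; apply: eq_bigr => i _; rewrite exchange_big.
rewrite exchange_big dotE; apply: eq_bigr => j _.
rewrite mxE mulr_suml; apply: eq_bigr => i _.
rewrite mxE mulr_sumr mulr_suml; apply: eq_bigr => l _.
ring.
Qed.

End StructureConstants.

Section BilinearExt.
Variables (k : fieldType) (n : nat) (V : lmodType k).

Lemma linear_ext (f g : 'rV[k]_n -> V) : linear f -> linear g ->
  (forall i, f (delta_mx 0 i) = g (delta_mx 0 i)) -> f =1 g.
Proof.
move=> lf lg fg a.
pose F := HB.pack_for {linear 'rV[k]_n -> V} f (GRing.isLinear.Build k _ _ _ f lf).
pose G := HB.pack_for {linear 'rV[k]_n -> V} g (GRing.isLinear.Build k _ _ _ g lg).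
rewrite -[f a]/(F a) -[g a]/(G a) [a]row_sum_delta !linear_sum.
by apply: eq_bigr => i _; rewrite !linearZ /= fg.
Qed.

Lemma bilinear_ext (f g : 'rV[k]_n -> 'rV[k]_n -> V) :
  (forall b, linear (f^~ b)) -> (forall a, linear (f a)) ->
  (forall b, linear (g^~ b)) -> (forall a, linear (g a)) ->
  (forall i j, f (delta_mx 0 i) (delta_mx 0 j) = g (delta_mx 0 i) (delta_mx 0 j)) ->
  f =2 g.
Proof.
move=> fl fr gl gr fg a b; apply: (@linear_ext (f^~ b) (g^~ b)) => // i.
exact: (@linear_ext (f _) (g _)).
Qed.

End BilinearExt.

Section Bialgebra.
Variables (k : fieldType) (n : nat).
Implicit Types (c d : 'I_n -> 'I_n -> 'I_n -> k) (a b u e : 'rV[k]_n).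
Definition is_alg c u :=
  [/\ associative (mulv c), left_id u (mulv c) & right_id u (mulv c)].

Definition assoc_coef c := forall i j l t,
  \sum_h c i j h * c h l t = \sum_h c j l h * c i h t.

Definition is_aug c e := forall a b, dot e (mulv c a b) = dot e a * dot e b.

(** The product of the tensor square, on matrices of coordinates. *)
Definition tmul c (s t : 'M[k]_n) : 'M[k]_n := \matrix_(a, b)
  \sum_i \sum_i' \sum_j \sum_j' s i i' * t j j' * (c i j a * c i' j' b).

(** Multiplicativity of the coproduct, in a form visibly symmetric under the
    exchange of products and coproducts. *)
Definition compat_coef c d := forall i j h l : 'I_n,
  \sum_t c i j t * d h l t =
  \sum_i1 \sum_i2 \sum_j1 \sum_j2
     d i1 i2 i * d j1 j2 j * (c i1 j1 h * c i2 j2 l).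

Lemma mulv_deltal c a l t : mulv c a (delta_mx 0 l) 0 t = \sum_h a 0 h * c h l t.
Proof.
rewrite mulvE; apply: eq_bigr => i _; rewrite (bigD1 l) //= big1 ?addr0.
  by rewrite !mxE !eqxx mulr1.
by move=> j nj; rewrite !mxE (negPf nj) /= mulr0 mul0r.
Qed.

Lemma mulv_deltar c a l t : mulv c (delta_mx 0 l) a 0 t = \sum_h a 0 h * c l h t.
Proof.
rewrite mulvE exchange_big; apply: eq_bigr => i _; rewrite (bigD1 l) //= big1 ?addr0.
  by rewrite !mxE !eqxx mul1r.
by move=> j nj; rewrite !mxE (negPf nj) /= mul0r mul0r.
Qed.

Lemma assoc_coefP c : assoc_coef c <-> associative (mulv c).
Proof.
split=> [H|H i j l t].
  move=> a b x; move: a b.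
  apply: bilinear_ext => [b y a a'|a y b b'|b y a a'|a y b b'|i j].
  - by rewrite mulvDl.
  - by rewrite mulvDl mulvDr.
  - by rewrite !mulvDl.
  - by rewrite mulvDr mulvDl.
  move: x; apply: linear_ext => [y x x'|y x x'|l]; rewrite ?mulvDr //.
  apply/rowP => t; rewrite mulv_deltal mulv_deltar.
  under eq_bigr do rewrite mulv_delta.
  by under [RHS]eq_bigr do rewrite mulv_delta.
have /rowP/(_ t) := H (delta_mx 0 i) (delta_mx 0 j) (delta_mx 0 l).
rewrite mulv_deltal mulv_deltar.
under eq_bigr do rewrite mulv_delta; move=> ->.
by under [RHS]eq_bigr do rewrite mulv_delta.
Qed.

Lemma tmulDl c (x : k) (s s' t : 'M[k]_n) : tmul c (x *: s + s') t = x *: tmul c s t + tmul c s' t.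
Proof.
apply/matrixP => a b; rewrite !mxE mulr_sumr -big_split; apply: eq_bigr => i _.
rewrite mulr_sumr -big_split; apply: eq_bigr => i' _.
rewrite mulr_sumr -big_split; apply: eq_bigr => j _.
rewrite mulr_sumr -big_split; apply: eq_bigr => j' _.
by rewrite !mxE /=; ring.
Qed.

Lemma tmulDr c (x : k) (s t t' : 'M[k]_n) : tmul c s (x *: t + t') = x *: tmul c s t + tmul c s t'.
Proof.
apply/matrixP => a b; rewrite !mxE mulr_sumr -big_split; apply: eq_bigr => i _.
rewrite mulr_sumr -big_split; apply: eq_bigr => i' _.
rewrite mulr_sumr -big_split; apply: eq_bigr => j _.
rewrite mulr_sumr -big_split; apply: eq_bigr => j' _.
by rewrite !mxE /=; ring.
Qed.

Lemma tmul_pure c a a' b b' :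
  tmul c (a^T *m a') (b^T *m b') = (mulv c a b)^T *m mulv c a' b'.
Proof.
apply/matrixP => x y; rewrite !mxE big_ord1 !mxE mulr_suml.
apply: eq_bigr => i _; rewrite exchange_big mulr_suml; apply: eq_bigr => j _.
rewrite mulr_sumr; apply: eq_bigr => i' _; rewrite mulr_sumr.
apply: eq_bigr => j' _; rewrite !mxE !big_ord1 !mxE; ring.
Qed.

Lemma compat_coefP c d :
  compat_coef c d <->
  (forall a b, comulv d (mulv c a b) = tmul c (comulv d a) (comulv d b)).
Proof.
have E i j (a b : 'I_n) : comulv d (mulv c (delta_mx 0 i) (delta_mx 0 j)) a b
    = \sum_l c i j l * d a b l.
  by rewrite mxE; apply: eq_bigr => l _; rewrite mulv_delta.
have E' i j (a b : 'I_n) :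
    tmul c (comulv d (delta_mx 0 i)) (comulv d (delta_mx 0 j)) a b
    = \sum_i1 \sum_i2 \sum_j1 \sum_j2
     d i1 i2 i * d j1 j2 j * (c i1 j1 a * c i2 j2 b).
  rewrite mxE; do 4!(apply: eq_bigr => ? _).
  by rewrite !comulv_delta.
split=> [H|H i j a b]; last by rewrite -E -E' H.
apply: bilinear_ext => [b y a a'|a y b b'|b y a a'|a y b b'|i j].
- by rewrite mulvDl linearP.
- by rewrite mulvDr linearP.
- by rewrite linearP tmulDl.
- by rewrite linearP tmulDr.
by apply/matrixP => a b; rewrite E E' H.
Qed.

Lemma compat_coef_dual c d : compat_coef c d -> compat_coef d c.
Proof.
move=> H i j a b; under eq_bigr do rewrite mulrC.
rewrite H; apply: eq_bigr => i1 _; rewrite exchange_big; apply: eq_bigr => j1 _.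
by apply: eq_bigr => i2 _; apply: eq_bigr => j2 _; ring.
Qed.

(** Every axiom is paired with its dual, so that the dual bialgebra is obtained
    by exchanging the fields. *)
Record bialg := Bialg {
  mc : 'I_n -> 'I_n -> 'I_n -> k;
  dc : 'I_n -> 'I_n -> 'I_n -> k;
  uv : 'rV[k]_n;
  ev : 'rV[k]_n;
  mc_alg : is_alg mc uv;
  dc_alg : is_alg dc ev;
  ev_aug : is_aug mc ev;
  uv_aug : is_aug dc uv;
  ev_uv : dot ev uv = 1;
  mc_dc : compat_coef mc dc
}.

Definition dual (T : bialg) : bialg :=
  Bialg (dc_alg T) (mc_alg T) (uv_aug T) (ev_aug T)
        (etrans (dotC _ _) (ev_uv T)) (compat_coef_dual (mc_dc T)).

End Bialgebra.

(** * Convolution and indicators *)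

Section BialgTheory.
Variables (k : fieldType) (n : nat) (T : bialg k n).
Notation V := 'rV[k]_n.
Implicit Types (a b : V).

Lemma mcA : associative (mulv (mc T)). Proof. by case: (mc_alg T). Qed.
Lemma mc1l : left_id (uv T) (mulv (mc T)). Proof. by case: (mc_alg T). Qed.
Lemma mc1r : right_id (uv T) (mulv (mc T)). Proof. by case: (mc_alg T). Qed.

Lemma comulvM a b :
  comulv (dc T) (mulv (mc T) a b) = tmul (mc T) (comulv (dc T) a) (comulv (dc T) b).
Proof. by move: a b; apply/compat_coefP; apply: mc_dc. Qed.

Lemma dot_comulv (f x : V) (g : V) :
  (f *m comulv (dc T) x *m g^T) 0 0 = dot (mulv (dc T) f g) x.
Proof. by rewrite dot_mulv. Qed.

Lemma matrix_dot_ext (s t : 'M[k]_n) :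
  (forall f g : V, (f *m s *m g^T) 0 0 = (f *m t *m g^T) 0 0) -> s = t.
Proof.
move=> st; apply/row_matrixP => i; rewrite !rowE.
by apply: dot_inj => g; apply: st.
Qed.

Lemma comulv_uv : comulv (dc T) (uv T) = (uv T)^T *m uv T.
Proof.
apply: matrix_dot_ext => f g; rewrite dot_comulv dotC uv_aug !mulmxA.
rewrite -mulmxA mxE big_ord1; congr (_ * _).
by rewrite dotC.
Qed.

Lemma ev_comulv a : ev T *m comulv (dc T) a = a.
Proof.
apply: dot_inj => g; rewrite -dot_mulv; case: (dc_alg T) => _ -> _.
exact: dotC.
Qed.

Lemma comulv_ev a : comulv (dc T) a *m (ev T)^T = a^T.
Proof.
apply: trmx_inj; rewrite trmx_mul !trmxK; apply: dot_inj => g.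
rewrite dotC {1}/dot trmx_mul trmxK mulmxA dot_comulv dotC.
by case: (dc_alg T) => _ _ ->.
Qed.

(** Endomorphisms are matrices acting on row vectors from the right, so the
    tensor t is sent by f (x) g to f^T t g. *)
Definition convm (f g : 'M[k]_n) : 'M[k]_n :=
  \matrix_l mulmap (mc T) (f^T *m comulv (dc T) (delta_mx 0 l) *m g).

Definition convm1 : 'M[k]_n := (ev T)^T *m uv T.

Lemma mul_conv a f g : a *m convm f g = mulmap (mc T) (f^T *m comulv (dc T) a *m g).
Proof.
move: a; apply: linear_ext => [x a b|x a b|l].
- by rewrite mulmxDl scalemxAl.
- by rewrite linearP mulmxDr mulmxDl -scalemxAr -scalemxAl linearP.
by rewrite -rowE rowK.
Qed.

Lemma convDl x f f' g : convm (x *: f + f') g = x *: convm f g + convm f' g.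
Proof.
apply/row_matrixP => i; rewrite !rowE mulmxDr -scalemxAr !mul_conv.
by rewrite linearP /= !mulmxDl -!scalemxAl linearP.
Qed.

Lemma convDr x f g g' : convm f (x *: g + g') = x *: convm f g + convm f g'.
Proof.
apply/row_matrixP => i; rewrite !rowE mulmxDr -scalemxAr !mul_conv.
by rewrite mulmxDr -!scalemxAr linearP.
Qed.

HB.instance Definition _ f :=
  GRing.isLinear.Build k 'M[k]_n 'M[k]_n _ (convm f)
    (fun x g g' => convDr x f g g').

Lemma conv1f f : convm convm1 f = f.
Proof.
apply/row_matrixP => i; rewrite !rowE mul_conv /convm1 trmx_mul trmxK.
by rewrite -!mulmxA (mulmxA (ev T)) ev_comulv -/(mulv _ _ _) mc1l.
Qed.

Lemma convf1 f : convm f convm1 = f.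
Proof.
apply/row_matrixP => i; rewrite !rowE mul_conv /convm1.
by rewrite mulmxA -(mulmxA f^T) comulv_ev -trmx_mul -/(mulv _ _ _) mc1r.
Qed.

Lemma row_conv f g l :
  row l (convm f g) = \sum_i \sum_j dc T i j l *: mulv (mc T) (row i f) (row j g).
Proof.
rewrite rowE mul_conv.
have -> : f^T *m comulv (dc T) (delta_mx 0 l) *m g
   = \sum_i \sum_j dc T i j l *: ((row i f)^T *m row j g).
  rewrite {1}[comulv _ _]matrix_sum_delta mulmx_sumr mulmx_suml.
  apply: eq_bigr => i _; rewrite mulmx_sumr mulmx_suml; apply: eq_bigr => j _.
  rewrite comulv_delta -scalemxAr -scalemxAl !rowE trmx_mul trmx_delta.
  by rewrite -(mul_delta_mx (0 : 'I_1)) !mulmxA.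
rewrite linear_sum; apply: eq_bigr => i _; rewrite linear_sum.
by apply: eq_bigr => j _; rewrite linearZ.
Qed.

Lemma mulv_suml c I (r : seq I) (P : pred I) (F : I -> V) b :
  mulv c (\sum_(i <- r | P i) F i) b = \sum_(i <- r | P i) mulv c (F i) b.
Proof. exact: (linear_sum (mulvr c b)). Qed.

(** Both triple products of a row are the same sum over three indices of
    products of rows; coassociativity identifies their coefficients. *)
Lemma convA : associative convm.
Proof.
move=> f g h; apply/row_matrixP => l; rewrite !row_conv.
pose F i j t := mulv (mc T) (mulv (mc T) (row i f) (row j g)) (row t h).
transitivity (\sum_i \sum_j \sum_t (\sum_m dc T j t m * dc T i m l) *: F i j t).
  apply: eq_bigr => i _.
  under eq_bigr => j _.
    rewrite row_conv linear_sum /= scaler_sumr.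
    under eq_bigr => s _.
      rewrite linear_sum /= scaler_sumr.
      under eq_bigr do rewrite linearZ /= scalerA mcA.
      over.
    over.
  rewrite exchange_big; apply: eq_bigr => j _; rewrite exchange_big.
  apply: eq_bigr => t _; rewrite scaler_suml; apply: eq_bigr => m _.
  by rewrite mulrC.
have [/assoc_coefP dA _ _] := dc_alg T.
under eq_bigr => i _ do under eq_bigr => j _ do under eq_bigr => t _ do rewrite -dA.
under [RHS]eq_bigr => m _.
  under eq_bigr => t _.
    rewrite row_conv mulv_suml scaler_sumr.
    under eq_bigr => i _.
      rewrite mulv_suml scaler_sumr.
      under eq_bigr do rewrite -[mulv _ (_ *: _) _]/(mulvr _ _ _) linearZ /= scalerA mulrC.
      over.
    over.
  rewrite exchange_big; over.
rewrite [RHS]exchange_big; apply: eq_bigr => i _.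
under [RHS]eq_bigr => m _ do rewrite exchange_big.
rewrite [RHS]exchange_big; apply: eq_bigr => j _.
rewrite [RHS]exchange_big; apply: eq_bigr => t _.
by rewrite scaler_suml.
Qed.

Definition antip (S : 'M[k]_n) :=
  convm S 1%:M = convm1 /\ convm 1%:M S = convm1.

Definition sweedler_mx (S : 'M[k]_n) (z : int) : 'M[k]_n :=
  match z with
  | Posz m => iter m (convm 1%:M) convm1
  | Negz m => iter m.+1 (convm S) convm1
  end.

Definition indic S (z : int) : k := \tr (sweedler_mx S (z - 1) *m S).

Lemma convE f g l t : convm f g l t =
  \sum_i \sum_j \sum_a \sum_b dc T i j l * f i a * g j b * mc T a b t.
Proof.
have -> : convm f g l t = row l (convm f g) 0 t by rewrite [RHS]mxE.
rewrite row_conv summxE; apply: eq_bigr => i _.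
rewrite summxE; apply: eq_bigr => j _; rewrite mxE mulvE mulr_sumr.
apply: eq_bigr => a _; rewrite mulr_sumr; apply: eq_bigr => b _.
by rewrite !mxE !mulrA.
Qed.

End BialgTheory.

Section Dual.
Variables (k : fieldType) (n : nat) (T : bialg k n).

Lemma conv_dual f g : convm (dual T) f^T g^T = (convm T f g)^T.
Proof.
apply/matrixP => l t; rewrite [RHS]mxE !convE /=.
under eq_bigr => a _ do rewrite exchange_big /=.
rewrite exchange_big; apply: eq_bigr => i _ /=.
under eq_bigr => a _ do rewrite exchange_big.
rewrite exchange_big /=; apply: eq_bigr => j _; apply: eq_bigr => a _.
by apply: eq_bigr => b _; rewrite !mxE; ring.
Qed.

Lemma conv1_dual : convm1 (dual T) = (convm1 T)^T.
Proof. by rewrite /convm1 trmx_mul trmxK. Qed.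

Lemma antip_dual S : antip T S -> antip (dual T) S^T.
Proof.
by case=> S1 S2; split; rewrite -[1%:M]trmx1 conv_dual conv1_dual ?S1 ?S2.
Qed.

Lemma sweedler_mx_dual S z : sweedler_mx (dual T) S^T z = (sweedler_mx T S z)^T.
Proof.
have E f m : iter m (convm (dual T) f^T) (convm1 (dual T))
    = (iter m (convm T f) (convm1 T))^T.
  by elim: m => [|m IHm]; rewrite ?iterS ?IHm ?conv_dual // conv1_dual.
case: z => m; last exact: E.
by have := E 1%:M m; rewrite trmx1.
Qed.

(** The dual of an iterated convolution is the iterated convolution of the
    duals, and the trace is insensitive to transposition and to the order of
    S and of the Sweedler power. *)
Lemma indic_dual S z : indic (dual T) S^T z = indic T S z.
Proof. by rewrite /indic sweedler_mx_dual -trmx_mul mxtrace_tr mxtrace_mulC. Qed.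

End Dual.

(** * Graded degenerations *)

Section Graded.
Variables (k : fieldType) (n : nat).
Implicit Types (c d : 'I_n -> 'I_n -> 'I_n -> k) (u e : 'rV[k]_n).
Implicit Types (w : 'I_n -> int).

(** A weight on the basis defines a decreasing filtration of the algebra and an
    increasing one of the coalgebra. The second is the first for the opposite
    weight [opw], so each statement about products yields its dual. *)
Definition filtc w c := forall i j l, c i j l != 0 -> w i + w j <= w l.
Definition filtv w u := forall i, u 0 i != 0 -> 0 <= w i.
Definition filtm w (f : 'M[k]_n) := forall i j, f i j != 0 -> w i <= w j.
Definition opw w i : int := - w i.

(** Truncation to the components of weight zero. On filtered maps it is
    compatible with composition, because weights never decrease along a
    product of nonzero coefficients: the total is zero only if every step is.
    This one remark proves all the axioms of the graded bialgebra. *)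
Definition grc w c i j l := if w i + w j == w l then c i j l else 0.
Definition grv w u : 'rV[k]_n := \row_i (if w i == 0 then u 0 i else 0).
Definition grm w (f : 'M[k]_n) : 'M[k]_n :=
  \matrix_(i, j) (if w i == w j then f i j else 0).

Ltac mask0 := by rewrite ?(if_same, mul0r, mulr0).

Ltac ifs := repeat (case: ifP => /eqP ?); rewrite ?(mulr0, mul0r) //; lia.

Lemma grc_opw w c : grc (opw w) c =2 grc w c.
Proof.
move=> i j; apply/funext => l; rewrite /grc /opw.
by rewrite -opprD eqr_opp.
Qed.

Lemma grv_opw w u : grv (opw w) u = grv w u.
Proof. by apply/rowP => i; rewrite !mxE /opw oppr_eq0. Qed.

Lemma gr_is_alg w c u : filtc w c -> filtv w u -> is_alg c u ->
  is_alg (grc w c) (grv w u).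
Proof.
move=> fc fu [/assoc_coefP cA c1l c1r]; split.
- apply/assoc_coefP => i j l t.
  have E1 h : grc w c i j h * grc w c h l t
      = if w i + w j + w l == w t then c i j h * c h l t else 0.
    rewrite /grc.
    case: (eqVneq (c i j h) 0) => [->|/fc H]; first by mask0.
    case: (eqVneq (c h l t) 0) => [->|/fc H']; first by mask0.
    ifs.
  have E2 h : grc w c j l h * grc w c i h t
      = if w i + w j + w l == w t then c j l h * c i h t else 0.
    rewrite /grc.
    case: (eqVneq (c j l h) 0) => [->|/fc H]; first by mask0.
    case: (eqVneq (c i h t) 0) => [->|/fc H']; first by mask0.
    ifs.
  under eq_bigr do rewrite E1.
  under [RHS]eq_bigr do rewrite E2.
  by case: (w i + w j + w l == w t); [apply: cA | rewrite !big1].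
- apply: linear_ext => [x a b|x a b|l]; rewrite ?mulvDr //.
  have /rowP H := c1l (delta_mx 0 l); apply/rowP => t.
  case: (eqVneq (w l) (w t)) => [E|ne].
    rewrite -{}H !mulv_deltal; apply: eq_bigr => h _; rewrite mxE /grc.
    case: (eqVneq (c h l t) 0) => [->|/fc H]; first by mask0.
    case: (eqVneq (u 0 h) 0) => [->|/fu H']; first by mask0.
    ifs.
  rewrite mulv_deltal big1 => [|h _].
    by rewrite mxE; case: (eqVneq t l) ne => [->|]; rewrite ?eqxx ?andbF.
  rewrite mxE /grc; ifs.
apply: linear_ext => [x a b|x a b|l]; rewrite ?mulvDl //.
have /rowP H := c1r (delta_mx 0 l); apply/rowP => t.
case: (eqVneq (w l) (w t)) => [E|ne].
  rewrite -{}H !mulv_deltar; apply: eq_bigr => h _; rewrite mxE /grc.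
  case: (eqVneq (c l h t) 0) => [->|/fc H]; first by mask0.
  case: (eqVneq (u 0 h) 0) => [->|/fu H']; first by mask0.
  ifs.
rewrite mulv_deltar big1 => [|h _].
  by rewrite mxE; case: (eqVneq t l) ne => [->|]; rewrite ?eqxx ?andbF.
rewrite mxE /grc; ifs.
Qed.

Lemma gr_is_aug w c e : filtc w c -> filtv (opw w) e -> is_aug c e ->
  is_aug (grc w c) (grv w e).
Proof.
move=> fc fe H.
apply: (@bilinear_ext _ _ k^o) => [b x a a'|a x b b'|b x a a'|a x b b'|i j] /=.
- by rewrite mulvDl dotDr.
- by rewrite mulvDr dotDr.
- by rewrite dotDr mulrDl -mulrA.
- by rewrite dotDr mulrDr mulrCA.
have := H (delta_mx 0 i) (delta_mx 0 j); rewrite !dot_delta !mxE.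
rewrite !dotE; under eq_bigr do rewrite mulv_delta.
move=> Hij; under eq_bigr => l _ do rewrite mulv_delta mxE.
case: (eqVneq (w i + w j) 0) => [E0|ne]; last first.
  rewrite big1 => [|l _]; last first.
    by rewrite /grc; ifs.
  ifs.
transitivity (\sum_l e 0 l * c i j l).
  apply: eq_bigr => l _; rewrite /grc.
  case: (eqVneq (c i j l) 0) => [->|/fc H1]; first by mask0.
  case: (eqVneq (e 0 l) 0) => [->|/fe H2]; first by mask0.
  move: H2; rewrite /opw; ifs.
rewrite {}Hij.
case: (eqVneq (e 0 i) 0) => [->|/fe H1]; first by mask0.
case: (eqVneq (e 0 j) 0) => [->|/fe H2]; first by mask0.
move: H1 H2; rewrite /opw; ifs.
Qed.

Lemma gr_compat w c d : filtc w c -> filtc (opw w) d -> compat_coef c d ->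
  compat_coef (grc w c) (grc w d).
Proof.
move=> fc fd H i j h l; rewrite /filtc /opw in fd.
pose b := w i + w j == w h + w l.
transitivity (if b then \sum_t c i j t * d h l t else 0).
  rewrite /b; case: eqP => ne; last first.
    by rewrite big1 // => t _; rewrite /grc; ifs.
  apply: eq_bigr => t _; rewrite /grc.
  case: (eqVneq (c i j t) 0) => [->|/fc H1]; first by mask0.
  case: (eqVneq (d h l t) 0) => [->|/fd H2]; first by mask0.
  ifs.
rewrite H /b; case: eqP => ne; last first.
  rewrite big1 // => i1 _; rewrite big1 // => i2 _; rewrite big1 // => j1 _.
  rewrite big1 // => j2 _; rewrite /grc.
  ifs.
apply: eq_bigr => i1 _; apply: eq_bigr => i2 _; apply: eq_bigr => j1 _.
apply: eq_bigr => j2 _; rewrite /grc.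
case: (eqVneq (d i1 i2 i) 0) => [->|/fd H1]; first by mask0.
case: (eqVneq (d j1 j2 j) 0) => [->|/fd H2]; first by mask0.
case: (eqVneq (c i1 j1 h) 0) => [->|/fc H3]; first by mask0.
case: (eqVneq (c i2 j2 l) 0) => [->|/fc H4]; first by mask0.
ifs.
Qed.

Definition filtered w (T : bialg k n) :=
  [/\ filtc w (mc T), filtc (opw w) (dc T), filtv w (uv T) & filtv (opw w) (ev T)].

Section GrBialg.
Variables (w : 'I_n -> int) (T : bialg k n) (fT : filtered w T).

Lemma gr_mc_alg : is_alg (grc w (mc T)) (grv w (uv T)).
Proof. by case: fT => *; apply: gr_is_alg => //; apply: mc_alg. Qed.

Lemma gr_dc_alg : is_alg (grc w (dc T)) (grv w (ev T)).
Proof.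
case: fT => *; rewrite -grv_opw.
have -> : grc w (dc T) = grc (opw w) (dc T).
  by apply/funext => i; apply/funext => j; rewrite grc_opw.
by apply: gr_is_alg => //; apply: dc_alg.
Qed.

Lemma gr_ev_aug : is_aug (grc w (mc T)) (grv w (ev T)).
Proof. by case: fT => *; apply: gr_is_aug => //; apply: ev_aug. Qed.

Lemma gr_uv_aug : is_aug (grc w (dc T)) (grv w (uv T)).
Proof.
case: fT => _ fd fu _; rewrite -grv_opw.
have -> : grc w (dc T) = grc (opw w) (dc T).
  by apply/funext => i; apply/funext => j; rewrite grc_opw.
apply: gr_is_aug => //; last exact: uv_aug.
by move=> i /fu; rewrite /opw; lia.
Qed.

Lemma gr_ev_uv : dot (grv w (ev T)) (grv w (uv T)) = 1.
Proof.
case: fT => _ _ fu fe; rewrite -(ev_uv T) !dotE; apply: eq_bigr => i _.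
rewrite !mxE; case: (eqVneq (ev T 0 i) 0) => [->|/fe H1]; first by mask0.
case: (eqVneq (uv T 0 i) 0) => [->|/fu H2]; first by mask0.
by move: H1; rewrite /opw; case: eqP => //; lia.
Qed.

Lemma gr_mc_dc : compat_coef (grc w (mc T)) (grc w (dc T)).
Proof. by case: fT => *; apply: gr_compat => //; apply: mc_dc. Qed.

Definition gr : bialg k n :=
  Bialg gr_mc_alg gr_dc_alg gr_ev_aug gr_uv_aug gr_ev_uv gr_mc_dc.

Lemma conv_gr f g : filtm w f -> filtm w g ->
  convm gr (grm w f) (grm w g) = grm w (convm T f g) /\ filtm w (convm T f g).
Proof.
case: fT => fm fd _ _ ff fg; rewrite /filtc /opw in fd.
have nz l t i j a b : dc T i j l * f i a * g j b * mc T a b t != 0 ->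
    [/\ w l <= w i + w j, w i <= w a, w j <= w b & w a + w b <= w t].
  rewrite !mulf_eq0 !negb_or => /andP[/andP[/andP[/fd H1 /ff H2] /fg H3] /fm H4].
  by split=> //; lia.
split; last first.
  move=> l t; rewrite convE leNgt; apply: contra_neqN => lt.
  rewrite big1 // => i _; rewrite big1 // => j _; rewrite big1 // => a _.
  rewrite big1 // => b _; apply/eqP/negPn/negP => /nz[? ? ? ?]; lia.
apply/matrixP => l t; rewrite [RHS]mxE !convE.
case: eqP => E; last first.
  rewrite big1 // => i _; rewrite big1 // => j _; rewrite big1 // => a _.
  rewrite big1 // => b _; rewrite !mxE /= /grc.
  ifs.
apply: eq_bigr => i _; apply: eq_bigr => j _; apply: eq_bigr => a _.
apply: eq_bigr => b _; rewrite !mxE /= /grc.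
case: (eqVneq (dc T i j l * f i a * g j b * mc T a b t) 0) => [E0|/nz[H1 H2 H3 H4]].
  by repeat (case: ifP => _); rewrite ?(mulr0, mul0r) ?E0.
by ifs.
Qed.

Lemma conv1_gr : convm1 gr = grm w (convm1 T) /\ filtm w (convm1 T).
Proof.
case: fT => _ _ fu fe; rewrite /convm1; split; last first.
  move=> i j; rewrite mxE big_ord1 !mxE mulf_eq0 negb_or => /andP[/fe H /fu].
  by move: H; rewrite /opw; lia.
apply/matrixP => i j; rewrite /= !mxE !big_ord1 !mxE.
case: (eqVneq (ev T 0 i) 0) => [->|/fe H1]; first by mask0.
case: (eqVneq (uv T 0 j) 0) => [->|/fu H2]; first by mask0.
by move: H1; rewrite /opw; ifs.
Qed.

Lemma grm1 : grm w 1%:M = 1%:M.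
Proof.
apply/matrixP => i j; rewrite !mxE.
by case: (eqVneq i j) => [->|]; rewrite ?eqxx ?if_same.
Qed.

Lemma filtm1 : filtm w 1%:M.
Proof. by move=> i j; rewrite mxE; case: (eqVneq i j) => [->|]; rewrite ?eqxx. Qed.

Lemma antip_gr S : filtm w S -> antip T S -> antip gr (grm w S).
Proof.
move=> fS [S1 S2]; split; rewrite -grm1.
  by rewrite (conv_gr fS filtm1).1 S1 conv1_gr.1.
by rewrite (conv_gr filtm1 fS).1 S2 conv1_gr.1.
Qed.

Lemma sweedler_mx_gr S z : filtm w S ->
  sweedler_mx gr (grm w S) z = grm w (sweedler_mx T S z) /\ filtm w (sweedler_mx T S z).
Proof.
move=> fS.
have E f m : filtm w f -> iter m (convm gr (grm w f)) (convm1 gr)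
    = grm w (iter m (convm T f) (convm1 T)) /\ filtm w (iter m (convm T f) (convm1 T)).
  move=> ff; elim: m => [|m [IH1 IH2]]; first exact: conv1_gr.
  by rewrite !iterS IH1; apply: conv_gr.
case: z => m; last exact: E.
by have := E _ m filtm1; rewrite grm1.
Qed.

(** A filtered matrix and its graded part have the same diagonal. *)
Lemma indic_gr S z : filtm w S -> indic gr (grm w S) z = indic T S z.
Proof.
move=> fS; have [E fP] := sweedler_mx_gr (z - 1) fS; rewrite /indic E.
apply: eq_bigr => i _; rewrite [LHS]mxE [RHS]mxE; apply: eq_bigr => j _.
rewrite !mxE; case: (eqVneq (sweedler_mx T S (z - 1) i j) 0) => [->|/fP H1]; first by mask0.
case: (eqVneq (S j i) 0) => [->|/fS H2]; first by mask0.
by ifs.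
Qed.

End GrBialg.
End Graded.

(** * Quotients and changes of basis *)

(** The quotient by the kernel of q, realized on the target of q with the help of
    a section r. When q is invertible this is a change of basis. *)
Section Quotient.
Variables (k : fieldType) (n m : nat) (T : bialg k n).
Variables (r : 'M[k]_(m, n)) (q : 'M[k]_(n, m)).
Hypothesis rq : r *m q = 1%:M.
Hypothesis qM : forall a b,
  mulv (mc T) a b *m q = mulv (mc T) (a *m q *m r) (b *m q *m r) *m q.
Hypothesis qD : forall a, a *m q = 0 -> q^T *m comulv (dc T) a *m q = 0.
Hypothesis qE : forall a, a *m q = 0 -> dot (ev T) a = 0.

Definition quo_mc i j l := (mulv (mc T) (row i r) (row j r) *m q) 0 l.
Definition quo_dc i j l := (q^T *m comulv (dc T) (row l r) *m q) i j.
Definition quo_uv : 'rV[k]_m := uv T *m q.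
Definition quo_ev : 'rV[k]_m := ev T *m r^T.

Lemma dot_mulr (a : 'rV[k]_n) (b : 'rV[k]_m) : dot (a *m q) b = dot a (b *m q^T).
Proof. by rewrite /dot trmx_mul trmxK mulmxA. Qed.

Lemma dot_mulr' (a : 'rV[k]_n) (b : 'rV[k]_m) : dot (a *m r^T) b = dot a (b *m r).
Proof. by rewrite /dot trmx_mul mulmxA. Qed.

Lemma quo_mul a b : mulv quo_mc a b = mulv (mc T) (a *m r) (b *m r) *m q.
Proof.
move: a b; apply: bilinear_ext => [b x a a'|a x b b'|b x a a'|a x b b'|i j].
- exact: mulvDl.
- exact: mulvDr.
- by rewrite mulmxDl -scalemxAl mulvDl mulmxDl scalemxAl.
- by rewrite mulmxDl -scalemxAl mulvDr mulmxDl scalemxAl.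
by apply/rowP => l; rewrite mulv_delta -!rowE.
Qed.

Lemma quo_comul a : comulv quo_dc a = q^T *m comulv (dc T) (a *m r) *m q.
Proof.
move: a; apply: linear_ext => [x a b|x a b|l].
- exact: linearP.
- rewrite mulmxDl -scalemxAl linearP /=.
  by rewrite mulmxDr mulmxDl -scalemxAr -scalemxAl.
by apply/matrixP => i j; rewrite comulv_delta -rowE.
Qed.

Lemma quo_morph a b : mulv quo_mc (a *m q) (b *m q) = mulv (mc T) a b *m q.
Proof. by rewrite quo_mul -qM. Qed.

Lemma qrB (a : 'rV[k]_n) : (a *m q *m r - a) *m q = 0.
Proof. by rewrite mulmxBl -(mulmxA (a *m q)) rq mulmx1 subrr. Qed.

Lemma quo_comulq a : comulv quo_dc (a *m q) = q^T *m comulv (dc T) a *m q.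
Proof.
rewrite quo_comul; apply/eqP; rewrite -subr_eq0 -mulmxBl -mulmxBr -linearB.
by rewrite qD ?qrB.
Qed.

Lemma quo_evq (a : 'rV[k]_n) : dot (ev T) (a *m q *m r) = dot (ev T) a.
Proof.
by have := qE (qrB a); rewrite -scaleN1r addrC dotDr mulN1r addrC => /eqP; rewrite subr_eq0 => /eqP.
Qed.

Lemma quo_evE : quo_ev *m q^T = ev T.
Proof.
by apply: dot_inj => a; rewrite dotC -dot_mulr dotC dot_mulr' quo_evq.
Qed.

(** The dual of a quotient is a subalgebra of the dual, embedded by the
    transpose of q. *)
Lemma quo_dual_mul f g :
  mulv (dc T) (f *m q^T) (g *m q^T) = mulv quo_dc f g *m q^T.
Proof.
apply: dot_inj => a; rewrite [RHS]dotC -dot_mulr [RHS]dotC !dot_mulv quo_comulq.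
by rewrite !mulmxA [RHS]dot_mulr.
Qed.

Lemma qT_inj (a b : 'rV[k]_m) : a *m q^T = b *m q^T -> a = b.
Proof.
move=> /(congr1 (mulmx^~ r^T)); rewrite -!mulmxA -trmx_mul rq trmx1.
by rewrite !mulmx1.
Qed.

Lemma quo_mc_alg : is_alg quo_mc quo_uv.
Proof.
have E (a : 'rV[k]_m) : exists a', a = a' *m q.
  by exists (a *m r); rewrite -mulmxA rq mulmx1.
split=> [a b c|a|a].
- have [a' ->] := E a; have [b' ->] := E b; have [c' ->] := E c.
  by rewrite !quo_morph mcA.
- by have [a' ->] := E a; rewrite quo_morph mc1l.
- by have [a' ->] := E a; rewrite quo_morph mc1r.
Qed.

Lemma quo_dc_alg : is_alg quo_dc quo_ev.
Proof.
case: (dc_alg T) => dA d1l d1r.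
split=> [a b c|a|a]; apply: qT_inj; rewrite -!quo_dual_mul ?quo_evE //.
Qed.

Lemma quo_ev_aug : is_aug quo_mc quo_ev.
Proof.
move=> a b; rewrite quo_mul !dot_mulr' quo_evq; exact: ev_aug.
Qed.

Lemma quo_uv_aug : is_aug quo_dc quo_uv.
Proof. by move=> a b; rewrite !dot_mulr -quo_dual_mul uv_aug. Qed.

Lemma quo_ev_uv : dot quo_ev quo_uv = 1.
Proof. by rewrite dot_mulr' quo_evq ev_uv. Qed.

Lemma sum_pure_ext (V : lmodType k) (f g : 'M[k]_n -> V) : linear f -> linear g ->
  (forall a b : 'rV[k]_n, f (a^T *m b) = g (a^T *m b)) -> f =1 g.
Proof.
move=> lf lg fg s.
pose F := HB.pack_for {linear 'M[k]_n -> V} f (GRing.isLinear.Build k _ _ _ f lf).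
pose G := HB.pack_for {linear 'M[k]_n -> V} g (GRing.isLinear.Build k _ _ _ g lg).
rewrite -[f s]/(F s) -[g s]/(G s) [s]matrix_sum_delta !linear_sum.
apply: eq_bigr => i _; rewrite !linear_sum; apply: eq_bigr => j _.
rewrite !linearZ /=; congr (_ *: _).
by rewrite -(mul_delta_mx (0 : 'I_1)) -[X in X *m _]trmxK trmx_delta.
Qed.

Lemma quo_mulmap s : mulmap quo_mc (q^T *m s *m q) = mulmap (mc T) s *m q.
Proof.
move: s; apply: sum_pure_ext => [x s t|x s t|a b].
- by rewrite mulmxDr mulmxDl -scalemxAr -scalemxAl linearP.
- by rewrite linearP mulmxDl scalemxAl.
by rewrite mulmxA -trmx_mul -mulmxA -!/(mulv _ _ _) quo_morph.
Qed.

Lemma quo_tmul s t :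
  tmul quo_mc (q^T *m s *m q) (q^T *m t *m q) = q^T *m tmul (mc T) s t *m q.
Proof.
move: s; apply: sum_pure_ext => [x s s'|x s s'|a a'].
- by rewrite mulmxDr mulmxDl -scalemxAr -scalemxAl tmulDl.
- by rewrite tmulDl mulmxDr mulmxDl -scalemxAr -scalemxAl.
move: t; apply: sum_pure_ext => [x s s'|x s s'|b b'].
- rewrite [q^T *m (x *: s + s')]mulmxDr [X in tmul _ _ X]mulmxDl.
  by rewrite -[q^T *m (_ *: _)]scalemxAr -[_ *: _ *m q]scalemxAl tmulDr.
- by rewrite tmulDr mulmxDr mulmxDl -scalemxAr -scalemxAl.
rewrite tmul_pure !mulmxA -!trmx_mul -!mulmxA.
by rewrite tmul_pure !quo_morph !trmx_mul !mulmxA.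
Qed.

Lemma quo_mc_dc : compat_coef quo_mc quo_dc.
Proof.
apply/compat_coefP => a b; rewrite quo_mul quo_comulq comulvM -quo_tmul.
by rewrite -!quo_comul.
Qed.

Definition quo : bialg k m :=
  Bialg quo_mc_alg quo_dc_alg quo_ev_aug quo_uv_aug quo_ev_uv quo_mc_dc.

(** g is the endomorphism induced by f on the quotient. *)
Definition qrel (f : 'M[k]_n) (g : 'M[k]_m) := f *m q = q *m g.

Lemma conv_qrel f f' g g' : qrel f f' -> qrel g g' ->
  qrel (convm T f g) (convm quo f' g').
Proof.
move=> ff gg; apply/row_matrixP => i; rewrite !rowE mulmxA mul_conv.
rewrite mulmxA (mul_conv quo) -quo_mulmap quo_comulq !mulmxA -trmx_mul ff trmx_mul.
by rewrite -!mulmxA gg.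
Qed.

Lemma conv1_qrel : qrel (convm1 T) (convm1 quo).
Proof.
rewrite /qrel /convm1 /= -mulmxA [RHS]mulmxA; congr (_ *m _).
by rewrite -[q in RHS]trmxK -trmx_mul quo_evE.
Qed.

Lemma qrel_inj f g g' : qrel f g -> qrel f g' -> g = g'.
Proof.
by rewrite /qrel => -> /(congr1 (mulmx r)); rewrite !mulmxA rq !mul1mx.
Qed.

Lemma qrel1 : qrel 1%:M 1%:M. Proof. by rewrite /qrel mul1mx mulmx1. Qed.

Lemma antip_quo S S' : qrel S S' -> antip T S -> antip quo S'.
Proof.
move=> SS [S1 S2]; split; apply: qrel_inj conv1_qrel.
  by rewrite -S1; apply: conv_qrel qrel1.
by rewrite -S2; apply: conv_qrel qrel1 _.
Qed.

Lemma iter_conv_qrel f f' i : qrel f f' ->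
  qrel (iter i (convm T f) (convm1 T)) (iter i (convm quo f') (convm1 quo)).
Proof.
move=> ff; elim: i => [|i IHi]; first exact: conv1_qrel.
by rewrite !iterS; apply: conv_qrel.
Qed.

Lemma sweedler_mx_quo S S' z : qrel S S' -> qrel (sweedler_mx T S z) (sweedler_mx quo S' z).
Proof.
by move=> SS; case: z => i; apply: iter_conv_qrel => //; apply: qrel1.
Qed.

End Quotient.

(** * Commutative bialgebras *)

Section IteratedProducts.
Variables (k : fieldType) (n : nat) (c : 'I_n -> 'I_n -> 'I_n -> k).
Implicit Types (P W : 'rV[k]_n -> Prop).

(** [prod_chain P W i] is the additive span of the products x1 (x2 (... (xi w)))
    with factors x in P and w in W; for an ideal P and W the whole algebra it
    is the power P^i. As a predicate it requires no subspace to be built. *)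
Inductive prod_chain P W : nat -> 'rV[k]_n -> Prop :=
| chain_base v : W v -> prod_chain P W 0 v
| chain_zero i : prod_chain P W i.+1 0
| chain_step i x y z : P x -> prod_chain P W i y -> prod_chain P W i.+1 z ->
    prod_chain P W i.+1 (mulv c x y + z).

Definition nilpot P W := exists N, forall v, prod_chain P W N v -> v = 0.

Lemma chain_mul P W i x y : P x -> prod_chain P W i y -> prod_chain P W i.+1 (mulv c x y).
Proof. by move=> Px Wy; rewrite -[mulv _ _ _]addr0; apply: chain_step => //; apply: chain_zero. Qed.

End IteratedProducts.

Definition full_pred (k : fieldType) (n : nat) (v : 'rV[k]_n) := True.
Definition orth (k : fieldType) (n : nat) (e v : 'rV[k]_n) := dot e v = 0.

Section MatrixPowers.
Variables (k : fieldType) (n : nat).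
Implicit Types A : 'M[k]_n.

Lemma mulmxXr A i : A ^+ i.+1 = A ^+ i *m A. Proof. exact: exprSr. Qed.
Lemma mulmxXl A i : A ^+ i.+1 = A *m A ^+ i. Proof. exact: exprS. Qed.
Lemma mulmxX0 A : A ^+ 0 = 1%:M. Proof. exact: expr0. Qed.
Lemma mulmxXD A i j : A ^+ (i + j) = A ^+ i *m A ^+ j. Proof. exact: exprD. Qed.

Lemma trmxX A i : A^T ^+ i = (A ^+ i)^T.
Proof.
by elim: i => [|i IHi]; rewrite ?mulmxX0 ?trmx1 // mulmxXr mulmxXl trmx_mul IHi.
Qed.

End MatrixPowers.

Section Binomial.
Variable k : fieldType.

(** The vanishing binomials make a |-> a^r additive on the image of the natural
    numbers in k, hence the identity there, so that
    (m - 1)(1 + m + ... + m^(r-1)) = m^r - 1 = m - 1. *)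
Lemma geometric_sum_order (r m : nat) : (1 < r)%N ->
  (forall i, (0 < i < r)%N -> 'C(r, i)%:R = 0 :> k) ->
  \sum_(j < r) (m%:R ^+ j) = (if m%:R == 1 :> k then 0 else 1) :> k.
Proof.
move=> r1 Cr.
have frob a : a%:R ^+ r = a%:R :> k.
  case: r r1 Cr => // r r1 Cr; elim: a => [|a IHa]; first by rewrite expr0n.
  rewrite -addn1 natrD exprDn big_ord_recr big_ord_recl /= subn0 subnn bin0 binn.
  rewrite !expr0 expr1n !mulr1 !mulr1n IHa big1 ?addr0 // => i _.
  by rewrite -mulr_natr Cr ?mulr0 //= /bump leq0n add1n ltnS ltn_ord.
have [->|m1] := eqVneq (m%:R : k) 1.
  under eq_bigr do rewrite expr1n.
  rewrite sumr_const card_ord -(Cr 1%N) ?bin1 //.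
apply: (@mulfI _ (m%:R - 1)); first by rewrite subr_eq0.
by rewrite -subrX1 frob mulr1.
Qed.

End Binomial.

Section Primitive.
Variables (k : fieldType) (n : nat) (T : bialg k n).
Hypothesis cm : commutative (mulv (mc T)).
Hypothesis nilA : nilpot (mc T) (orth (ev T)) (@full_pred k n).
Hypothesis nilD : nilpot (dc T) (orth (uv T)) (@full_pred k n).
Notation V := 'rV[k]_n.
Implicit Types a b f : V.
Notation mul := (mulv (mc T)).
Notation delta := (comulv (dc T)).

Definition primitive (x : V) := delta x = x^T *m uv T + (uv T)^T *m x.

Lemma dim_gt0 : (0 < n)%N.
Proof.
rewrite lt0n; apply/eqP => n0; have := ev_uv T; rewrite dotE big1.
  by move/esym/eqP; rewrite oner_eq0.
  by move=> i _; have := ltn_ord i; rewrite {2}n0.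
Qed.

(** Among the vectors v outside the line of 1, take one killed by all products of t
    functionals of the dual augmentation ideal, with t minimal. Contracting v
    with one such functional lowers t, so the result lies on the line of 1;
    subtracting eps(v) 1 makes v primitive. *)
Lemma exists_primitive : n != 1%N -> exists2 x, primitive x & x != 0 /\ dot (ev T) x = 0.
Proof.
move=> n1.
have [v0 v0P] : exists v : V, forall c, v != c *: uv T.
  have : exists i, uv T 0 i != 0.
    apply: contrapT => /forallNP u0; have /esym/eqP := ev_uv T.
    rewrite dotE big1 ?oner_eq0 // => i _.
    by have /negP/negPn/eqP-> := u0 i; rewrite mulr0.
  case=> i ui; have [j ji] : exists j, j != i.
    have n2 : (1 < n)%N by rewrite ltn_neqAle eq_sym n1 dim_gt0.
    case: (eqVneq i (Ordinal (ltnW n2))) => [->|ni]; last by exists (Ordinal (ltnW n2)); rewrite eq_sym.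
    by exists (Ordinal n2).
  exists (delta_mx 0 j) => c; apply/negP => /eqP E.
  have /rowP/(_ i) := E; rewrite !mxE eq_sym (negPf ji) andbF.
  move/esym/eqP; rewrite mulf_eq0 (negPf ui) orbF => /eqP c0.
  have /rowP/(_ j) := E; rewrite c0 !mxE !eqxx mul0r => /eqP.
  by rewrite oner_eq0.
pose Q t := `[< exists2 v : V, forall c, v != c *: uv T &
   forall f, prod_chain (dc T) (orth (uv T)) (@full_pred k n) t f -> dot f v = 0 >].
have exQ : exists t, Q t.
  case: nilD => N NP; exists N; apply/asboolP; exists v0 => // f /NP->.
  by rewrite /dot mul0mx mxE.
case: (ex_minnP exQ) => t /asboolP[v vP vt] tmin.
have prim f : dot (uv T) f = 0 -> exists c, f *m delta v = c *: uv T.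
  move=> f1; apply: contrapT => /forallNP E.
  case: t vt tmin => [vt _|t vt tmin].
    apply/negP: (vP 0); rewrite negbK scale0r; apply/eqP/dot_inj => g.
    by rewrite dotC vt ?/dot ?mul0mx ?mxE //; apply: chain_base.
  suff /tmin : Q t by rewrite ltnn.
  apply/asboolP; exists (f *m delta v) => [c|g pg]; first by apply/eqP/E.
  by rewrite dotC -dot_mulv; apply: vt; apply: chain_mul.
pose x := v - dot (ev T) v *: uv T.
have ex : dot (ev T) x = 0.
  by rewrite /x addrC -scaleNr dotDr ev_uv mulr1 addNr.
have xP f : dot (uv T) f = 0 -> f *m delta x = dot f x *: uv T.
  move=> f1; have [c fv] := prim f f1.
  have fx : f *m delta x = c *: uv T.
    rewrite linearB linearZ /= mulmxBr fv -scalemxAr comulv_uv mulmxA.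
    rewrite [f *m (uv T)^T]mx11_scalar -/(dot f (uv T)) (dotC f) f1.
    by rewrite mul_scalar_mx scale0r scaler0 subr0.
  rewrite fx; congr (_ *: _).
  have := dot_mulv (dc T) f (ev T) x; case: (dc_alg T) => _ _ ->.
  rewrite fx => ->; rewrite -[c *: _]addr0 dotDl (dotC (uv T)) ev_uv mulr1.
  by rewrite /dot mul0mx mxE addr0.
exists x; last first.
  split=> //; apply/eqP => x0; apply/negP: (vP (dot (ev T) v)).
  by rewrite negbK -subr_eq0 -/x x0.
apply: matrix_dot_ext => f g.
have [f0 [f01 fE]] : exists f0, dot (uv T) f0 = 0 /\ f = dot (uv T) f *: ev T + f0.
  exists (f - dot (uv T) f *: ev T); split; last by rewrite addrC subrK.
  by rewrite addrC -scaleNr dotDr (dotC _ (ev T)) ev_uv mulr1 addNr.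
rewrite mulmxDr mulmxDl !mulmxA {1}fE mulmxDl -scalemxAl ev_comulv xP //.
rewrite [f *m x^T]mx11_scalar [f *m (uv T)^T]mx11_scalar !mul_scalar_mx.
rewrite -/(dot f x) -/(dot f (uv T)) {2}fE dotDl ex mulr0 add0r addrC.
by rewrite mulmxDl [dot f (uv T)]dotC.
Qed.

Variable x : V.
Hypothesis (px : primitive x) (ex : dot (ev T) x = 0).

Definition mulx : 'M[k]_n := lin1_mx (mul x).
Notation X := mulx.

Lemma mulxE a : a *m X = mul x a. Proof. by rewrite mul_rV_lin1. Qed.

(** Multiplication by a primitive x acts on coproducts as x (x) 1 + 1 (x) x, a
    sum of two commuting operators; hence the binomial formula
    [comulv_mulxn]. *)
Lemma comulv_mulx a : delta (a *m X) = X^T *m delta a + delta a *m X.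
Proof.
rewrite mulxE comulvM px -[x^T *m _]scale1r tmulDl scale1r.
move: (delta a) => t; congr (_ + _); move: t; apply: sum_pure_ext => [y s t|y s t|b b'].
- exact: tmulDr.
- by rewrite mulmxDr scalemxAr.
- by rewrite tmul_pure mc1l mulmxA -trmx_mul mulxE.
- exact: tmulDr.
- by rewrite mulmxDl scalemxAl.
- by rewrite tmul_pure mc1l -mulmxA mulxE.
Qed.

Lemma mulx_exprE a i : a *m X ^+ i = mul (uv T *m X ^+ i) a.
Proof.
elim: i => [|i IHi]; first by rewrite mulmxX0 !mulmx1 mc1l.
by rewrite mulmxXr !mulmxA IHi !mulxE mcA.
Qed.

Lemma mulx_chain a i : prod_chain (mc T) (orth (ev T)) (@full_pred k n) i (a *m X ^+ i).
Proof.
elim: i => [|i IHi]; first exact: chain_base.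
by rewrite mulmxXr mulmxA mulxE; apply: chain_mul.
Qed.

Lemma mulx_nilp : exists N, X ^+ N = 0.
Proof.
case: nilA => N NP; exists N; apply/row_matrixP => i.
by rewrite row0 rowE; apply/NP/mulx_chain.
Qed.

Lemma mulx_neq0 : x != 0 -> X != 0.
Proof.
by apply: contraNneq => X0; rewrite -(mc1r T x) -mulxE X0 mulmx0.
Qed.

Lemma comulv_mulxn a i : delta (a *m X ^+ i) =
  \sum_(j < i.+1) 'C(i, j)%:R *: ((X^T) ^+ j *m delta a *m X ^+ (i - j)).
Proof.
(* Pascal's rule, with y j l = (x^j (x) x^l) Delta(a). *)
pose y j l := (X^T) ^+ j *m delta a *m X ^+ l.
have yl j l : X^T *m y j l = y j.+1 l by rewrite /y !mulmxA -mulmxXl.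
have yr j l : y j l *m X = y j l.+1 by rewrite /y -mulmxA -mulmxXr.
rewrite -/(y _ _); elim: i => [|i IHi].
  by rewrite big_ord1 scale1r /y !mulmxX0 !mulmx1 mul1mx.
rewrite mulmxXr mulmxA comulv_mulx IHi mulmx_sumr mulmx_suml.
under eq_bigr => j _ do rewrite -scalemxAr yl.
under [X in _ + X = _]eq_bigr => j _ do rewrite -scalemxAl yr.
rewrite [RHS]big_ord_recl [X in _ + X = _]big_ord_recl /= !bin0 !subn0 addrCA.
congr (_ + _); under [RHS]eq_bigr => j _.
  rewrite /bump leq0n add1n binS natrD scalerDl subSS; over.
rewrite big_split /= addrC; congr (_ + _).
rewrite [RHS]big_ord_recr /= bin_small // scale0r addr0.
by apply: eq_bigr => j _; rewrite /bump leq0n add1n subnSK.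
Qed.

Lemma exists_order : x != 0 ->
  exists2 r, (1 < r)%N & X ^+ r = 0 /\ X ^+ r.-1 != 0.
Proof.
move=> x0; have exN : exists N, X ^+ N == 0.
  by case: mulx_nilp => N NP; exists N; apply/eqP.
case: (ex_minnP exN) => r /eqP Xr rmin.
have r1 : (1 < r)%N.
  case: r Xr {rmin} => [|[|//]] X0; have := mulx_neq0 x0; last by rewrite -X0 eqxx.
  by rewrite -[X]mul1mx -(mulmxX0 X) X0 mul0mx eqxx.
exists r => //; split=> //; apply/negP => /rmin.
by rewrite -[X in (X <= _)%N](prednK (ltnW r1)) ltnn.
Qed.

Variable r : nat.
Hypotheses (r1 : (1 < r)%N) (Xr : X ^+ r = 0) (Xr' : X ^+ r.-1 != 0).

Lemma mulx_order0 i : (r <= i)%N -> X ^+ i = 0.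
Proof. by move/subnKC <-; rewrite mulmxXD Xr mul0mx. Qed.

Lemma uv_mulx_neq0 : uv T *m X ^+ r.-1 != 0.
Proof.
apply: contraNneq Xr' => y0; apply/eqP/row_matrixP => i.
by rewrite row0 rowE mulx_exprE y0 -mulvrE linear0.
Qed.

(** The coproduct of x^r = 0 is the sum of the terms C(r, j) x^j (x) x^(r-j).
    Multiplying by x^(r-1-i) (x) x^(i-1) annihilates all of them except j = i,
    which becomes C(r, i) times the nonzero tensor x^(r-1) (x) x^(r-1). *)
Lemma bin_order0 i : (0 < i < r)%N -> 'C(r, i)%:R = 0 :> k.
Proof.
case/andP=> i0 ir; have := comulv_mulxn (uv T) r.
rewrite Xr mulmx0 linear0 comulv_uv => /(congr1 (fun s => (X^T) ^+ (r.-1 - i) *m s *m X ^+ i.-1)).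
rewrite mulmx0 mul0mx mulmx_sumr mulmx_suml.
pose y := uv T *m X ^+ r.-1.
have lt_i : (i < r.+1)%N by lia.
rewrite (bigD1 (Ordinal lt_i)) //= big1 ?addr0 => [|[j jr] /= ji].
  rewrite -scalemxAr -scalemxAl !mulmxA -mulmxXD -!mulmxA -mulmxXD.
  have -> : (r.-1 - i + i = r.-1)%N by lia.
  have -> : (r - i + i.-1 = r.-1)%N by lia.
  rewrite trmxX mulmxA -trmx_mul -/y => /esym/eqP.
  rewrite scaler_eq0 => /orP[/eqP//|]; have : y != 0 := uv_mulx_neq0.
  case/rV0Pn=> l yl /eqP/matrixP/(_ l l); rewrite !mxE big_ord1 mxE => /eqP.
  by rewrite mulf_eq0 orbb (negPf yl).
have {}ji : j != i by apply: contra ji => /eqP E; apply/eqP/val_inj.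
rewrite -scalemxAr -scalemxAl !mulmxA -mulmxXD -!mulmxA -mulmxXD.
case: (ltngtP j i) ji => // ji _; last first.
  by rewrite trmxX mulx_order0 ?trmx0 ?mul0mx ?scaler0 //; lia.
by rewrite (@mulx_order0 (r - j + i.-1)) ?mulmx0 ?scaler0 //; lia.
Qed.

(** The operator a |-> f(a1) a2. *)
Definition contract (f : V) : 'M[k]_n := lin1_mx (fun a => f *m delta a).

Lemma contractE f a : a *m contract f = f *m delta a.
Proof.
rewrite /contract; move: a; apply: linear_ext => [y a b|y a b|i].
- by rewrite mulmxDl scalemxAl.
- by rewrite linearP mulmxDr scalemxAr.
by rewrite -rowE; apply/rowP => j; rewrite !mxE.
Qed.

Lemma ev_mulx a : dot (ev T) (a *m X) = 0.
Proof. by rewrite mulxE ev_aug ex mul0r. Qed.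

(** If eps(a) <> 0 then a is, up to a scalar, 1 - b with b in the augmentation
    ideal, so a x^(r-1) = 0 gives x^(r-1) = b x^(r-1), which lies in every
    power of that ideal. *)
Lemma mulx_kill a : a *m X ^+ r.-1 = 0 -> dot (ev T) a = 0.
Proof.
move=> a0; apply: contrapT => /eqP e0; have /negP := Xr'; case.
pose b := uv T - (dot (ev T) a)^-1 *: a.
have eb : dot (ev T) b = 0.
  by rewrite /b addrC -scaleNr dotDr ev_uv mulNr mulVf // addNr.
pose z := uv T *m X ^+ r.-1.
have zb : z = mul b z.
  rewrite cm /z -mulx_exprE /b mulmxBl -scalemxAl a0 scaler0 subr0.
  by [].
have zpw i : prod_chain (mc T) (orth (ev T)) (@full_pred k n) i z.
  elim: i => [|i IHi]; first exact: chain_base.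
  by rewrite zb; apply: chain_mul.
case: nilA => N NP; have := uv_mulx_neq0; rewrite -/z (NP z) ?eqxx //.
Qed.

(** The freeness of the algebra over k[x]. By [mulx_kill] some functional f
    satisfies f(x^(r-1) b) = eps(b). Contraction by f and by f(x -) differ by a
    commutator with x; on the kernel of x every such commutator amounts, up to
    sign, to one right multiplication by X, and after r - 1 of them the
    contraction is by eps, that is, the identity. *)
Lemma mulx_ker a : a *m X = 0 -> exists b : V, a = b *m X ^+ r.-1.
Proof.
move=> aX.
have [f fE] : exists f : V, f *m (X^T) ^+ r.-1 = ev T.
  suff /submxP[f ->] : (ev T <= (X^T) ^+ r.-1)%MS by exists f.
  rewrite submxE; apply/eqP/rowP => j; rewrite [RHS]mxE.
  pose c : V := (col j (cokermx ((X^T) ^+ r.-1)))^T.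
  have -> : (ev T *m cokermx ((X^T) ^+ r.-1)) 0 j = dot (ev T) c.
    by rewrite /dot /c trmxK colE mulmxA -colE [RHS]mxE.
  apply: mulx_kill; rewrite /c; apply: trmx_inj; rewrite trmx_mul trmxK -trmxX.
  by rewrite colE mulmxA mulmx_coker mul0mx trmx0.
have step i : exists b : V, a *m contract (f *m (X^T) ^+ i) = b *m X ^+ i.
  elim: i => [|i [b IHi]]; first by exists (a *m contract f); rewrite !mulmxX0 !mulmx1.
  exists (- b); rewrite contractE mulmxXr mulmxXr mulmxA mulNmx mulmxA -IHi contractE.
  rewrite -!mulmxA.
  have := comulv_mulx a; rewrite aX linear0 => /esym/eqP; rewrite addr_eq0 => /eqP->.
  by rewrite !mulmxN.
have [b] := step r.-1; rewrite fE contractE ev_comulv => ->; by exists b.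
Qed.

End Primitive.

Section TraceQuotient.
Variables (k : fieldType) (n m r : nat).
Variables (X f : 'M[k]_n) (q : 'M[k]_(n, m)) (s : 'M[k]_(m, n)) (c : k).
Hypotheses (r1 : (1 < r)%N) (Xr : X ^+ r = 0) (Xq : X *m q = 0) (sq : s *m q = 1%:M).
Hypothesis kerX : forall a : 'rV_n, a *m X = 0 -> (a <= X ^+ r.-1)%MS.
Hypothesis kerq : forall a : 'rV_n, a *m q = 0 -> (a <= X)%MS.
Hypothesis Xf : X *m f = c *: (f *m X).

(** With s a section of q, 1 - q s = Z X for some Z, and iterating
    gives 1 = sum_(j < r) Z^j q s X^j. Moving X^j through f costs c^j, and by
    the trace property it meets Z^j q, where X^j Z^j q = q: indeed X Z - 1
    takes its values in the kernel of X, which is the image of X^(r-1). *)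
Lemma trace_quotient : \tr f = (\sum_(j < r) c ^+ j) * \tr (s *m f *m q).
Proof.
have /submxP[Z ZX] : (1%:M - q *m s <= X)%MS.
  apply/row_subP => i; apply: kerq; rewrite -row_mul mulmxBl mul1mx -mulmxA sq.
  by rewrite mulmx1 subrr row0.
have E1 : 1%:M = q *m s + Z *m X by rewrite -ZX addrC subrK.
have /submxP[Y XZ] : (X *m Z - 1%:M <= X ^+ r.-1)%MS.
  apply/row_subP => i; apply: kerX; rewrite -row_mul mulmxBl mul1mx -mulmxA -ZX.
  by rewrite mulmxBr mulmx1 mulmxA Xq mul0mx subr0 subrr row0.
have {}XZ : X *m Z = 1%:M + Y *m X ^+ r.-1 by rewrite -XZ addrC subrK.
(* The error term Y X^(r-1) of X Z meets X^(r-j) q, which is zero. *)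
have XZq j : (j < r)%N -> X ^+ j *m Z ^+ j *m q = q.
  elim: j => [|j IHj] jr; first by rewrite !mulmxX0 !mul1mx.
  rewrite mulmxXr mulmxXl -!mulmxA (mulmxA X) XZ !mulmxDl mul1mx mulmxDr.
  rewrite mulmxA IHj ?(ltnW jr) // -[RHS]addr0; congr (_ + _).
  have -> : (r.-1 = (r.-1 - j) + j)%N by lia.
  rewrite mulmxXD -!mulmxA [X ^+ j *m (Z ^+ j *m q)]mulmxA IHj ?(ltnW jr) //.
  have -> : (r.-1 - j = (r.-1 - j).-1.+1)%N by lia.
  by rewrite mulmxXr -!mulmxA Xq !mulmx0.
have Xjf j : X ^+ j *m f = c ^+ j *: (f *m X ^+ j).
  elim: j => [|j IHj]; first by rewrite !mulmxX0 mul1mx mulmx1 expr0 scale1r.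
  rewrite mulmxXl -mulmxA IHj -scalemxAr (mulmxA X f) Xf -scalemxAl scalerA -exprSr.
  by rewrite -mulmxA -mulmxXl.
have expand j : 1%:M = \sum_(i < j) Z ^+ i *m q *m s *m X ^+ i + Z ^+ j *m X ^+ j.
  elim: j => [|j IHj]; first by rewrite big_ord0 !mulmxX0 mulmx1 add0r.
  rewrite IHj big_ord_recr -addrA; congr (_ + _).
  rewrite mulmxXr mulmxXl -[X in Z ^+ j *m X]mul1mx E1 mulmxDl mulmxDr /=.
  by rewrite !mulmxA.
rewrite -[f in LHS]mul1mx (expand r) Xr mulmx0 addr0 mulmx_suml raddf_sum mulr_suml.
apply: eq_bigr => j _ /=; rewrite -!mulmxA Xjf -!scalemxAr linearZ /=; congr (_ * _).
rewrite mxtrace_mulC -!mulmxA mxtrace_mulC -!mulmxA.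
by rewrite [X ^+ j *m (_ *m q)]mulmxA XZq ?ltn_ord.
Qed.

End TraceQuotient.

Section SweedlerPowers.
Variables (k : fieldType) (n : nat) (T : bialg k n).

Definition conv_pow (i : nat) : 'M[k]_n := iter i (convm T 1%:M) (convm1 T).

(** The i-th Sweedler power P satisfies P(x a) = i x P(a) for x primitive and
    central: each of the i tensor factors contributes one copy of x. *)
Lemma mulx_conv_pow (cm : commutative (mulv (mc T))) x i :
  primitive T x -> dot (ev T) x = 0 ->
  mulx T x *m conv_pow i = i%:R *: (conv_pow i *m mulx T x).
Proof.
move=> px ex; have mX (s : 'M[k]_n) :
    mulmap (mc T) (s *m mulx T x) = mulmap (mc T) s *m mulx T x.
  move: s; apply: sum_pure_ext => [y s t|y s t|a b].
  - by rewrite mulmxDl -scalemxAl linearP.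
  - by rewrite linearP mulmxDl scalemxAl.
  by rewrite -mulmxA -!/(mulv _ _ _) !mulxE !mcA (cm x).
have Xm (s : 'M[k]_n) :
    mulmap (mc T) ((mulx T x)^T *m s) = mulmap (mc T) s *m mulx T x.
  move: s; apply: sum_pure_ext => [y s t|y s t|a b].
  - by rewrite mulmxDr -scalemxAr linearP.
  - by rewrite linearP mulmxDl scalemxAl.
  by rewrite mulmxA -trmx_mul -!/(mulv _ _ _) !mulxE mcA.
elim: i => [|i IHi].
  rewrite scale0r; apply/row_matrixP => j; rewrite row0 rowE mulmxA /conv_pow /=.
  rewrite /convm1 mulmxA [_ *m (ev T)^T]mx11_scalar -/(dot _ _) dotC ev_mulx //.
  by rewrite mul_scalar_mx scale0r.
apply/row_matrixP => j; rewrite !rowE -scalemxAr !mulmxA /conv_pow !iterS -/(conv_pow i).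
rewrite !mul_conv comulv_mulx // mulmxDr mulmxDl trmx1 !mul1mx.
rewrite -(mulmxA _ (mulx T x)) IHi linearD /= -mulmxA Xm.
rewrite -scalemxAr linearZ /= mulmxA mX -natr1 scalerDl scale1r.
by rewrite addrC.
Qed.

Lemma uv_conv_pow i : uv T *m conv_pow i = uv T.
Proof.
elim: i => [|i IHi].
  rewrite /conv_pow /= /convm1 mulmxA [uv T *m _]mx11_scalar -/(dot _ _) dotC ev_uv.
  exact: mul1mx.
rewrite /conv_pow iterS -/(conv_pow i) mul_conv comulv_uv trmx1 mul1mx -mulmxA IHi.
by rewrite -/(mulv _ _ _) mc1l.
Qed.

End SweedlerPowers.

Section QuotientByPrimitive.
Variables (k : fieldType) (n : nat) (T : bialg k n).
Hypothesis cm : commutative (mulv (mc T)).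
Hypothesis nilA : nilpot (mc T) (orth (ev T)) (@full_pred k n).
Hypothesis nilD : nilpot (dc T) (orth (uv T)) (@full_pred k n).
Variable x : 'rV[k]_n.
Hypotheses (px : primitive T x) (ex : dot (ev T) x = 0) (x0 : x != 0).
Variables (m : nat) (q : 'M[k]_(n, m)) (s : 'M[k]_(m, n)).
Hypotheses (sq : s *m q = 1%:M) (Xq : mulx T x *m q = 0).
Hypothesis kerq : forall a : 'rV_n, a *m q = 0 -> (a <= mulx T x)%MS.

Lemma prim_quo_M a b : mulv (mc T) a b *m q
  = mulv (mc T) (a *m q *m s) (b *m q *m s) *m q.
Proof.
have K a' b' : mulv (mc T) (a' *m q *m s) b' *m q = mulv (mc T) a' b' *m q.
  apply/eqP; rewrite -subr_eq0 -mulmxBl.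
  rewrite -(mulvrE _ b' (a' *m q *m s)) -(mulvrE _ b' a') -linearB /=.
  have /submxP[z ->] : (a' *m q *m s - a' <= mulx T x)%MS.
    by apply: kerq; rewrite mulmxBl -(mulmxA (a' *m q)) sq mulmx1 subrr.
  by rewrite mulvrE mulxE -mcA -mulxE -mulmxA Xq mulmx0.
by rewrite K (cm a (b *m q *m s)) K cm.
Qed.

Lemma prim_quo_D a : a *m q = 0 -> q^T *m comulv (dc T) a *m q = 0.
Proof.
move=> /kerq/submxP[z ->]; rewrite comulv_mulx // mulmxDr mulmxDl.
by rewrite mulmxA -trmx_mul Xq trmx0 !mul0mx -!mulmxA Xq !mulmx0 addr0.
Qed.

Lemma prim_quo_E a : a *m q = 0 -> dot (ev T) a = 0.
Proof. by move=> /kerq/submxP[z ->]; rewrite ev_mulx. Qed.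

Definition prim_quo := quo sq prim_quo_M prim_quo_D prim_quo_E.

Lemma prim_quo_comm : commutative (mulv (mc prim_quo)).
Proof. by move=> a b; rewrite /= !quo_mul cm. Qed.

Lemma prim_quo_nilA : nilpot (mc prim_quo) (orth (ev prim_quo)) (@full_pred k m).
Proof.
case: nilA => N NP; exists N => v pv.
suff [w pww ->] : exists2 w, prod_chain (mc T) (orth (ev T)) (@full_pred k n) N w & v = w *m q.
  by rewrite (NP w) // mul0mx.
elim: pv => [{}v _|i|i {}x' y z Px _ [w pww ->] _ [w' pww' ->]].
- by exists (v *m s); [apply: chain_base | rewrite -mulmxA sq mulmx1].
- by exists 0; [apply: chain_zero | rewrite mul0mx].
exists (mulv (mc T) (x' *m s) w + w').
  apply: chain_step => //; rewrite /orth -dot_mulr' //.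
rewrite mulmxDl; congr (_ + _).
by rewrite -(quo_morph prim_quo_M) /= -[x' *m s *m q]mulmxA sq mulmx1.
Qed.

Lemma prim_quo_nilD : nilpot (dc prim_quo) (orth (uv prim_quo)) (@full_pred k m).
Proof.
case: nilD => N NP; exists N => v pv.
apply: (qT_inj sq); rewrite mul0mx; apply: NP.
elim: pv => [{}v _|i|i {}x' y z Px _ IH1 _ IH2].
- exact: chain_base.
- by rewrite mul0mx; apply: chain_zero.
rewrite mulmxDl -quo_dual_mul //; last exact: prim_quo_D.
by apply: chain_step => //; rewrite /orth -dot_mulr.
Qed.

End QuotientByPrimitive.

Section CommutativeTrace.
Variable k : fieldType.

Definition pertinent (a : k) : k := if a == 1 then 0 else 1.

(** Induction on the dimension through the quotient by a primitive element; the
    factor contributed at each step is 0 or 1 and depends only on a b. *)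
Lemma comm_trace n (T : bialg k n) :
  commutative (mulv (mc T)) ->
  nilpot (mc T) (orth (ev T)) (@full_pred k n) ->
  nilpot (dc T) (orth (uv T)) (@full_pred k n) ->
  forall a b, \tr (conv_pow T a *m conv_pow T b) = if n == 1%N then 1 else pertinent (a * b)%:R.
Proof.
elim/ltn_ind: n T => n IHn T cm nilA nilD a b.
case: eqP => [n1|/eqP n1].
  subst n; have := uv_conv_pow T b; rewrite -{1}(uv_conv_pow T a) -mulmxA.
  set f := _ *m conv_pow T b; rewrite [f]mx11_scalar mul_mx_scalar mxtrace_scalar.
  move=> /(congr1 (dot (ev T))); by rewrite dotZr ev_uv mulr1.
have [x px [x0 ex]] := exists_primitive nilD n1.
have [r r1 [Xr Xr']] := exists_order nilA ex x0.
set X := mulx T x in Xr Xr'.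
pose q := col_base (cokermx X).
have [s sq] : exists s, s *m q = 1%:M by apply/row_fullP; apply: col_base_full.
have Xq : X *m q = 0.
  have /row_freeP[B qB] := row_base_free (cokermx X).
  by rewrite -[q]mulmx1 -qB (mulmxA q) mulmx_base mulmxA mulmx_coker mul0mx.
have kerq (v : 'rV_n) : v *m q = 0 -> (v <= X)%MS.
  by move=> vq; rewrite submxE -[cokermx X]mulmx_base mulmxA -/q vq mul0mx.
have lt_n : (\rank (cokermx X) < n)%N.
  have : \rank X != 0%N by rewrite mxrank_eq0 mulx_neq0.
  by rewrite mxrank_coker; have := dim_gt0 T; lia.
clearbody q.
pose T' := prim_quo cm px ex sq Xq kerq.
have qr i : conv_pow T i *m q = q *m conv_pow T' i.
  apply: iter_conv_qrel; exact: qrel1.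
have Xf : X *m (conv_pow T a *m conv_pow T b) = (a * b)%:R *: (conv_pow T a *m conv_pow T b *m X).
  rewrite mulmxA mulx_conv_pow // -scalemxAl -mulmxA mulx_conv_pow // -scalemxAr scalerA.
  by rewrite natrM mulmxA.
have := trace_quotient r1 Xr Xq sq _ kerq Xf; move=> ->.
  rewrite geometric_sum_order //; last by apply: (bin_order0 px r1 Xr Xr').
  have -> : s *m (conv_pow T a *m conv_pow T b) *m q = conv_pow T' a *m conv_pow T' b.
    by rewrite -!mulmxA qr [conv_pow T a *m (q *m _)]mulmxA qr !mulmxA sq mul1mx.
  rewrite IHn //; [|exact: prim_quo_comm|exact: prim_quo_nilA|exact: prim_quo_nilD].
  by rewrite /pertinent; do 2!case: ifP; rewrite ?mulr1 ?mul0r.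
move=> v /(mulx_ker cm nilA px Xr')[w ->].
exact: submxMl.
Qed.

End CommutativeTrace.

Section LinearPredicates.
Variables (k : fieldType) (n : nat) (c : 'I_n -> 'I_n -> 'I_n -> k).

Definition linear_pred (P : 'rV[k]_n -> Prop) :=
  P 0 /\ forall a x y, P x -> P y -> P (a *: x + y).

Lemma lpred_full : linear_pred (@full_pred k n). Proof. by []. Qed.

Lemma lpred_orth e : linear_pred (@orth k n e).
Proof.
by split=> [|a x y]; rewrite /orth ?dot0r // dotDr => -> ->; rewrite mulr0 addr0.
Qed.

Variables P W : 'rV[k]_n -> Prop.
Hypotheses (lP : linear_pred P) (lW : linear_pred W).

Lemma lpred_chain i : linear_pred (prod_chain c P W i).
Proof.
case: lP => P0 PD; case: lW => W0 WD.
have W0' : prod_chain c P W 0 0 by apply: chain_base.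
have sc j a x : prod_chain c P W j x -> prod_chain c P W j (a *: x).
  elim=> [v Wv|j'|j' x' u z Px pu _ _ IH].
  - by apply: chain_base; rewrite -[_ *: v]addr0; apply: WD.
  - by rewrite scaler0; apply: chain_zero.
  rewrite scalerDr -mulvZl; apply: chain_step => //.
  by rewrite -[_ *: x']addr0; apply: PD.
have ad j x y : prod_chain c P W j x -> prod_chain c P W j y -> prod_chain c P W j (x + y).
  move=> px; elim: px y => [v Wv|j'|j' x' u z Px pu _ _ IH] y py.
  - by inversion py; apply: chain_base; rewrite -[v]scale1r; apply: WD.
  - by rewrite add0r.
  by rewrite -addrA; apply: chain_step => //; apply: IH.
split=> [|a x y px py]; first by case: i => [//|i]; apply: chain_zero.
by apply: ad => //; apply: sc.
Qed.

Lemma lpred_sum I (r : seq I) (Q : pred I) (F : I -> 'rV[k]_n) :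
  (forall i, Q i -> P (F i)) -> P (\sum_(i <- r | Q i) F i).
Proof.
case: lP => P0 PD FP; apply: big_ind => // x y Px Py.
by rewrite -[x]scale1r; apply: PD.
Qed.

Lemma lpredZ a x : P x -> P (a *: x).
Proof. by case: lP => P0 PD Px; rewrite -[_ *: x]addr0; apply: PD. Qed.

End LinearPredicates.

Lemma dvdn_bin_pexp p e i : prime p -> (0 < i < p ^ e)%N -> (p %| 'C(p ^ e, i))%N.
Proof.
move=> pr_p /andP[i0 lt_i]; apply: contraLR lt_i => np; rewrite -leqNgt.
have co : coprime (p ^ e) 'C(p ^ e, i) by rewrite coprimeXl // prime_coprime.
apply: dvdn_leq => //; rewrite -(Gauss_dvdl _ co).
by case: i {np co} i0 => // i _; rewrite -mul_bin_diag dvdn_mulr.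
Qed.

Section Unipotent.
Variables (k : fieldType) (n : nat) (T : bialg k n).
Hypothesis nilA : nilpot (mc T) (orth (ev T)) (@full_pred k n).

Lemma conv_pow_add i j : convm T (conv_pow T i) (conv_pow T j) = conv_pow T (i + j).
Proof.
elim: i => [|i IHi]; first exact: conv1f.
by rewrite addSn /conv_pow !iterS -!/(conv_pow T _) -IHi convA.
Qed.

Let y := 1%:M - convm1 T.
Let Y i := iter i (convm T y) (convm1 T).

(** The map y = 1 - eta eps takes its values in the augmentation ideal, so its i-th
    convolution power takes its values in the i-th power of that ideal. *)
Lemma row_Y i l : prod_chain (mc T) (orth (ev T)) (@full_pred k n) i (row l (Y i)).
Proof.
elim: i l => [|i IHi] l; first exact: chain_base.
rewrite /Y iterS -/(Y i) row_conv.
have lpw := lpred_chain (mc T) (lpred_orth (ev T)) (@lpred_full k n) i.+1.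
apply: (lpred_sum lpw) => a _; apply: (lpred_sum lpw) => b _.
apply: (lpredZ lpw); apply: chain_mul => //.
rewrite /orth /y linearB /= row1 /convm1 row_mul.
rewrite [row a _]mx11_scalar mul_scalar_mx addrC -scaleNr dotDr ev_uv dot_delta.
by rewrite !mxE mulr1 addNr.
Qed.

Lemma Y_nil : exists N, forall i, (N <= i)%N -> Y i = 0.
Proof.
case: nilA => N NP; exists N => i /subnK <-; elim: (i - N)%N => [|j IHj].
  by apply/row_matrixP => l; rewrite row0; apply/NP/row_Y.
by rewrite /Y addSn iterS -/(Y _) IHj linear0.
Qed.

Lemma conv_pow_bin i : conv_pow T i = \sum_(j < i.+1) 'C(i, j)%:R *: Y j.
Proof.
elim: i => [|i IHi]; first by rewrite big_ord1 scale1r.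
have -> : conv_pow T i.+1 = convm T y (conv_pow T i) + conv_pow T i.
  rewrite -{2}[conv_pow T i](conv1f T) -[convm T y _]scale1r -convDl.
  by rewrite scale1r /y subrK /conv_pow iterS.
rewrite IHi linear_sum /=; under eq_bigr => j _ do rewrite linearZ -/(Y j.+1) /=.
rewrite [X in _ + X = _]big_ord_recl [RHS]big_ord_recl /= !bin0 addrCA.
congr (_ + _); under [RHS]eq_bigr => j _.
  rewrite /bump leq0n add1n binS natrD scalerDl; over.
rewrite big_split /= addrC; congr (_ + _).
by rewrite [RHS]big_ord_recr /= bin_small // scale0r addr0.
Qed.

Variable p : nat.
Hypothesis charp : p \in [pchar k].

Lemma conv_pow_period : exists2 e, (0 < e)%N & conv_pow T (p ^ e) = convm1 T.
Proof.
have pr_p := pcharf_prime charp.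
have [N NP] := Y_nil; exists N.+1 => //; rewrite conv_pow_bin big_ord_recl /=.
rewrite bin0 scale1r big1 ?addr0 // => i _; rewrite /bump leq0n add1n.
have [ip|ip] := ltnP i.+1 (p ^ N.+1).
  have /dvdnP[d ->] := @dvdn_bin_pexp p N.+1 i.+1 pr_p ip.
  by rewrite natrM (pcharf0 charp) mulr0 scale0r.
suff Yi : Y i.+1 = 0 by rewrite [convm T y _]Yi scaler0.
apply: NP; apply: leq_trans ip; apply: ltnW; apply: ltnW.
by rewrite ltn_expl ?prime_gt1.
Qed.

Variable S : 'M[k]_n.
Hypothesis aS : antip T S.

(** The identity minus the convolution unit is nilpotent for convolution, so its
    p^e-th power vanishes for e large, and in characteristic p the convolution
    power of exponent p^e of the identity is the unit ([conv_pow_period]). *)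
Lemma antip_conv_pow : exists2 a, S = conv_pow T a & a%:R = -1 :> k.
Proof.
have [e e0 pe] := conv_pow_period.
have p0 : (0 < p ^ e)%N by rewrite expn_gt0 prime_gt0 ?(pcharf_prime charp).
exists (p ^ e).-1; last first.
  apply/eqP; rewrite -subr_eq0 opprK natr1 prednK // natrX (pcharf0 charp).
  by rewrite expr0n; case: e e0 {pe p0}.
case: aS => S1 _; rewrite -[LHS](convf1 T) -pe -(prednK p0).
by rewrite [conv_pow T _.+1]/conv_pow iterS -/(conv_pow _ _) convA S1 conv1f.
Qed.

Lemma sweedler_mx_conv_pow z : exists2 b, sweedler_mx T S z = conv_pow T b & b%:R = z%:~R :> k.
Proof.
have [a Sa a1] := antip_conv_pow.
case: z => m; first by exists m.
exists (a * m.+1)%N; last by rewrite natrM a1 NegzE mulN1r mulrNz.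
rewrite /sweedler_mx; elim: m.+1 => [|j IHj]; first by rewrite muln0.
by rewrite iterS IHj {1}Sa conv_pow_add mulnS.
Qed.

Lemma comm_indic z : n != 1%N -> commutative (mulv (mc T)) ->
  nilpot (dc T) (orth (uv T)) (@full_pred k n) ->
  indic T S z = if z%:~R == 0 :> k then 0 else 1.
Proof.
move=> n1 cm nilD; rewrite /indic.
have [b -> bz] := sweedler_mx_conv_pow (z - 1); have [a -> a1] := antip_conv_pow.
rewrite comm_trace // (negPf n1) /pertinent natrM bz a1 rmorphB /= mulrN1 opprB.
by rewrite -subr_eq0 addrAC subrr add0r oppr_eq0.
Qed.

End Unipotent.

(** * Adic filtrations *)

Section VspaceOfPred.
Variables (k : fieldType) (V : vectType k).

(** By excluded middle a linear predicate on a finite-dimensional space is a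
    subspace: the sum of all subspaces on which it holds. *)
Lemma vspace_of_pred (P : V -> Prop) : P 0 ->
  (forall a x y, P x -> P y -> P (a *: x + y)) ->
  exists U : {vspace V}, forall x, x \in U <-> P x.
Proof.
move=> P0 PD; have [U UP] := sumv_family_ex (fun D => forall x, x \in D -> P x).
exists U => x; rewrite UP; split=> [[s sP xs]|Px].
  have {}sP D x' : D \in s -> x' \in D -> P x' by move=> Ds; apply: (sP _ Ds).
  elim: s x sP xs => [|D s IHs] x sP; first by rewrite big_nil memv0 => /eqP->.
  rewrite big_cons => /memv_addP[y yD [z zs ->]].
  rewrite -[y]scale1r; apply: PD; first by apply: sP yD; rewrite mem_head.
  by apply: IHs zs => D' x' D's; apply: sP; rewrite inE D's orbT.
exists [:: <[x]>%VS]; last by rewrite big_seq1 memv_line.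
move=> D; rewrite inE => /eqP-> y /vlineP[a ->].
by rewrite -[_ *: x]addr0; apply: PD.
Qed.

End VspaceOfPred.

Section AdaptedBasis.
Variables (k : fieldType) (n : nat).
Notation V := 'rV[k]_n.

(** Descending induction on j: a basis of a complement of U (j+1) in U j is put
    in front of the adapted sequence of U (j+1). *)
Lemma adapted_seq (U : nat -> {vspace V}) N j :
  (forall i, (U i.+1 <= U i)%VS) -> U N = 0%VS -> (j <= N)%N ->
  exists L : seq (nat * V), [/\ free [seq x.2 | x <- L],
    all (fun x => j <= x.1)%N L &
    forall t, (j <= t)%N -> U t = <<[seq x.2 | x <- L & (t <= x.1)%N]>>%VS].
Proof.
move=> dec UN.
have [m] := ubnP (N - j); elim: m j => // m IHm j; rewrite ltnS => jm jN.
case: (ltngtP j N) jN => // [jN _|-> _]; last first.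
  exists [::]; split=> [||t jt] //; first by rewrite nil_free.
  rewrite span_nil; apply/eqP; rewrite -subv0 -UN -(subnK jt).
  elim: (t - N)%N => [|i IHi]; first by rewrite subvv.
  exact: subv_trans (dec _) IHi.
have [||L [fL aL LP]] := IHm j.+1 => //; first by lia.
have spL : <<[seq x.2 | x <- L]>>%VS = U j.+1.
  by rewrite (LP j.+1) // (all_filterP aL).
exists ([seq (j, b) | b <- vbasis (U j :\: U j.+1)] ++ L); split.
- rewrite map_cat -map_comp map_id cat_free (basis_free (vbasisP _)) fL /=.
  by rewrite spL (span_basis (vbasisP _)); apply/directv_addP; apply: capv_diff.
- rewrite all_cat; apply/andP; split; first by apply/allP=> x /mapP[b _ ->].
  by apply: sub_all aL => x; apply: ltnW.
move=> t; rewrite leq_eqVlt => /predU1P[<-|jt]; rewrite filter_cat map_cat span_cat.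
  have -> : [seq x <- L | (j <= x.1)%N] = L.
    by apply/all_filterP; apply: sub_all aL => x; apply: ltnW.
  rewrite spL; have -> : [seq x <- [seq (j, b) | b <- vbasis (U j :\: U j.+1)] | (j <= x.1)%N]
    = [seq (j, b) | b <- vbasis (U j :\: U j.+1)].
    by apply/all_filterP/allP=> x /mapP[b _ ->] /=.
  rewrite -map_comp map_id (span_basis (vbasisP _)).
  by rewrite addv_diff; apply/esym/addv_idPl.
have -> : [seq x <- [seq (j, b) | b <- vbasis (U j :\: U j.+1)] | (t <= x.1)%N] = [::].
  apply/eqP; rewrite -[_ == _]negbK -has_filter; apply/hasPn => x /mapP[b _ ->] /=.
  by rewrite -ltnNge.
by rewrite span_nil add0v -LP.
Qed.

Lemma adapted_basis (U : nat -> V -> Prop) N :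
  (forall i, linear_pred (U i)) -> (forall i v, U i.+1 v -> U i v) -> (forall v, U 0%N v) ->
  (forall v, U N v -> v = 0) ->
  exists r (deg : 'I_n -> nat), r \in unitmx /\
    forall s v, U s (v *m r) <-> forall i, v 0 i != 0 -> (s <= deg i)%N.
Proof.
move=> lU dec U0 UN.
have /choice[W WP] i : exists W : {vspace V}, forall v, v \in W <-> U i v.
  by case: (lU i) => z D; apply: vspace_of_pred.
have decW i : (W i.+1 <= W i)%VS by apply/subvP => v /WP/dec/WP.
have WN : W N = 0%VS.
  by apply/eqP; rewrite -subv0; apply/subvP => v /WP/UN->; rewrite mem0v.
have W0 : W 0%N = fullv by apply/eqP; rewrite eqEsubv subvf; apply/subvP => v _; apply/WP.
have [L [fL _ LP]] := adapted_seq decW WN (leq0n N).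
pose X := [seq x.2 | x <- L].
have L0 : [seq x <- L | (0 <= x.1)%N] = L by apply/all_filterP/allP.
have spX : <<X>>%VS = fullv by rewrite -W0 (LP 0%N) // L0.
have sX : size X = n.
  have /eqP <- : free X := fL.
  by rewrite spX dimvf dim_matrix; apply: mul1n.
have sL : size L = n by have := sX; rewrite size_map.
pose r : 'M[k]_n := \matrix_i X`_i.
pose deg (i : 'I_n) := (nth (0%N, 0) L i).1.
have rowr i : row i r = X`_i by rewrite rowK.
have mulr' (v : V) : v *m r = \sum_i v 0 i *: X`_i.
  by rewrite mulmx_sum_row; apply: eq_bigr => i _; rewrite rowr.
have r_inj (v : V) : v *m r = 0 -> v = 0.
  rewrite mulr' => v0; apply/rowP => i; rewrite mxE.
  have tX : size X == n by rewrite sX.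
  have /freeP/(_ (fun i => v 0 i)) := (fL : free (Tuple tX)).
  by move=> ->.
exists r, deg; split.
  rewrite -row_free_unit; apply/inj_row_free; exact: r_inj.
have mem_row (i : 'I_n) : X`_i = (nth (0%N, 0) L i).2.
  by rewrite /X (nth_map (0%N, 0)) ?sL.
have UX s (i : 'I_n) : (s <= deg i)%N -> U s X`_i.
  move=> le; apply/WP; rewrite (LP s) //; apply: memv_span.
  rewrite mem_row; apply/mapP; exists (nth (0%N, 0) L i) => //.
  by rewrite mem_filter le mem_nth // sL.
move=> s v; split=> [|H]; last first.
  rewrite mulr'; apply: (lpred_sum (lU s)) => i _.
  case: (eqVneq (v 0 i) 0) => [->|/H/UX]; last exact: (lpredZ (lU s)).
  by rewrite scale0r; case: (lU s).
pose Q (w : V) := exists2 a : V, w = a *m r & forall i, a 0 i != 0 -> (s <= deg i)%N.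
have [Z ZP] : exists Z : {vspace V}, forall w, w \in Z <-> Q w.
  apply: vspace_of_pred.
    by exists 0 => [|i]; rewrite ?mul0mx // mxE eqxx.
  move=> c w w' [a -> aP] [a' -> aP']; exists (c *: a + a').
    by rewrite mulmxDl scalemxAl.
  move=> i; rewrite !mxE; case: (eqVneq (a 0 i) 0) => [->|/aP//].
  by rewrite mulr0 add0r => /aP'.
have WZ : (W s <= Z)%VS.
  rewrite (LP s) //; apply/span_subvP => w /mapP[x]; rewrite mem_filter => /andP[sx xL] ->.
  apply/ZP; have lt : (index x L < n)%N by move: xL; rewrite -index_mem sL.
  exists (delta_mx 0 (Ordinal lt)) => [|i].
    by rewrite -rowE rowr mem_row /= nth_index.
  rewrite mxE eqxx; case: (eqVneq i (Ordinal lt)) => [->|]; rewrite ?eqxx // => _.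
  by rewrite /deg /= nth_index.
move=> /WP/(subvP WZ)/ZP[a E aP] i.
suff -> : v = a by apply: aP.
by apply/eqP; rewrite -subr_eq0; apply/eqP/r_inj; rewrite mulmxBl E subrr.
Qed.

End AdaptedBasis.

Section FilteredInverse.
Variables (k : fieldType) (n : nat) (T : bialg k n) (w : 'I_n -> int).
Hypothesis fT : filtered w T.

Lemma antip_filt S : antip T S -> filtm w S.
Proof.
case=> S1 S2; pose F := linfun (convm T 1%:M).
have FE f : F f = convm T 1%:M f by rewrite lfunE.
have Finj f : F f = 0 -> f = 0.
  by rewrite FE => E; rewrite -(conv1f T f) -S1 -convA E linear0.
have [E EP] : exists E : {vspace 'M[k]_n}, forall f, f \in E <-> filtm w f.
  apply: vspace_of_pred => [i j|a f g ff fg i j]; first by rewrite mxE eqxx.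
  rewrite !mxE; case: (eqVneq (f i j) 0) => [->|/ff//].
  by rewrite mulr0 add0r => /fg.
(* F is injective and preserves the finite-dimensional space E. *)
have FE' : (F @: E)%VS = E.
  apply/eqP; rewrite eqEdim limg_dim_eq ?leqnn ?andbT.
    apply/subvP => _ /memv_imgP[f /EP ff ->]; apply/EP; rewrite FE.
    by have [] := conv_gr fT (@filtm1 _ _ w) ff.
  apply/eqP; rewrite -subv0; apply/subvP => f.
  by rewrite memv_cap memv_ker => /andP[_ /eqP/Finj->]; apply: mem0v.
have : convm1 T \in E by apply/EP; have [] := conv1_gr fT.
rewrite -FE' => /memv_imgP[f /EP ff]; rewrite FE -S2 => E12.
suff -> : S = f by [].
apply/eqP; rewrite -subr_eq0; apply/eqP/Finj.
by rewrite FE linearB /= E12 subrr.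
Qed.

End FilteredInverse.

Section IdealPowers.
Variables (k : fieldType) (n : nat) (c : 'I_n -> 'I_n -> 'I_n -> k).
Variable K : 'rV[k]_n -> Prop.
Hypothesis cA : associative (mulv c).
Notation U := (prod_chain c K (@full_pred k n)).

Lemma chain_dec i v : U i.+1 v -> U i v.
Proof.
elim: i v => [|i IHi] v; first by move=> _; apply: chain_base.
move Ej : i.+2 => j pj; elim: pj Ej => {j v} [//|j _|j x y z Kx py _ _ IHz [Ej]].
  exact: chain_zero.
by subst j; apply: chain_step => //; [apply: IHi|apply: IHz].
Qed.

Hypothesis Kl : forall a x, K x -> K (mulv c a x).

Lemma chain_absorb j a v : U j v -> U j (mulv c a v).
Proof.
elim=> [{}v _|j'|j' x y z Kx py _ _ IHz]; first exact: chain_base.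
  by rewrite linear0; apply: chain_zero.
by rewrite linearD /= cA; apply: chain_step => //; apply: Kl.
Qed.

Lemma chain_mulD i j x y : U i x -> U j y -> U (i + j) (mulv c x y).
Proof.
move=> px py; elim: px => [v _|i'|i' u v z Ku pv IHv _ IHz].
- exact: chain_absorb.
- by rewrite -mulvrE linear0; apply: chain_zero.
by rewrite -mulvrE linearD /= !mulvrE -cA addSn; apply: chain_step.
Qed.

End IdealPowers.

Section Biideal.
Variables (k : fieldType) (n : nat) (T : bialg k n) (K : 'rV[k]_n -> Prop).

(** The condition on the coproduct of K is stated on the dual side: K^perp is
    closed under convolution. For a two-sided ideal killed by the counit this
    says that K is a biideal. *)
Record biideal : Prop := Biideal {
  biideal_linear : linear_pred K;
  biideal_l : forall a x, K x -> K (mulv (mc T) a x);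
  biideal_r : forall a x, K x -> K (mulv (mc T) x a);
  biideal_ev : forall x, K x -> dot (ev T) x = 0;
  biideal_perp : forall f g, (forall x, K x -> dot f x = 0) ->
    (forall x, K x -> dot g x = 0) -> forall x, K x -> dot (mulv (dc T) f g) x = 0
}.

(** The rows of r form a basis in which the powers of K are spanned by the basis
    vectors of large degree. *)
Definition adapted (r : 'M[k]_n) (deg : 'I_n -> nat) :=
  forall s (v : 'rV[k]_n), prod_chain (mc T) K (@full_pred k n) s (v *m r) <->
    forall i, v 0 i != 0 -> (s <= deg i)%N.

End Biideal.

Section Adic.
Variables (k : fieldType) (n : nat) (T : bialg k n) (S : 'M[k]_n).
Variable K : 'rV[k]_n -> Prop.
Notation V := 'rV[k]_n.
Hypothesis aS : antip T S.
Hypothesis IK : biideal T K.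
Let lK := biideal_linear IK.
Let Kl := biideal_l IK.
Let Kr := biideal_r IK.
Let Kev := biideal_ev IK.
Let Kperp := biideal_perp IK.

Variables (r q : 'M[k]_n) (deg : 'I_n -> nat).
Hypothesis (rq : r *m q = 1%:M) (qr : q *m r = 1%:M).
Hypothesis degP : adapted T K r deg.

Lemma mulqr (a : V) : a *m q *m r = a. Proof. by rewrite -mulmxA qr mulmx1. Qed.
Lemma mulrq (a : V) : a *m r *m q = a. Proof. by rewrite -mulmxA rq mulmx1. Qed.

Lemma base_M a b :
  mulv (mc T) a b *m q = mulv (mc T) (a *m q *m r) (b *m q *m r) *m q.
Proof. by rewrite !mulqr. Qed.

Lemma mulq_eq0 (a : V) : a *m q = 0 -> a = 0.
Proof. by move/(congr1 (mulmx^~ r)); rewrite mulqr mul0mx. Qed.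

Lemma base_D a : a *m q = 0 -> q^T *m comulv (dc T) a *m q = 0.
Proof. by move/mulq_eq0->; rewrite linear0 mulmx0 mul0mx. Qed.

Lemma base_E a : a *m q = 0 -> dot (ev T) a = 0.
Proof. by move/mulq_eq0->; rewrite dot0r. Qed.

Definition rebase : bialg k n := quo rq base_M base_D base_E.
Notation T1 := rebase.
Definition rebase_antip : 'M[k]_n := r *m S *m q.
Notation w := (fun i => (deg i)%:Z).

Lemma rebase_qrel f : qrel q f (r *m f *m q).
Proof. by rewrite /qrel !mulmxA qr mul1mx. Qed.

Lemma antip_rebase : antip T1 rebase_antip.
Proof. exact: antip_quo (rebase_qrel S) aS. Qed.

Lemma indic_rebase z : indic T1 rebase_antip z = indic T S z.
Proof.
rewrite /indic; have H := sweedler_mx_quo rq base_M base_D base_E (z - 1) (rebase_qrel S).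
have -> : sweedler_mx T1 rebase_antip (z - 1) = r *m sweedler_mx T S (z - 1) *m q.
  by rewrite -mulmxA H mulmxA rq mul1mx.
rewrite /rebase_antip !mulmxA -(mulmxA _ q r) qr mulmx1 mxtrace_mulC !mulmxA qr.
by rewrite mul1mx.
Qed.

Lemma ideal_chain1 x : K x -> prod_chain (mc T) K (@full_pred k n) 1 x.
Proof. by move=> Kx; rewrite -[x](mc1r T); apply: chain_mul => //; apply: chain_base. Qed.

Lemma chain1_ideal x : prod_chain (mc T) K (@full_pred k n) 1 x -> K x.
Proof.
case: lK => K0 KD; move Ej : 1%N => j pj.
elim: pj Ej => // j' y u z Ky _ _ _ IHz Ej.
by rewrite -[mulv _ _ _]scale1r; apply: KD; [apply: Kr|apply: IHz].
Qed.

Lemma filt_mc : filtc w (mc T1).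
Proof.
move=> i j l cne; rewrite -PoszD lez_nat.
have d0 s : prod_chain (mc T) K (@full_pred k n) (deg s) (delta_mx 0 s *m r).
  apply/degP => t; rewrite mxE eqxx.
  by case: (eqVneq t s) => [->|]; rewrite ?eqxx.
have := chain_mulD (mcA T) Kl (d0 i) (d0 j); rewrite -[mulv _ _ _]mulqr => /degP.
apply; rewrite -[mulv _ _ _ *m q](quo_mul T r q) mulv_delta //.
Qed.

Lemma filt_ev : filtv (opw w) (ev T1).
Proof.
move=> i ei; suff -> : opw w i = 0 by [].
apply/eqP; rewrite /opw oppr_eq0 eqz_nat -leqn0 leqNgt; apply: contra ei => di.
rewrite -dot_delta dot_mulr'; apply/eqP/Kev/chain1_ideal/degP => j.
by rewrite mxE eqxx; case: (eqVneq j i) => [->|]; rewrite ?eqxx.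
Qed.

Definition tensdeg (s : nat) (t : 'M[k]_n) :=
  forall i j, t i j != 0 -> (s <= deg i + deg j)%N.

Lemma tensdegD s t t' : tensdeg s t -> tensdeg s t' -> tensdeg s (t + t').
Proof.
move=> ht ht' i j; rewrite mxE; case: (eqVneq (t i j) 0) => [->|/ht//].
by rewrite add0r => /ht'.
Qed.

(** The tensor square is filtered by the total degree, as an algebra. *)
Lemma tensdeg_tmul s s' t t' : tensdeg s t -> tensdeg s' t' ->
  tensdeg (s + s') (tmul (mc T1) t t').
Proof.
move=> ht ht' a b; apply: contra_neqT; rewrite -ltnNge => lt.
rewrite mxE big1 // => i _; rewrite big1 // => i' _; rewrite big1 // => j _.
rewrite big1 // => j' _; apply/eqP/negPn/negP; rewrite !mulf_eq0 !negb_or.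
case/andP=> /andP[/ht H1 /ht' H2] /andP[/filt_mc H3 /filt_mc H4]; lia.
Qed.

Lemma comulv_rebase x : comulv (dc T1) (x *m q) = q^T *m comulv (dc T) x *m q.
Proof. exact: (quo_comulq rq base_D). Qed.

(** A coordinate of degree zero vanishes on K, hence so does the convolution of two
    of them: the coproduct of K has no component of total degree zero. *)
Lemma tensdeg_K x : K x -> tensdeg 1 (comulv (dc T1) (x *m q)).
Proof.
move=> Kx i j; rewrite comulv_rebase; apply: contra_neqT; rewrite -ltnNge => lt.
have kill l : deg l = 0%N -> forall x', K x' -> dot (delta_mx 0 l *m q^T) x' = 0.
  move=> dl x' Kx'; rewrite dotC -dot_mulr dot_delta; apply/eqP/negPn/negP.
  have /degP H : prod_chain (mc T) K (@full_pred k n) 1 (x' *m q *m r) by rewrite mulqr; apply: ideal_chain1.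
  by move/H; rewrite dl.
have E (M : 'M[k]_n) :
    ((delta_mx 0 i : V) *m M *m (delta_mx 0 j : V)^T) 0 0 = M i j.
  by rewrite [LHS](dot_delta (delta_mx 0 i *m M) j) -rowE mxE.
have [di dj] : deg i = 0%N /\ deg j = 0%N by lia.
have := Kperp (kill i di) (kill j dj) Kx; rewrite -dot_comulv trmx_mul trmxK => <-.
by rewrite -E !mulmxA.
Qed.

(** Since the coproduct is multiplicative, it is determined on powers of K by its
    values on K. *)
Lemma tensdeg_chain s x : prod_chain (mc T) K (@full_pred k n) s x ->
  tensdeg s (comulv (dc T1) (x *m q)).
Proof.
elim=> [v _|i|i y u z Ky _ IHu _ IHz] //.
  by rewrite mul0mx linear0 => ? ?; rewrite mxE eqxx.
have cD a b : comulv (dc T1) (a + b) = comulv (dc T1) a + comulv (dc T1) b.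
  exact: linearD.
rewrite mulmxDl cD; apply: tensdegD => //.
have -> : mulv (mc T) y u *m q = mulv (mc T1) (y *m q) (u *m q).
  by rewrite [RHS](quo_morph base_M).
by rewrite (comulvM T1) -add1n; apply: tensdeg_tmul => //; apply: tensdeg_K.
Qed.

Lemma filt_dc : filtc (opw w) (dc T1).
Proof.
move=> i j l; rewrite -comulv_delta /opw.
have d0 : prod_chain (mc T) K (@full_pred k n) (deg l) (delta_mx 0 l *m r).
  apply/degP => t; rewrite mxE eqxx.
  by case: (eqVneq t l) => [->|]; rewrite ?eqxx.
have := tensdeg_chain d0; rewrite mulrq => H /H; lia.
Qed.

Lemma filtered_rebase : filtered w T1.
Proof. by split; [apply: filt_mc|apply: filt_dc|move=> i _|apply: filt_ev]. Qed.

Definition adic_gr : bialg k n := gr filtered_rebase.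
Definition adic_antip : 'M[k]_n := grm w rebase_antip.

Lemma filt_rebase_antip : filtm w rebase_antip.
Proof. exact: (@antip_filt _ _ T1 w filtered_rebase _ antip_rebase). Qed.

Lemma antip_adic : antip adic_gr adic_antip.
Proof. exact: antip_gr filt_rebase_antip antip_rebase. Qed.

Lemma indic_adic z : indic adic_gr adic_antip z = indic T S z.
Proof. by rewrite indic_gr ?indic_rebase //; apply: filt_rebase_antip. Qed.

End Adic.

(** * From a nilpotent Hopf ideal to a commutative bialgebra *)

Section ChainTheory.
Variables (k : fieldType) (n : nat) (c : 'I_n -> 'I_n -> 'I_n -> k) (u : 'rV[k]_n).
Hypothesis calg : is_alg c u.
Implicit Types P Q W : 'rV[k]_n -> Prop.

Lemma chain_mono P Q W W' i (v : 'rV[k]_n) : (forall x, P x -> Q x) -> (forall x, W x -> W' x) ->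
  prod_chain c P W i v -> prod_chain c Q W' i v.
Proof.
move=> PQ WW; elim=> [x Wx|j|j x y z Px _ IHy _ IHz].
- by apply: chain_base; apply: WW.
- exact: chain_zero.
by apply: chain_step => //; apply: PQ.
Qed.

Lemma chain_addS P W i (x y : 'rV[k]_n) :
  prod_chain c P W i.+1 x -> prod_chain c P W i.+1 y -> prod_chain c P W i.+1 (x + y).
Proof.
move Ej : i.+1 => j px; elim: px Ej y => // j' => [_ y|a b z Pa pb _ _ IHz Ej y] py.
  by rewrite add0r.
by rewrite -addrA; apply: chain_step => //; apply: IHz.
Qed.

Lemma chain1_mull Q Q' W (x y : 'rV[k]_n) : (forall a, Q a -> Q' (mulv c x a)) ->
  prod_chain c Q W 1 y -> prod_chain c Q' W 1 (mulv c x y).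
Proof.
case: calg => cA _ _ QQ.
suff H j v : prod_chain c Q W j v -> j = 1%N -> prod_chain c Q' W 1 (mulv c x v) by move/H; apply.
elim=> // j' => [_|a b z Qa Wb _ _ IHz Ej].
  by rewrite linear0; apply: chain_zero.
rewrite linearD /= cA; apply: chain_step; [exact: QQ| |exact: IHz].
by case: Ej Wb => -> pb; inversion pb; apply: chain_base.
Qed.

Lemma chain_split P i j (v : 'rV[k]_n) :
  prod_chain c P (@full_pred k n) (i + j) v ->
  prod_chain c (prod_chain c P (@full_pred k n) i) (prod_chain c P (@full_pred k n) j) 1 v.
Proof.
case: calg => cA c1l _; elim: i v => [|i IHi] v pv.
  by rewrite -[v]c1l; apply: chain_mul; apply: chain_base.
rewrite addSn in pv; move Em : (i + j).+1 pv => m pv.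
elim: pv Em => // m' => [_|x y z Px py _ _ IHz [Em]]; first exact: chain_zero.
apply: chain_addS; last by apply: IHz; rewrite Em.
by apply: chain1_mull (IHi y _) => [a pa|]; [apply: chain_mul|rewrite Em].
Qed.

Lemma chain_pow P Q a b (v : 'rV[k]_n) :
  (forall x, prod_chain c P (@full_pred k n) a x -> Q x) ->
  prod_chain c P (@full_pred k n) (b * a) v -> prod_chain c Q (@full_pred k n) b v.
Proof.
move=> PQ; elim: b v => [|b IHb] v; first by move=> _; apply: chain_base.
rewrite mulSn => /chain_split.
suff H j w : prod_chain c (prod_chain c P (@full_pred k n) a) (prod_chain c P (@full_pred k n) (b * a)) j w ->
    j = 1%N -> prod_chain c Q (@full_pred k n) b.+1 w by move/H; apply.
elim=> // j' => [_|x y z Px py _ _ IHz Ej]; first exact: chain_zero.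
apply: chain_step; [exact: PQ| |exact: IHz].
by apply: IHb; case: Ej py => -> py; inversion py.
Qed.

(** An ideal some power of which is contained in a nilpotent one is nilpotent. *)
Lemma nilpot_pow P Q a : (forall x, prod_chain c P (@full_pred k n) a x -> Q x) ->
  nilpot c Q (@full_pred k n) -> nilpot c P (@full_pred k n).
Proof. by move=> PQ [N NP]; exists (N * a)%N => v /(chain_pow PQ)/NP. Qed.

Lemma nilpot_sub P Q W : (forall x, P x -> Q x) -> nilpot c Q W -> nilpot c P W.
Proof. by move=> PQ [N NP]; exists N => v /(@chain_mono _ _ _ W _ _ PQ (fun _ => id))/NP. Qed.

Definition posdeg (deg : 'I_n -> nat) (v : 'rV[k]_n) := forall i, deg i = 0%N -> v 0 i = 0.

Lemma graded_nilpot (deg : 'I_n -> nat) :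
  (forall i j l, c i j l != 0 -> (deg i + deg j = deg l)%N) ->
  nilpot c (posdeg deg) (@full_pred k n).
Proof.
move=> gc; have H s v : prod_chain c (posdeg deg) (@full_pred k n) s v ->
    forall l, v 0 l != 0 -> (s <= deg l)%N.
  elim=> [//|s' l|s' x y z Px _ IHy _ IHz l]; first by rewrite mxE eqxx.
  rewrite mxE; case: (eqVneq (z 0 l) 0) => [->|/IHz//]; rewrite addr0.
  apply: contra_neqT; rewrite -ltnNge => lt.
  rewrite mulvE big1 // => i _; rewrite big1 // => j _.
  apply/eqP/negPn/negP; rewrite !mulf_eq0 !negb_or => /andP[/andP[xi /IHy H1] /gc H2].
  have : deg i != 0%N by apply: contraNneq xi => /Px->.
  lia.
exists (\max_i deg i).+1 => v /H vP; apply/rowP => l; rewrite mxE.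
apply/eqP/negPn/negP => /vP; rewrite ltnNge leq_bigmax //.
Qed.

End ChainTheory.

Section DualOfGraded.
Variables (k : fieldType) (n : nat) (T : bialg k n).
Variable K : 'rV[k]_n -> Prop.
Notation V := 'rV[k]_n.
Hypothesis IK : biideal T K.
Let lK := biideal_linear IK.
Let Kr := biideal_r IK.
Let Kperp := biideal_perp IK.
Variables (r q : 'M[k]_n) (deg : 'I_n -> nat).
Hypothesis (rq : r *m q = 1%:M) (qr : q *m r = 1%:M).
Hypothesis degP : adapted T K r deg.

Let G := adic_gr IK rq qr degP.
Let perp (f : V) := forall x, K x -> dot f x = 0.
Let perp1 (f : V) := perp f /\ dot (uv T) f = 0.
Hypothesis nilB : nilpot (dc T) perp1 perp.

Lemma K_coord x i : K x -> deg i = 0%N -> (x *m q) 0 i = 0.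
Proof.
move=> Kx di; have /degP H : prod_chain (mc T) K (@full_pred k n) 1 (x *m q *m r).
  by rewrite mulqr //; apply: ideal_chain1.
by apply/eqP/negPn/negP => /H; rewrite di.
Qed.

Lemma perp_coord f i : perp f -> (0 < deg i)%N -> (f *m r^T) 0 i = 0.
Proof.
move=> pf di; rewrite -dot_delta dot_mulr'; apply: pf.
apply: (chain1_ideal IK); apply/degP => j; rewrite mxE eqxx.
by case: (eqVneq j i) => [->|]; rewrite ?eqxx.
Qed.

Lemma chain_perp s f : prod_chain (dc T) perp1 perp s f -> perp f.
Proof.
elim=> // [j x _|j x y z [px _] _ py _ pz t Kt]; first by rewrite dotC dot0r.
by rewrite -[mulv _ _ _]scale1r dotDl pz // Kperp // mulr0 addr0.
Qed.

(** In degree zero the dual product of the graded bialgebra is that of K^perp in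
    the dual of T, so the degree zero part of a product of functionals can be
    computed there. *)
Lemma deg0_lift s v : prod_chain (dc G) (orth (uv G)) (@full_pred k n) s v ->
  exists2 v', prod_chain (dc T) perp1 perp s v' &
    forall l, deg l = 0%N -> v 0 l = (v' *m r^T) 0 l.
Proof.
pose d0 (f : V) : V := \row_i (if deg i == 0%N then f 0 i else 0).
have d0P f : perp (d0 f *m q^T).
  move=> x Kx; rewrite dotC -dot_mulr dotE big1 // => i _; rewrite [d0 _ _ _]mxE.
  by case: (deg i =P 0%N) => [/(K_coord Kx)->|_]; rewrite ?mul0r ?mulr0.
have qrT (f : V) : f *m q^T *m r^T = f by rewrite -mulmxA -trmx_mul rq trmx1 mulmx1.
have rqT (f : V) : f *m r^T *m q^T = f by rewrite -mulmxA -trmx_mul qr trmx1 mulmx1.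
elim=> [{}v _|j|j f y z Of _ [y' py Ey] _ [z' pz Ez]].
- exists (d0 v *m q^T) => [|l dl]; first by apply: chain_base.
  by rewrite qrT mxE dl eqxx.
- by exists 0 => [|l _]; [apply: chain_zero|rewrite mul0mx !mxE].
exists (mulv (dc T) (d0 f *m q^T) y' + z').
  apply: chain_step => //; split=> //.
  rewrite -dot_mulr dotE -[RHS]Of dotE; apply: eq_bigr => i _.
  by rewrite !mxE eqz_nat; case: (deg i =P 0%N); rewrite ?mul0r ?mulr0.
move=> l dl; rewrite mulmxDl mxE [RHS]mxE -Ez //; congr (_ + _).
rewrite -[y' in RHS]rqT (quo_dual_mul rq (base_D T qr)) qrT !mulvE.
apply: eq_bigr => i _; apply: eq_bigr => t _; rewrite [d0 _ _ _]mxE /= /grc dl.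
case: (eqVneq (deg i) 0%N) => [di|di]; last first.
  by rewrite !mul0r; case: ifP => /eqP; rewrite ?mulr0 //; lia.
case: (posnP (deg t)) => [dt|dt].
  by rewrite di dt addr0 eqxx Ey.
rewrite (perp_coord (chain_perp py)) // mulr0 mul0r.
by case: ifP => /eqP; rewrite ?mulr0 //; lia.
Qed.

(** A long product in the augmentation ideal of the dual of gr T has no degree
    zero part, since that part is a long product in the augmentation ideal of
    K^perp; and elements of positive degree are nilpotent. *)
Lemma local_dual_gr : nilpot (dc G) (orth (uv G)) (@full_pred k n).
Proof.
case: nilB => N NP; apply: (nilpot_pow (dc_alg G) (a := N) (Q := posdeg deg)).
  by move=> x /deg0_lift[v /NP-> E] i /E->; rewrite mul0mx mxE.
apply: graded_nilpot => i j l; rewrite /= /grc.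
by case: ifP => /eqP; rewrite ?eqxx //; lia.
Qed.

End DualOfGraded.

Section Augmentation.
Variables (k : fieldType) (n : nat) (T : bialg k n).
Notation V := 'rV[k]_n.

Lemma orth_sub_scale (e u f : V) : dot e u = 1 ->
  (forall x, orth e x -> dot f x = 0) -> f = dot f u *: e.
Proof.
move=> eu fe; apply: dot_inj => x.
have xu : orth e (- dot e x *: u + x).
  by rewrite /orth dotDr eu mulr1 addNr.
have /eqP := fe _ xu; rewrite dotDr mulNr addrC subr_eq0 => /eqP->.
by rewrite [RHS]dotC dotZr mulrC (dotC x).
Qed.

Lemma orth_ev_l a x : orth (ev T) x -> orth (ev T) (mulv (mc T) a x).
Proof. by rewrite /orth ev_aug => ->; rewrite mulr0. Qed.

Lemma orth_ev_r a x : orth (ev T) x -> orth (ev T) (mulv (mc T) x a).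
Proof. by rewrite /orth ev_aug => ->; rewrite mul0r. Qed.

Lemma orth_ev_perp f g : (forall x, orth (ev T) x -> dot f x = 0) ->
  (forall x, orth (ev T) x -> dot g x = 0) ->
  forall x, orth (ev T) x -> dot (mulv (dc T) f g) x = 0.
Proof.
move=> /(orth_sub_scale (ev_uv T))-> /(orth_sub_scale (ev_uv T))-> x ox.
rewrite mulvZl linearZ /=; case: (dc_alg T) => _ -> _.
by rewrite dotC !dotZr (dotC x) ox !mulr0.
Qed.

Lemma orth_ev_biideal : biideal T (orth (ev T)).
Proof.
split => //; [exact: lpred_orth|exact: orth_ev_l|exact: orth_ev_r|].
exact: orth_ev_perp.
Qed.

Lemma tmul_tr (c : 'I_n -> 'I_n -> 'I_n -> k) (s t : 'M[k]_n) :
  tmul c s^T t^T = (tmul c s t)^T.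
Proof.
apply/matrixP => a b; rewrite !mxE exchange_big; apply: eq_bigr => i _.
apply: eq_bigr => i' _; rewrite exchange_big; apply: eq_bigr => j _.
by apply: eq_bigr => j' _; rewrite !mxE [c _ _ a * _]mulrC.
Qed.

Section LocalGr.
Variables (r q : 'M[k]_n) (deg : 'I_n -> nat).
Hypothesis (rq : r *m q = 1%:M) (qr : q *m r = 1%:M).
Hypothesis degP : adapted T (orth (ev T)) r deg.

Let IK := orth_ev_biideal.
Notation T1 := (rebase T rq qr).
Notation K := (orth (ev T)).
Let Q := adic_gr IK rq qr degP.

Lemma tensdegW s s' (t : 'M[k]_n) : (s' <= s)%N -> tensdeg deg s t -> tensdeg deg s' t.
Proof. by move=> le H i j /H; apply: leq_trans. Qed.

Lemma tensdeg_tr s (t : 'M[k]_n) : tensdeg deg s t -> tensdeg deg s t^T.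
Proof. by move=> H i j; rewrite mxE addnC => /H. Qed.

(** A coordinate of degree zero kills the augmentation ideal, hence is a multiple
    of the counit. *)
Lemma deg0_coord i : deg i = 0%N ->
  exists c, forall v : V, v 0 i = c * dot (ev T1) v.
Proof.
move=> di; pose c := dot (delta_mx 0 i) (uv T1).
have E : delta_mx 0 i = c *: ev T1.
  apply: orth_sub_scale => [|x]; first exact: ev_uv.
  rewrite /orth dot_mulr' => /ideal_chain1/degP H; rewrite dotC dot_delta.
  by apply/eqP/negPn/negP => /H; rewrite di.
by exists c => v; rewrite -dot_delta E dotZr dotC.
Qed.

(** For y in the augmentation ideal, t = Delta(y) - y (x) 1 - 1 (x) y is killed by
    the counit on either side, so all its components have degree at least one
    in both factors. The two subtracted terms cancel in the asymmetry
    Delta(y) - Delta(y)^op, which thus has total degree at least 2. *)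
Lemma asym_orth y : dot (ev T1) y = 0 ->
  tensdeg deg 2 (comulv (dc T1) y - (comulv (dc T1) y)^T).
Proof.
move=> ey; pose t := comulv (dc T1) y - y^T *m uv T1 - (uv T1)^T *m y.
have -> : comulv (dc T1) y - (comulv (dc T1) y)^T = t - t^T.
  rewrite /t !linearB /= !trmx_mul !trmxK.
  by apply/matrixP => i j; rewrite !mxE; ring.
have evt : ev T1 *m t = 0.
  rewrite /t !mulmxBr ev_comulv !(mulmxA (ev T1)) !mul_dot.
  rewrite ey ev_uv !mul_scalar_mx scale0r scale1r subr0.
  by rewrite subrr.
have tev : ev T1 *m t^T = 0.
  have trP (a b : V) : (a^T *m b)^T = b^T *m a by rewrite trmx_mul trmxK.
  have -> : t^T = (comulv (dc T1) y)^T - (uv T1)^T *m y - y^T *m uv T1.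
    by apply/matrixP => i j; rewrite /t !mxE !big_ord1 !mxE; ring.
  rewrite !mulmxBr !(mulmxA (ev T1)) !mul_dot.
  rewrite ey ev_uv !mul_scalar_mx scale0r scale1r subr0.
  have -> : ev T1 *m (comulv (dc T1) y)^T = y.
    by apply: trmx_inj; rewrite trmx_mul trmxK comulv_ev.
  by rewrite subrr.
have z (s : 'M[k]_n) i j : ev T1 *m s = 0 -> deg i = 0%N -> s i j = 0.
  move=> es di; have [c cP] := deg0_coord di.
  have -> : s i j = (col j s)^T 0 i by rewrite !mxE.
  rewrite cP /dot trmxK colE mulmxA es mul0mx mxE mulr0 //.
have tP i j : t i j != 0 -> (0 < deg i)%N /\ (0 < deg j)%N.
  move=> tij; split; rewrite lt0n; apply: contraNneq tij => d0; first by rewrite z.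
  by apply/eqP; apply: etrans (z _ j i tev d0); rewrite [RHS]mxE.
have tN i j : (t - t^T) i j = t i j - t j i by rewrite [LHS]mxE; congr (_ + _); rewrite [LHS]mxE [in LHS]mxE.
move=> i j; rewrite tN; case: (eqVneq (t i j) 0) => [->|/tP[]]; last by lia.
by rewrite sub0r oppr_eq0 => /tP[]; lia.
Qed.

Lemma asym_uv : comulv (dc T1) (uv T1) - (comulv (dc T1) (uv T1))^T = 0.
Proof. by rewrite comulv_uv; move: (uv T1) => a; rewrite trmx_mul trmxK subrr. Qed.

(** The asymmetry of the coproduct strictly raises the degree: true on the
    augmentation ideal, and inherited by products by the Leibniz formula
    ab - a'b' = (a - a') b + a' (b - b'). *)
Lemma asym_chain s x : prod_chain (mc T) K (@full_pred k n) s x ->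
  tensdeg deg s.+1 (comulv (dc T1) (x *m q) - (comulv (dc T1) (x *m q))^T).
Proof.
have evq x' : orth (ev T) x' -> dot (ev T1) (x' *m q) = 0.
  by rewrite /orth dot_mulr' mulqr.
elim=> {s x} [v _|i|i y u z Ky pu IHu _ IHz].
- have AD c (a b : V) : comulv (dc T1) (c *: a + b) - (comulv (dc T1) (c *: a + b))^T
      = c *: (comulv (dc T1) a - (comulv (dc T1) a)^T)
        + (comulv (dc T1) b - (comulv (dc T1) b)^T).
    rewrite (_ : comulv (dc T1) (c *: a + b)
      = c *: comulv (dc T1) a + comulv (dc T1) b); last exact: linearP.
    by apply/matrixP => i j; rewrite !mxE; ring.
  pose v0 := v *m q - dot (ev T1) (v *m q) *: uv T1.
  have ev0 : dot (ev T1) v0 = 0.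
    by rewrite /v0 addrC -scaleNr dotDr ev_uv mulr1 addNr.
  have -> : v *m q = dot (ev T1) (v *m q) *: uv T1 + v0 by rewrite addrC subrK.
  rewrite AD asym_uv scaler0 add0r.
  by apply: tensdegW (asym_orth ev0).
- have c0 : comulv (dc T1) 0 = 0 by exact: linear0.
  by rewrite mul0mx c0 trmx0 subrr => ? ?; rewrite mxE eqxx.
have cD a b : comulv (dc T1) (a + b) = comulv (dc T1) a + comulv (dc T1) b.
  exact: linearD.
have tD (a b : 'M[k]_n) : (a + b)^T = a^T + b^T by exact: linearD.
rewrite mulmxDl cD tD opprD addrACA; apply: tensdegD => //.
have -> : mulv (mc T) y u *m q = mulv (mc T1) (y *m q) (u *m q).
  by rewrite [RHS](quo_morph (base_M T qr)).
rewrite (comulvM T1) -tmul_tr.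
set Y := comulv (dc T1) (y *m q); set W := comulv (dc T1) (u *m q).
have -> : tmul (mc T1) Y W - tmul (mc T1) Y^T W^T
    = tmul (mc T1) (Y - Y^T) W + tmul (mc T1) Y^T (W - W^T).
  have -> : Y - Y^T = -1 *: Y^T + Y by rewrite scaleN1r addrC.
  have -> : W - W^T = -1 *: W^T + W by rewrite scaleN1r addrC.
  rewrite tmulDl tmulDr.
  move: (tmul _ Y W) (tmul _ Y^T W) (tmul _ Y^T W^T) => A B C.
  by apply/matrixP => a b; rewrite !mxE; ring.
apply: tensdegD.
  have -> : (i.+2 = 2 + i)%N by [].
  apply: (tensdeg_tmul IK degP); first exact/asym_orth/evq.
  exact: (tensdeg_chain IK).
have -> : (i.+2 = 1 + i.+1)%N by [].
apply: (tensdeg_tmul IK degP) => //.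
apply: tensdeg_tr.
exact: (tensdeg_K IK).
Qed.

(** An asymmetry that strictly raises the degree disappears in the graded
    bialgebra. *)
Lemma gr_local_cocomm : commutative (mulv (dc Q)).
Proof.
have H i j l : dc Q i j l = dc Q j i l.
  rewrite /= /grc addrC; case: ifP => // /eqP E.
  have d0 : prod_chain (mc T) K (@full_pred k n) (deg l) (delta_mx 0 l *m r).
    apply/degP => t; rewrite mxE eqxx.
    by case: (eqVneq t l) => [->|]; rewrite ?eqxx.
  have := asym_chain d0; rewrite (mulrq rq) => /(_ i j).
  have -> (M : 'M[k]_n) : (M - M^T) i j = M i j - M j i.
    by rewrite [LHS]mxE; congr (_ + _); rewrite [LHS]mxE [in LHS]mxE.
  rewrite !comulv_delta => lt; apply/eqP; rewrite -subr_eq0.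
  by apply/negPn/negP => /lt; lia.
move=> a b; apply/rowP => l; rewrite !mulvE exchange_big.
by apply: eq_bigr => i _; apply: eq_bigr => j _; rewrite H [a 0 j * _]mulrC.
Qed.

Lemma orth_posdeg v : orth (ev Q) v -> posdeg deg v.
Proof.
move=> ov i di; have [c ->] := deg0_coord di.
suff -> : ev T1 = ev Q by rewrite ov mulr0.
apply/rowP => j; rewrite [RHS]mxE eqz_nat; case: (deg j =P 0%N) => // dj.
apply/eqP/negPn/negP => /(filt_ev IK degP); rewrite /opw; lia.
Qed.

(** The part of degree zero is one-dimensional: any two coordinates of degree zero
    are proportional to the counit, hence to each other. *)
Lemma orth_posdeg_uv f : orth (uv Q) f -> posdeg deg f.
Proof.
move=> fo i di; have [c cP] := deg0_coord di.
have c0 : c != 0.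
  apply: contra_eq_neq (cP (delta_mx 0 i)) => ->.
  by rewrite mul0r mxE !eqxx oner_eq0.
have uniq0 j : deg j = 0%N -> j = i.
  move=> dj; have [c' cP'] := deg0_coord dj; apply/eqP/negPn/negP => ji.
  have := cP (delta_mx 0 j); rewrite mxE eqxx [i == j]eq_sym (negPf ji).
  move=> /esym/eqP; rewrite mulf_eq0 (negPf c0) => /eqP e0.
  have := cP' (delta_mx 0 j); rewrite e0 mulr0 mxE !eqxx => /eqP.
  by rewrite oner_eq0.
have u0 j : j != i -> uv Q 0 j = 0.
  by rewrite mxE eqz_nat; case: (deg j =P 0%N) => // /uniq0->; rewrite eqxx.
have e0 j : j != i -> ev Q 0 j = 0.
  by rewrite mxE eqz_nat; case: (deg j =P 0%N) => // /uniq0->; rewrite eqxx.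
have := ev_uv Q; rewrite dotE (bigD1 i) //= big1 ?addr0 => [eu|j /e0-> ]; last first.
  by rewrite mul0r.
have ui : uv Q 0 i != 0.
  by apply: contra_eq_neq eu => ->; rewrite mulr0 eq_sym oner_eq0.
move: fo; rewrite /orth dotE (bigD1 i) //= big1 ?addr0 => [|j /u0->]; last exact: mul0r.
by move/eqP; rewrite mulf_eq0 (negPf ui) => /eqP.
Qed.

Lemma gr_local_nil : nilpot (mc Q) (orth (ev Q)) (@full_pred k n).
Proof.
apply: (nilpot_sub orth_posdeg); apply: graded_nilpot => i j l; rewrite /= /grc.
by case: ifP => /eqP; rewrite ?eqxx //; lia.
Qed.

Lemma gr_local_conil : nilpot (dc Q) (orth (uv Q)) (@full_pred k n).
Proof.
apply: (nilpot_sub orth_posdeg_uv); apply: graded_nilpot => i j l; rewrite /= /grc.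
by case: ifP => /eqP; rewrite ?eqxx //; lia.
Qed.

End LocalGr.
End Augmentation.

Section Core.
Variables (k : fieldType) (p : nat).
Hypothesis charp : p \in [pchar k].

Lemma nilpot_adapted n (T : bialg k n) K : biideal T K ->
  nilpot (mc T) K (@full_pred k n) ->
  exists r q deg, [/\ r *m q = 1%:M, q *m r = 1%:M & adapted T K r deg].
Proof.
move=> IK [N NP].
have [|||r [deg [ru degP]]] := @adapted_basis k n (prod_chain (mc T) K (@full_pred k n)) N _ _ _ NP.
- by move=> i; apply: lpred_chain; [apply: biideal_linear IK|].
- by move=> i v; apply: chain_dec.
- by move=> v; apply: chain_base.
by exists r, (invmx r), deg; rewrite mulmxV // mulVmx.
Qed.

(** For a local bialgebra, its graded bialgebra for the augmentation ideal has a
    commutative dual that meets the hypotheses of [comm_indic]. *)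
Lemma local_indic n (T : bialg k n) S z : n != 1%N -> antip T S ->
  nilpot (mc T) (orth (ev T)) (@full_pred k n) ->
  indic T S z = if z%:~R == 0 :> k then 0 else 1.
Proof.
move=> n1 aS nilT; have IK := orth_ev_biideal T.
have [r [q [deg [rq qr degP]]]] := nilpot_adapted IK nilT.
rewrite -(indic_adic aS IK rq qr degP) -indic_dual.
have aQ := antip_dual (antip_adic aS IK rq qr degP).
apply: (comm_indic _ charp aQ) => //.
- exact: gr_local_conil.
- exact: gr_local_cocomm.
exact: gr_local_nil.
Qed.

(** The last hypothesis says that the augmentation ideal of K^perp, the dual of
    the quotient by K, is nilpotent. *)
Theorem core_indic n (T : bialg k n) S K z : n != 1%N -> antip T S ->
  biideal T K -> nilpot (mc T) K (@full_pred k n) ->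
  nilpot (dc T)
    (fun f => (forall x, K x -> dot f x = 0) /\ dot (uv T) f = 0)
    (fun f => forall x, K x -> dot f x = 0) ->
  indic T S z = if z%:~R == 0 :> k then 0 else 1.
Proof.
move=> n1 aS IK nilK nilB; have [r [q [deg [rq qr degP]]]] := nilpot_adapted IK nilK.
rewrite -(indic_adic aS IK rq qr degP) -indic_dual.
have aG := antip_dual (antip_adic aS IK rq qr degP).
by apply: local_indic => //; apply: (local_dual_gr IK).
Qed.

End Core.

(** * The coradical filtration is exhaustive *)

Section Functionals.
Variables (k : fieldType) (C : vectType k).
Implicit Types (U : {vspace C}) (x : C).

Definition coordf (i : 'I_(dim C)) : 'Hom(C, k^o) :=
  linfun (fun x : C => v2r x 0 i : k^o).

Lemma coordf_linear i : linear (fun x : C => v2r x 0 i : k^o).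
Proof. by move=> a x y; rewrite linearP !mxE. Qed.

Lemma coordfE i x : coordf i x = v2r x 0 i.
Proof.
pose F := HB.pack_for {linear C -> k^o} (fun x : C => v2r x 0 i : k^o)
  (GRing.isLinear.Build k C k^o _ _ (coordf_linear i)).
by rewrite /coordf -[fun _ => _]/(F : C -> k^o) lfunE.
Qed.

Lemma functional_ext x y : (forall f : 'Hom(C, k^o), f x = f y) -> x = y.
Proof.
move=> H; apply: (can_inj v2rK); apply/rowP => i; rewrite -!coordfE; exact: H.
Qed.

Lemma separate U x : x \notin U -> exists2 f : 'Hom(C, k^o),
  forall y, y \in U -> f y = 0 & f x != 0.
Proof.
move=> xU; pose g := (\1 - projv U)%VF.
have gE y : g y = y - projv U y by rewrite add_lfunE opp_lfunE id_lfunE.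
have gx : v2r (g x) != 0.
  rewrite -(inj_eq (can_inj r2vK)) v2rK linear0 gE subr_eq0.
  by apply: contraNneq xU => ->; apply: memv_proj.
have [i gi] := rV0Pn _ gx.
exists (coordf i \o g)%VF => [y yU|]; rewrite comp_lfunE coordfE //.
by rewrite gE projv_id // subrr linear0 mxE.
Qed.

End Functionals.

Section Coalgebra.
Variables (k : fieldType) (C : vectType k) (cC : coalgebra C).
Notation fct := 'Hom(C, k^o).
Implicit Types (f g : fct) (x y : C) (U V D E : {vspace C}).

(** The contractions x |-> f(x1) x2 and x |-> x1 f(x2). *)
Definition contractl f : 'End(C) := (tlift (fun a b : C => (f a : k) *: b) \o comul cC)%VF.
Definition contractr f : 'End(C) := (tlift (fun a b : C => (f b : k) *: a) \o comul cC)%VF.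

Lemma tliftl f a b : tlift (fun a b : C => (f a : k) *: b) (a \ox b) = (f a : k) *: b.
Proof.
apply: (tlift_tpure (f := fun a b : C => (f a : k) *: b)) => [v|u] c y z /=.
  by rewrite linearP scalerDl scalerA.
by rewrite scalerDr !scalerA mulrC.
Qed.

Lemma tliftr f a b : tlift (fun a b : C => (f b : k) *: a) (a \ox b) = (f b : k) *: a.
Proof.
apply: (tlift_tpure (f := fun a b : C => (f b : k) *: a)) => [v|u] c y z /=.
  by rewrite scalerDr !scalerA mulrC.
by rewrite linearP scalerDl scalerA.
Qed.

Lemma counit_contractl f x : counit cC (contractl f x) = f x.
Proof.
rewrite -[in RHS](counitr cC x) /contractl comp_lfunE.
suff /lfunP/(_ (comul cC x)) : (counit cC \o tlift (fun a b : C => (f a : k) *: b)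
   = f \o tlift (fun a b : C => (counit cC b : k) *: a))%VF by rewrite !comp_lfunE.
apply: tens_ext => a b; rewrite !comp_lfunE tliftl tliftr !linearZ /=.
exact: mulrC.
Qed.

Lemma counit_contractr f x : counit cC (contractr f x) = f x.
Proof.
rewrite -[in RHS](counitl cC x) /contractr comp_lfunE.
suff /lfunP/(_ (comul cC x)) : (counit cC \o tlift (fun a b : C => (f b : k) *: a)
   = f \o tlift (fun a b : C => (counit cC a : k) *: b))%VF by rewrite !comp_lfunE.
apply: tens_ext => a b; rewrite !comp_lfunE tliftl tliftr !linearZ /=.
exact: mulrC.
Qed.

Lemma contractl_counit x : contractl (counit cC) x = x.
Proof. by rewrite comp_lfunE counitl. Qed.

Lemma contractr_counit x : contractr (counit cC) x = x.
Proof. by rewrite comp_lfunE counitr. Qed.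

(** Both sides are f(x1) x2 g(x3). The composition laws below follow,
    since an operator commuting with all right contractions is itself a left
    contraction. *)
Lemma contractC f g x : contractl f (contractr g x) = contractr g (contractl f x).
Proof.
pose F : 'Hom(tens C (tens C C), C) :=
  tlift (fun a t => (f a : k) *: tlift (fun b c : C => (g c : k) *: b) t).
have FE a t : F (a \ox t) = (f a : k) *: tlift (fun b c : C => (g c : k) *: b) t.
  apply: (tlift_tpure (f := fun a t => (f a : k) *: tlift (fun b c : C => (g c : k) *: b) t)).
    by move=> u c y z; rewrite linearP scalerDl scalerA.
  by move=> u c y z; rewrite linearP scalerDr !scalerA mulrC.
(* F and G compute f(x1) g(x3) x2 from the two bracketings of the iterated
   coproduct. *)
have Er : (contractr g \o tlift (fun a b : C => (f a : k) *: b) = F \o tens_map \1 (comul cC))%VF.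
  apply: tens_ext => a b; rewrite !comp_lfunE tliftl tens_map_tpure id_lfunE FE.
  by rewrite !linearZ /=.
pose G : 'Hom(tens (tens C C) C, C) :=
  tlift (fun t c => (g c : k) *: tlift (fun a b : C => (f a : k) *: b) t).
have GE t c : G (t \ox c) = (g c : k) *: tlift (fun a b : C => (f a : k) *: b) t.
  apply: (tlift_tpure (f := fun t c => (g c : k) *: tlift (fun a b : C => (f a : k) *: b) t)).
    by move=> u d y z; rewrite linearP scalerDr !scalerA mulrC.
  by move=> u d y z; rewrite linearP scalerDl scalerA.
have FG : (F \o tens_assoc C C C)%VF = G.
  apply: tens_ext3 => a b c; rewrite comp_lfunE tens_assoc_tpure FE GE tliftl tliftr.
  by rewrite !scalerA mulrC.
have El : (contractl f \o tlift (fun a b : C => (g b : k) *: a)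
   = F \o tens_assoc C C C \o tens_map (comul cC) \1)%VF.
  apply: tens_ext => a b; rewrite FG !comp_lfunE tliftr tens_map_tpure id_lfunE GE.
  by rewrite !linearZ.
have /lfunP/(_ x) := comul_assoc cC.
have /lfunP/(_ (comul cC x)) := El; have /lfunP/(_ (comul cC x)) := Er.
rewrite !comp_lfunE => H1 H2 Ex.
by rewrite H1 H2 Ex.
Qed.

Lemma contractl_comp f g x : contractl f (contractl g x) = contractl (f \o contractl g)%VF x.
Proof.
apply: functional_ext => h.
rewrite -(counit_contractr h) -[RHS](counit_contractr h) -!contractC !counit_contractl.
by rewrite [RHS]comp_lfunE.
Qed.

Lemma contractr_comp f g x : contractr f (contractr g x) = contractr (f \o contractr g)%VF x.
Proof.
apply: functional_ext => h.
rewrite -(counit_contractl h) -[RHS](counit_contractl h) !contractC !counit_contractr.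
by rewrite [RHS]comp_lfunE.
Qed.

Definition lstable V := forall f x, x \in V -> contractl f x \in V.
Definition rstable V := forall f x, x \in V -> contractr f x \in V.

Lemma mem_tens_sub U V (u v : C) : u \in U -> v \in V -> u \ox v \in tens_sub U V.
Proof.
move=> uU vV; rewrite (coord_vbasis uU) (coord_vbasis vV).
have tl (w : C) : linear (fun z : C => z \ox w) by move=> a y z; apply: tpureDl.
have tr (w : C) : linear (fun z : C => w \ox z) by move=> a y z; apply: tpureDr.
pose L w := HB.pack_for {linear C -> tens C C} (fun z : C => z \ox w)
  (GRing.isLinear.Build k C (tens C C) _ _ (tl w)).
pose R w := HB.pack_for {linear C -> tens C C} (fun z : C => w \ox z)
  (GRing.isLinear.Build k C (tens C C) _ _ (tr w)).
rewrite -[_ \ox _]/(L _ _) linear_sum; apply: memv_suml => i _.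
rewrite linearZ memvZ //= -[_ \ox _]/(R _ _) linear_sum; apply: memv_suml => j _.
rewrite linearZ memvZ //=; apply: memv_span; apply/allpairsP.
by exists ((vbasis U)`_i, (vbasis V)`_j); rewrite !mem_nth ?size_tuple ?ltn_ord.
Qed.

(** If D is stable under the contractions by coordinate functionals, then all rows
    and all columns of a coproduct of an element of D lie in D, and projecting
    both factors onto D does not change it. *)
Lemma subcoalgebraP D : subcoalgebra cC D <-> lstable D /\ rstable D.
Proof.
split=> [/subvP sD|[Dl Dr]].
  have sub (F : 'Hom(tens C C, C)) : (forall u v, u \in D -> v \in D -> F (u \ox v) \in D) ->
      forall x, x \in D -> F (comul cC x) \in D.
    move=> FD x xD; have /subvP H : (tens_sub D D <= F @^-1: D)%VS.
      apply/span_subvP => w /allpairsP[[u v] [/= uD vD ->]].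
      by rewrite -memv_preim; apply: FD; apply: vbasis_mem.
    by rewrite memv_preim; apply/H/sD/memv_img.
  split=> f x xD; rewrite comp_lfunE; apply: sub xD => u v uD vD.
    by rewrite tliftl memvZ.
  by rewrite tliftr memvZ.
apply/subvP => _ /memv_imgP[x xD ->]; set t := comul cC x.
have entry i j : t i j = coordf i (contractr (coordf j) x)
    /\ t i j = coordf j (contractl (coordf i) x).
  have lin : linear (fun s : tens C C => s i j : k^o) by move=> a y z; rewrite !mxE.
  pose e := HB.pack_for {linear tens C C -> k^o} (fun s : tens C C => s i j : k^o)
    (GRing.isLinear.Build k (tens C C) k^o _ _ lin).
  have eE s : linfun e s = s i j by rewrite lfunE.
  have pE a b : (a \ox b : tens C C) i j = v2r a 0 i * v2r b 0 j.
    by rewrite !mxE big_ord1 mxE.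
  split.
    suff /lfunP/(_ t) : linfun e = (coordf i \o tlift (fun a b : C => (coordf j b : k) *: a))%VF.
      by rewrite eE !comp_lfunE.
    apply: tens_ext => a b.
    rewrite eE comp_lfunE tliftr pE linearZ /= !coordfE; exact: mulrC.
  suff /lfunP/(_ t) : linfun e = (coordf j \o tlift (fun a b : C => (coordf i a : k) *: b))%VF.
    by rewrite eE !comp_lfunE.
  apply: tens_ext => a b.
  by rewrite eE comp_lfunE tliftl pE linearZ /= !coordfE.
have ltl : t = \sum_j contractr (coordf j) x \ox r2v (delta_mx 0 j).
  apply/matrixP => i j; rewrite (entry i j).1 coordfE summxE (bigD1 j) //= big1.
    by rewrite addr0 !mxE big_ord1 r2vK !mxE !eqxx mulr1.
  by move=> l nl; rewrite !mxE big_ord1 r2vK !mxE eqxx eq_sym (negPf nl) mulr0.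
have ltr : t = \sum_i r2v (delta_mx 0 i) \ox contractl (coordf i) x.
  apply/matrixP => i j; rewrite (entry i j).2 coordfE summxE (bigD1 i) //= big1.
    by rewrite addr0 !mxE big_ord1 r2vK !mxE !eqxx mul1r.
  by move=> l nl; rewrite !mxE big_ord1 r2vK !mxE eqxx eq_sym (negPf nl) mul0r.
have -> : t = tens_map (projv D) (projv D) t.
  have -> : tens_map (projv D) (projv D) t = tens_map \1 (projv D) (tens_map (projv D) \1 t).
    by rewrite -comp_lfunE tens_map_comp comp_lfun1l comp_lfun1r.
  have -> : tens_map (projv D) \1 t = t.
    rewrite {1}ltl linear_sum [RHS]ltl; apply: eq_bigr => j _.
    by rewrite /= tens_map_tpure id_lfunE projv_id // Dr.
  rewrite [in RHS]ltr linear_sum [LHS]ltr; apply: eq_bigr => j _.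
  by rewrite /= tens_map_tpure id_lfunE projv_id // Dl.
rewrite [X in tens_map _ _ X]tens_decomp linear_sum; apply: memv_suml => i _.
rewrite linear_sum; apply: memv_suml => j _; rewrite linearZ memvZ //=.
by rewrite /= tens_map_tpure mem_tens_sub ?memv_proj.
Qed.

End Coalgebra.

Section MinimalVspace.
Variables (k : fieldType) (C : vectType k).

Lemma minimal_vspace (P : {vspace C} -> Prop) V0 : P V0 ->
  exists2 V, P V & forall W, P W -> (\dim V <= \dim W)%N.
Proof.
move=> PV; pose Q d := `[< exists2 V, P V & \dim V = d >].
have exQ : exists d, Q d by exists (\dim V0); apply/asboolP; exists V0.
case: (ex_minnP exQ) => d /asboolP[V PV' <-] dmin; exists V => // W PW.
by apply: dmin; apply/asboolP; exists W.
Qed.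

Lemma maximal_vspace (P : {vspace C} -> Prop) V0 : P V0 ->
  exists2 V, P V & forall W, P W -> (V <= W)%VS -> W = V.
Proof.
move=> PV; pose Q d := `[< exists2 V, P V & \dim V = d >].
have exQ : exists d, Q d by exists (\dim V0); apply/asboolP; exists V0.
have ubQ d : Q d -> (d <= \dim {:C})%N.
  by move=> /asboolP[V _ <-]; apply/dimvS/subvf.
case: (ex_maxnP exQ ubQ) => d /asboolP[V PV' <-] dmax; exists V => // W PW VW.
by apply/esym/eqP; rewrite eqEdim VW dmax //; apply/asboolP; exists W.
Qed.

Lemma vspace_stabilizes (W : nat -> {vspace C}) :
  (forall i, (W i.+1 <= W i)%VS) -> exists i, W i.+1 = W i.
Proof.
move=> dec; apply: contrapT => /forallNP ne.
have lt i : (\dim (W i) + i <= \dim {:C})%N.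
  elim: i => [|i IHi]; first by rewrite addn0 dimvS ?subvf.
  suff : (\dim (W i.+1) < \dim (W i))%N by lia.
  rewrite ltnNge; apply/negP => le; apply: (ne i).
  by apply/eqP; rewrite eqEdim dec.
by have := lt (\dim {:C}).+1; lia.
Qed.

End MinimalVspace.

Section CoradicalFiltration.
Variables (k : fieldType) (C : vectType k) (cC : coalgebra C).
Notation fct := 'Hom(C, k^o).
Notation contractl := (contractl cC).
Notation contractr := (contractr cC).
Implicit Types (f g : fct) (x y : C) (U V D E : {vspace C}).

Lemma coradical_stable : lstable cC (coradical cC) /\ rstable cC (coradical cC).
Proof.
have H (h : 'End(C)) : (forall D, simple_subcoalgebra cC D -> forall y, y \in D -> h y \in D) ->
    forall x, x \in coradical cC -> h x \in coradical cC.
  move=> hD x /mem_sumv_family[s sP xs]; apply/mem_sumv_family; exists s => //.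
  have {}hD D y : D \in s -> y \in D -> h y \in D by move/sP/hD; apply.
  elim: s {sP} x hD xs => [|D s IHs] x hD.
    by rewrite big_nil memv0 => /eqP->; rewrite linear0 mem0v.
  rewrite big_cons => /memv_addP[y yD [z zs ->]]; rewrite linearD.
  apply: memv_add; first by apply: hD; rewrite ?mem_head.
  by apply: IHs => // E w Es; apply: hD; rewrite inE Es orbT.
by split=> f x; apply: H => D [/subcoalgebraP[Dl Dr] _ _] y yD; [apply: Dl|apply: Dr].
Qed.

(** The ideal K of the dual algebra formed by the functionals that vanish on the
    coradical. *)
Definition corad_perp f := forall x, x \in coradical cC -> f x = 0.

Lemma perp_kill f x : corad_perp f -> x \in coradical cC -> contractl f x = 0.
Proof.
move=> pf xC; apply: functional_ext => h.
rewrite linear0 -(counit_contractr cC h) -contractC counit_contractl; apply: pf.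
by case: coradical_stable => _; apply.
Qed.

(** The iterated images K^i C of the coalgebra. *)
Inductive contraction_chain : nat -> C -> Prop :=
| hc_base x : contraction_chain 0 x
| hc_zero i : contraction_chain i.+1 0
| hc_step i f x y : corad_perp f -> contraction_chain i x -> contraction_chain i.+1 y ->
    contraction_chain i.+1 (contractl f x + y).

Lemma contraction_chainD i x y : contraction_chain i x -> contraction_chain i y -> contraction_chain i (x + y).
Proof.
elim=> [z _|j|j f u v pf cu _ _ IHv cy]; first exact: hc_base.
  by rewrite add0r.
by rewrite -addrA; apply: hc_step => //; apply: IHv.
Qed.

Lemma contraction_chain_hom (h : 'End(C)) :
  (forall f x, corad_perp f -> exists2 g, corad_perp g & h (contractl f x) = contractl g x) ->
  forall i x, contraction_chain i x -> contraction_chain i (h x).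
Proof.
move=> hP i x; elim=> [z|j|j f u v pf cu _ _ IHv]; first exact: hc_base.
  by rewrite linear0; apply: hc_zero.
rewrite linearD /=; have [g pg ->] := hP f u pf.
exact: hc_step.
Qed.

Lemma contraction_chainZ a i x : contraction_chain i x -> contraction_chain i (a *: x).
Proof.
move=> cx; have <- : (a *: \1)%VF x = a *: x by rewrite scale_lfunE id_lfunE.
apply: contraction_chain_hom cx => f u pf; exists (a *: f).
  by move=> z zC; rewrite scale_lfunE pf // scaler0.
rewrite scale_lfunE id_lfunE; apply: functional_ext => h.
rewrite linearZ /= -[h (contractl f u)](counit_contractr cC) -[h (contractl _ u)](counit_contractr cC).
by rewrite -!contractC !counit_contractl scale_lfunE.
Qed.

Lemma contraction_chain_stable f i x : contraction_chain i x -> contraction_chain i (contractl f x).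
Proof.
apply: contraction_chain_hom => g u pg; exists (f \o contractl g)%VF; last exact: contractl_comp.
by move=> z zC; rewrite comp_lfunE (perp_kill pg) ?linear0.
Qed.

Lemma contraction_chain_dec i x : contraction_chain i.+1 x -> contraction_chain i x.
Proof.
elim: i x => [x _|i IHi x]; first exact: hc_base.
move Ej : i.+2 => j cx; elim: cx Ej => {j x} [//|j _|j f x y pf cx _ _ IHy [Ej]].
  exact: hc_zero.
by subst j; apply: hc_step => //; [apply: IHi|apply: IHy].
Qed.

(** A nonzero left subcomodule V with K V = V; the equality is stated as the
    minimality of V among the subspaces containing K V. *)
Definition self_generated V := [/\ V != 0%VS, lstable cC V &
  forall E, (forall f x, corad_perp f -> x \in V -> contractl f x \in E) -> (V <= E)%VS].

Lemma contractr_self_generated f V : self_generated V -> (contractr f @: V)%VS != 0%VS ->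
  self_generated (contractr f @: V)%VS.
Proof.
case=> _ Vs Vg W0; split=> // [g _ /memv_imgP[x xV ->]|E HE].
  by rewrite contractC memv_img ?Vs.
have VE : (V <= contractr f @^-1: E)%VS.
  by apply: Vg => g x pg xV; rewrite -memv_preim -contractC HE ?memv_img.
by apply/subvP => _ /memv_imgP[x /(subvP VE) xE ->]; rewrite memv_preim.
Qed.

(** A V of least dimension is simple, for otherwise a right contraction by a
    functional vanishing on a proper stable subspace, but not on V, gives a
    smaller one. Let D be the subcoalgebra spanned by the right contractions of
    V. No nonzero element of D is killed by K, whereas D contains a simple
    subcoalgebra, which lies in the coradical and is killed by K. *)
Lemma no_self_generated V : ~ self_generated V.
Proof.
move=> /minimal_vspace[{}V [V0 Vs Vg] Vmin].
(* V is simple as a left-stable subspace. *)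
have simpleV W : (W <= V)%VS -> lstable cC W -> W != 0%VS -> W = V.
  move=> WV Ws W0; apply/eqP; rewrite eqEsubv WV /=; apply/negPn/negP => nVW.
  have /subvPn[x xV xW] := nVW; have [f fW fx] := separate xW.
  have im0 : (contractr f @: V)%VS != 0%VS.
    apply: contraNneq fx => im0; rewrite -(counit_contractr cC f x).
    have : contractr f x \in (contractr f @: V)%VS by apply: memv_img.
    by rewrite im0 memv0 => /eqP->; rewrite linear0.
  have := Vmin _ (contractr_self_generated (And3 V0 Vs Vg) im0).
  have /eqP := limg_ker_dim (contractr f) V.
  suff : (\dim W <= \dim (V :&: lker (contractr f)))%N.
    have : (0 < \dim W)%N by rewrite lt0n dimv_eq0.
    lia.
  apply/dimvS/subvP => w wW; rewrite memv_cap (subvP WV) //= memv_ker; apply/eqP.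
  apply: functional_ext => h; rewrite linear0 -(counit_contractl cC h) contractC counit_contractr.
  exact/fW/Ws.
pose Z x := forall f, corad_perp f -> contractl f x = 0.
have KZ f g : corad_perp f -> corad_perp (f \o contractl g)%VF.
  move=> pf x xC; rewrite comp_lfunE pf //.
  by case: coradical_stable => Cl _; apply: Cl.
(* Z is stable because K is an ideal, so by simplicity V meets it in zero. *)
have noV v : v \in V -> Z v -> v = 0.
  move=> vV vZ; apply/eqP/negPn/negP => v0.
  have [W WP] : exists W : {vspace C}, forall x, x \in W <-> x \in V /\ Z x.
    apply: vspace_of_pred => [|a x y [xV xZ] [yV yZ]].
      by split=> [|f _]; rewrite ?mem0v ?linear0.
    split=> [|f pf]; first by rewrite memvD ?memvZ.
    by rewrite linearP /= xZ // yZ // scaler0 addr0.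
  have WV : W = V.
    apply: simpleV; first by apply/subvP => x /WP[].
      move=> g x /WP[xV xZ]; apply/WP; split; first exact: Vs.
      by move=> f pf; rewrite contractl_comp xZ //; apply: KZ.
    apply: contraNneq v0 => W0; have : v \in W by apply/WP.
    by rewrite W0 memv0.
  have : (V <= 0)%VS.
    apply: Vg => f x pf xV; have /WP[_ xZ] : x \in W by rewrite WV.
    by rewrite xZ // mem0v.
  by rewrite subv0 (negPf V0).
have [D DP] : exists D : {vspace C}, (forall f x, x \in V -> contractr f x \in D) /\
    forall E, (forall f x, x \in V -> contractr f x \in E) -> (D <= E)%VS.
  have := minimal_vspace (P := fun D => forall f x, x \in V -> contractr f x \in D) (V0 := fullv).
  case=> [f x _|D DP Dmin]; first exact: memvf.
  exists D; split=> // E EP; have /Dmin le : forall f x, x \in V -> contractr f x \in (D :&: E)%VS.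
    by move=> f x xV; rewrite memv_cap DP ?EP.
  by apply/capv_idPl/eqP; rewrite eqEdim capvSl.
case: DP => DV Dmin.
(* Let U be maximal among the stable subspaces meeting Z trivially. If some
   contraction of V were not inside U, it would meet U in zero, and the sum
   of the two would contradict the maximality of U. *)
have DZ x : x \in D -> Z x -> x = 0.
  pose good U := [/\ lstable cC U & forall x, x \in U -> Z x -> x = 0].
  have good0 : good 0%VS.
    by split=> [f y|y]; rewrite !memv0 => /eqP-> //; rewrite linear0.
  have [U [Us UZ] Umax] := maximal_vspace good0.
  suff DU : (D <= U)%VS by move=> xD; apply/UZ/(subvP DU).
  apply: Dmin => g v vV; apply/negPn/negP => nU.
  pose W := (contractr g @^-1: U :&: V)%VS.
  have W0 : W = 0%VS.
    apply/eqP/negPn/negP => Wn; have WV : W = V.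
      apply: simpleV => //; first exact: capvSr.
      move=> f y; rewrite !memv_cap -!memv_preim => /andP[yU yV].
      by rewrite -contractC Us // Vs.
    by have := vV; rewrite -{1}WV memv_cap -memv_preim (negPf nU).
  have : (U + contractr g @: V)%VS = U.
    apply: Umax; last exact: addvSl; split=> [f _ /memv_addP[u uU [_ /memv_imgP[y yV ->] ->]]|].
      by rewrite linearD memv_add ?Us //= contractC memv_img ?Vs.
    move=> _ /memv_addP[u uU [_ /memv_imgP[y yV ->] ->]] eZ.
    have y0 : y = 0.
      apply: (noV _ yV) => f pf; apply/eqP; rewrite -memv0 -W0 memv_cap Vs // andbT.
      rewrite -memv_preim -contractC; have /eqP := eZ f pf; rewrite linearD addrC addr_eq0 => /eqP->.
      by rewrite memvN Us.
    by move: eZ; rewrite y0 linear0 addr0; apply: UZ.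
  by move=> E; move/negP: nU; apply; rewrite -E -[contractr g v]add0r memv_add ?mem0v ?memv_img.
have VD : (V <= D)%VS by apply/subvP => x xV; rewrite -(contractr_counit cC x); apply: DV.
have Ds : lstable cC D /\ rstable cC D.
  split=> f x xD; rewrite memv_preim; move: x xD; apply/subvP/Dmin => g v vV.
    by rewrite -memv_preim contractC DV ?Vs.
  by rewrite -memv_preim contractr_comp DV.
have D0 : D != 0%VS by apply: contraNneq V0 => D0; rewrite -subv0 -D0.
have [E [E0 ED Es] Emin] := @minimal_vspace _ _
  (fun E => [/\ E != 0%VS, (E <= D)%VS & lstable cC E /\ rstable cC E]) D (And3 D0 (subvv D) Ds).
have simE : simple_subcoalgebra cC E.
  split; [exact/subcoalgebraP|exact/eqP|move=> E' /subcoalgebraP E's E'E].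
  have [->|E'0] := eqVneq E' 0%VS; [by left|right].
  apply/eqP; rewrite eqEdim E'E; apply: Emin; split=> //.
  exact: subv_trans ED.
move: E0; rewrite -subv0 => /negP; apply; apply/subvP => x xE; rewrite memv0.
apply/eqP/DZ; first exact: (subvP ED).
move=> f pf; apply: perp_kill => //; apply/mem_sumv_family; exists [:: E].
  by move=> E'; rewrite inE => /eqP->.
by rewrite big_seq1.
Qed.

(** The decreasing sequence K^i C is stationary, and its limit V satisfies
    K V = V. *)
Theorem contraction_chain_nilpotent : exists N, forall x, contraction_chain N x -> x = 0.
Proof.
have /choice[W WP] i : exists W : {vspace C}, forall x, x \in W <-> contraction_chain i x.
  apply: vspace_of_pred => [|a x y cx cy].
    by case: i => [|i]; [apply: hc_base|apply: hc_zero].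
  by apply: contraction_chainD => //; apply: contraction_chainZ.
have dec i : (W i.+1 <= W i)%VS by apply/subvP => x /WP/contraction_chain_dec/WP.
apply: contrapT => /forallNP nil.
have W0 i : W i != 0%VS.
  apply/eqP => Wi; case: (nil i) => x /WP; rewrite Wi memv0.
  by move/eqP.
have [i Wi] := vspace_stabilizes dec.
apply: (@no_self_generated (W i)); split=> // [f x /WP cx|E HE].
  by apply/WP; apply: contraction_chain_stable.
rewrite -Wi; apply/subvP => x /WP; move Ej : i.+1 => j cx.
elim: cx Ej => {x j} // [j _|j f x y pf cx _ _ IHy Ej]; first exact: mem0v.
by apply: memvD; [apply: HE => //; apply/WP; case: Ej => ->|apply: IHy].
Qed.

End CoradicalFiltration.

(** * Nilpotency of the radical *)

Section Radical.
Variables (k : fieldType) (H : falgType k) (A J : {vspace H}).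
Hypotheses (A1 : 1 \in A) (AA : (A * A <= A)%VS).
Hypotheses (JA : (J <= A)%VS) (AJ : (A * J <= J)%VS) (JAr : (J * A <= J)%VS).
Hypothesis Jmax : forall M, max_left_ideal A M -> (J <= M)%VS.

Fixpoint jpow i : {vspace H} := if i is i'.+1 then (J * jpow i')%VS else A.

(** For X a maximal proper submodule of W, v outside X and I a left ideal with
    I v not inside X, the submodule I v + X is the whole of W. *)
Lemma maximal_submodule_gen (X W : {vspace H}) v : (X <= W)%VS -> (A * X <= X)%VS ->
  (A * W <= W)%VS -> v \in W -> v \notin X ->
  (forall Y, (Y <= W)%VS -> (A * Y <= Y)%VS -> Y <> W -> (X <= Y)%VS -> Y = X) ->
  forall I, left_ideal A I -> (exists2 i, i \in I & i * v \notin X) ->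
  forall w, w \in W -> exists i x, [/\ i \in I, x \in X & w = i * v + x].
Proof.
move=> XW AX AW vW vX Xmax I /andP[IA AI] [i0 i0I i0v].
have [Y YP] : exists Y : {vspace H}, forall y, y \in Y <->
    exists i x, [/\ i \in I, x \in X & y = i * v + x].
  apply: vspace_of_pred.
    by exists 0, 0; rewrite !mem0v mul0r addr0.
  move=> a _ _ [i [x [iI xX ->]]] [j [y [jI yX ->]]].
  exists (a *: i + j), (a *: x + y); split; rewrite ?memvD ?memvZ //.
  by rewrite mulrDl -scalerAl scalerDr addrACA.
have YW : (Y <= W)%VS.
  apply/subvP => _ /YP[i [x [iI xX ->]]]; apply: memvD; last exact: (subvP XW).
  by apply/(subvP AW)/memv_mul => //; apply: (subvP IA).
have XY : (X <= Y)%VS.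
  by apply/subvP => x xX; apply/YP; exists 0, x; rewrite mem0v mul0r add0r.
have AY : (A * Y <= Y)%VS.
  apply/prodvP => a _ aA /YP[i [x [iI xX ->]]]; apply/YP.
  exists (a * i), (a * x); split; [| |by rewrite mulrDr mulrA].
    by apply/(subvP AI)/memv_mul.
  by apply/(subvP AX)/memv_mul.
move=> w wW; apply/YP; have [->//|/eqP nYW] := eqVneq Y W.
have YX := Xmax Y YW AY nYW XY.
by case/negP: i0v; rewrite -YX; apply/YP; exists i0, 0; rewrite mem0v addr0.
Qed.

Lemma jpow_stable i : (A * jpow i <= jpow i)%VS.
Proof. by case: i => [|i] //=; rewrite prodvA prodvSl. Qed.

Lemma jpow_dec i : (jpow i.+1 <= jpow i)%VS.
Proof.
elim: i => [|i IHi] /=; first exact: subv_trans JAr JA.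
exact: prodvSr.
Qed.

(** Nakayama: let W = J W <> 0 be the limit of the powers of J, X a maximal proper
    submodule of W and v in W outside X. Then the elements of A taking v into X
    form a maximal left ideal, which contains J; as W = A v + X, it follows
    that J W lies in X. *)
Lemma radical_nilpotent : exists N, jpow N = 0%VS.
Proof.
have [i Wi] := vspace_stabilizes jpow_dec; exists i; apply/eqP/negPn/negP => W0.
have AW := jpow_stable i; move: Wi W0 AW; rewrite [jpow i.+1]/=.
move: (jpow i) => {i} W JW W0 AW.
pose prop X := [/\ (X <= W)%VS, (A * X <= X)%VS & X <> W].
have prop0 : prop 0%VS.
  by split; rewrite ?sub0v ?prodv0 //; apply/eqP; rewrite eq_sym.
have [X [XW AX /eqP nXW] Xm] := maximal_vspace prop0.
have Xmax Y : (Y <= W)%VS -> (A * Y <= Y)%VS -> Y <> W -> (X <= Y)%VS -> Y = X.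
  by move=> YW AY nYW; apply: Xm.
have [v vW vX] : exists2 v, v \in W & v \notin X.
  by apply/subvPn; apply: contra nXW => WX; rewrite eqEsubv XW.
have gen := maximal_submodule_gen XW AX AW vW vX Xmax.
have [M MP] : exists M : {vspace H}, forall x, x \in M <-> x \in A /\ x * v \in X.
  apply: vspace_of_pred => [|a x y [xA xv] [yA yv]].
    by rewrite mul0r !mem0v.
  by rewrite mulrDl -scalerAl !memvD ?memvZ.
have nM1 : 1 \notin M by apply/negP => /MP[_]; rewrite mul1r (negPf vX).
have maxM : max_left_ideal A M.
  split=> [||I lI MI]; last 1 first.
  - have [->|nIM] := eqVneq I M; [by left|right].
    have [i iI iM] : exists2 i, i \in I & i \notin M.
      by apply/subvPn; apply: contra nIM => IM; rewrite eqEsubv IM.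
    have /andP[IA AI] := lI.
    have iv : i * v \notin X.
      by apply: contra iM => ivX; apply/MP; split=> //; apply: (subvP IA).
    have [j [x [jI xX Ev]]] := gen I lI (ex_intro2 _ _ i iI iv) v vW.
    have I1 : 1 \in I.
      rewrite -(subrK j 1) memvD //; apply/(subvP MI)/MP; split.
        by rewrite memvB //; apply: (subvP IA).
      by rewrite mulrBl mul1r {1}Ev addrC addKr.
    apply/eqP; rewrite eqEsubv IA; apply/subvP => a aA.
    by rewrite -[a]mulr1; apply/(subvP AI)/memv_mul.
  - apply/andP; split; first by apply/subvP => x /MP[].
    apply/prodvP => a x aA /MP[xA xv]; apply/MP; split.
      by apply/(subvP AA)/memv_mul.
    by rewrite -mulrA; apply/(subvP AX)/memv_mul.
  by move=> MA; rewrite MA A1 in nM1.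
have JM := Jmax maxM.
have lA : left_ideal A A by rewrite /left_ideal subvv AA.
have v1 : exists2 i, i \in A & i * v \notin X by exists 1; rewrite ?mul1r.
move/negP: nXW; apply; rewrite eqEsubv XW /= -JW; apply/prodvP => j w jJ wW.
have [a [x [aA xX ->]]] := gen A lA v1 w wW.
rewrite mulrDr mulrA memvD //.
  have /(subvP JM)/MP[] // : j * a \in J by apply/(subvP JAr)/memv_mul.
by apply/(subvP AX)/memv_mul => //; apply: (subvP JA).
Qed.

End Radical.

(** * Coordinates on a Hopf algebra *)

Section Coordinates.
Variables (k : fieldType) (H : falgType k) (hH : hopf_algebra H).
Notation n := (dim H).
Notation V := 'rV[k]_n.
Implicit Types (a b f g : V) (x y : H).

Definition hmc (i j l : 'I_n) : k :=
  v2r (r2v (delta_mx 0 i) * r2v (delta_mx 0 j) : H) 0 l.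
Definition hdc (i j l : 'I_n) : k := (comul hH (r2v (delta_mx 0 l)) : 'M_n) i j.
Definition huv : V := v2r (1 : H).
Definition hev : V := \row_i counit hH (r2v (delta_mx 0 i)).

Lemma hmulE a b : mulv hmc a b = v2r (r2v a * r2v b : H).
Proof.
move: a b; apply: bilinear_ext => [b x a a'|a x b b'|b x a a'|a x b b'|i j].
- exact: mulvDl.
- exact: mulvDr.
- by rewrite linearP mulrDl -scalerAl linearP.
- by rewrite linearP mulrDr -scalerAr linearP.
by apply/rowP => l; rewrite mulv_delta.
Qed.

Lemma hcomulE a : comulv hdc a = comul hH (r2v a) :> 'M_n.
Proof.
move: a; apply: linear_ext => [x a b|x a b|l]; [exact: linearP|by rewrite !linearP|].
by apply/matrixP => i j; rewrite comulv_delta.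
Qed.

Lemma hevE a : dot hev a = counit hH (r2v a).
Proof.
move: a; apply: (@linear_ext _ _ k^o) => [x a b|x a b|i]; [exact: dotDr|by rewrite !linearP|].
by rewrite dot_delta mxE.
Qed.

Definition functional (f : V) : 'Hom(H, k^o) := linfun (fun x : H => dot f (v2r x) : k^o).

Lemma functionalE f x : functional f x = dot f (v2r x).
Proof.
have lin : linear (fun x : H => dot f (v2r x) : k^o).
  by move=> a y z; rewrite linearP dotDr.
pose F := HB.pack_for {linear H -> k^o} (fun x : H => dot f (v2r x) : k^o)
  (GRing.isLinear.Build k H k^o _ _ lin).
by rewrite /functional -[fun _ => _]/(F : H -> k^o) lfunE.
Qed.

Lemma functional_surj (phi : 'Hom(H, k^o)) : phi = functional (\row_i phi (r2v (delta_mx 0 i))).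
Proof.
apply/lfunP => x; rewrite functionalE dotE {1}[x]r2v_sum_delta linear_sum.
by apply: eq_bigr => i _; rewrite linearZ mxE mulrC.
Qed.

(** Left contraction in coordinates is multiplication of the matrix of the
    coproduct by a row, which identifies the dual product with convolution. *)
Lemma v2r_contractl f x : v2r (contractl hH (functional f) x) = f *m (comul hH x : 'M_n).
Proof.
have lin : linear (fun t : tens H H => f *m (t : 'M_n) : V).
  by move=> a y z; rewrite mulmxDr scalemxAr.
pose F := HB.pack_for {linear tens H H -> V} (fun t : tens H H => f *m (t : 'M_n) : V)
  (GRing.isLinear.Build k (tens H H) V _ _ lin).
have FE t : linfun F t = f *m (t : 'M_n) by rewrite lfunE.
have -> : contractl hH (functional f) x = r2v (linfun F (comul hH x)); last by rewrite r2vK FE.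
pose R : 'Hom('rV[k]_n, H) := linfun r2v.
have RE v : R v = r2v v by rewrite lfunE.
suff /lfunP/(_ (comul hH x)) : (tlift (fun a b : H => (functional f a : k) *: b) = R \o linfun F)%VF.
  by rewrite comp_lfunE RE /contractl comp_lfunE.
apply: tens_ext => a b; rewrite comp_lfunE RE FE tliftl /tpure mulmxA.
by rewrite mul_dot mul_scalar_mx linearZ /= v2rK functionalE.
Qed.

Lemma dot_hmul f g x : dot (mulv hdc f g) (v2r x) = functional g (contractl hH (functional f) x).
Proof. by rewrite dot_mulv hcomulE v2rK functionalE v2r_contractl dotC. Qed.

Lemma functional_hmul f g : functional (mulv hdc f g) = (functional g \o contractl hH (functional f))%VF.
Proof. by apply/lfunP => x; rewrite functionalE dot_hmul [RHS]comp_lfunE. Qed.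

Lemma functional_hev : functional hev = counit hH.
Proof. by apply/lfunP => x; rewrite functionalE hevE v2rK. Qed.

Lemma functional_inj f g : functional f = functional g -> f = g.
Proof.
move=> /lfunP E; apply: dot_inj => a; have := E (r2v a).
by rewrite !functionalE r2vK.
Qed.

Lemma hmc_alg : is_alg hmc huv.
Proof.
split=> [a b c|a|a]; rewrite !hmulE ?v2rK; first by rewrite mulrA.
- by rewrite mul1r r2vK.
- by rewrite mulr1 r2vK.
Qed.

Lemma hdc_alg : is_alg hdc hev.
Proof.
split=> [a b c|a|a]; apply: functional_inj; rewrite !functional_hmul ?functional_hev; apply/lfunP => x.
- rewrite -comp_lfunA !(comp_lfunE (functional c)) (comp_lfunE (contractl hH (functional b))).
  by rewrite contractl_comp.
- by rewrite (comp_lfunE (functional a)) contractl_counit.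
- by rewrite (comp_lfunE (counit hH)) counit_contractl.
Qed.

Lemma hev_aug : is_aug hmc hev.
Proof. by move=> a b; rewrite !hevE hmulE v2rK counitM. Qed.

Lemma huv_aug : is_aug hdc huv.
Proof.
move=> f g; rewrite dotC dot_hmul functionalE v2r_contractl comul1 /tpure mulmxA mul_dot.
by rewrite mul_scalar_mx dotZr mulrC (dotC g) mulrC !(dotC huv).
Qed.

Lemma hev_uv : dot hev huv = 1.
Proof. by rewrite hevE v2rK counit1. Qed.

Lemma tens_mul_pure (a b : H) t : tens_mul (a \ox b) t
  = tlift (fun c d => (a * c) \ox (b * d)) t.
Proof.
pose g (a b : H) : 'Hom(tens H H, tens H H) := tlift (fun c d => (a * c) \ox (b * d)).
have gE (a' b' c d : H) : g a' b' (c \ox d) = (a' * c) \ox (b' * d).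
  apply: (tlift_tpure (f := fun c d => (a' * c) \ox (b' * d))) => [v|v] x y z /=.
    by rewrite mulrDr -scalerAr tpureDl.
  by rewrite mulrDr -scalerAr tpureDr.
have -> : tens_mul (a \ox b) t = tlift (fun a b : H => g a b t) (a \ox b) by [].
rewrite (tlift_tpure (f := fun a b : H => g a b t)) // => v x y z.
  suff /lfunP/(_ t) : g (x *: y + z) v = x *: g y v + g z v.
    by rewrite add_lfunE scale_lfunE.
  apply: tens_ext => c d; rewrite add_lfunE scale_lfunE !gE.
  by rewrite mulrDl -scalerAl tpureDl.
suff /lfunP/(_ t) : g v (x *: y + z) = x *: g v y + g v z.
  by rewrite add_lfunE scale_lfunE.
apply: tens_ext => c d; rewrite add_lfunE scale_lfunE !gE.
by rewrite mulrDl -scalerAl tpureDr.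
Qed.

Lemma tens_mulE (s t : tens H H) : tens_mul s t = tmul hmc s t :> 'M_n.
Proof.
have pure (u v : V) : (u^T *m v : tens H H) = r2v u \ox r2v v by rewrite /tpure !r2vK.
move: s; apply: sum_pure_ext => [x s s'|x s s'|a a'].
- by rewrite /tens_mul linearP.
- exact: tmulDl.
rewrite [in LHS]pure tens_mul_pure; move: t.
apply: sum_pure_ext => [x s s'|x s s'|b b'].
- by rewrite linearP.
- exact: tmulDr.
rewrite [in LHS]pure (tlift_tpure (f := fun c d => (r2v a * c) \ox (r2v a' * d))).
- by rewrite tmul_pure !hmulE.
- by move=> v x y z /=; rewrite mulrDr -scalerAr tpureDl.
- by move=> v x y z /=; rewrite mulrDr -scalerAr tpureDr.
Qed.

Lemma hmc_hdc : compat_coef hmc hdc.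
Proof.
apply/compat_coefP => a b; rewrite !hcomulE hmulE v2rK comulM tens_mulE.
by [].
Qed.

Definition hopf_coords : bialg k n :=
  Bialg hmc_alg hdc_alg hev_aug huv_aug hev_uv hmc_hdc.
Notation T := hopf_coords.

Definition end_mx (f : 'End(H)) : 'M[k]_n := lin1_mx (fun a : V => v2r (f (r2v a))).

Lemma mul_end_mx (f : 'End(H)) a : a *m end_mx f = v2r (f (r2v a)).
Proof.
have lin : linear (fun a : V => v2r (f (r2v a))) by move=> x y z; rewrite !linearP.
pose F := HB.pack_for {linear V -> V} (fun a : V => v2r (f (r2v a)))
  (GRing.isLinear.Build k V V _ _ lin).
exact: (mul_rV_lin1 F).
Qed.

Lemma end_mx_comp (f g : 'End(H)) : end_mx (f \o g)%VF = end_mx g *m end_mx f.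
Proof.
by apply/row_matrixP => i; rewrite !rowE mulmxA !mul_end_mx comp_lfunE v2rK.
Qed.

Lemma mul_mapE (t : tens H H) : v2r (mul_map H t) = mulmap hmc t.
Proof.
have pure (u v : V) : (u^T *m v : tens H H) = r2v u \ox r2v v by rewrite /tpure !r2vK.
move: t; apply: sum_pure_ext => [x s s'|x s s'|a b].
- by rewrite !linearP.
- exact: linearP.
rewrite [in LHS]pure (tlift_tpure (f := fun a b : H => a * b)).
- by rewrite -[mulmap _ _]/(mulv _ _ _) hmulE.
- by move=> v x y z /=; rewrite mulrDl -scalerAl.
- by move=> v x y z /=; rewrite mulrDr -scalerAr.
Qed.

Lemma tens_mapE (f g : 'End(H)) (t : tens H H) :
  tens_map f g t = (end_mx f)^T *m (t : 'M_n) *m end_mx g :> 'M_n.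
Proof.
have pure (u v : V) : (u^T *m v : tens H H) = r2v u \ox r2v v by rewrite /tpure !r2vK.
move: t; apply: sum_pure_ext => [x s s'|x s s'|a b].
- by rewrite linearP.
- by rewrite mulmxDr mulmxDl -scalemxAr -scalemxAl.
rewrite [in LHS]pure tens_map_tpure /tpure -!mul_end_mx trmx_mul !mulmxA.
by [].
Qed.

Lemma end_mx_conv (f g : 'End(H)) : end_mx (conv hH f g) = convm T (end_mx f) (end_mx g).
Proof.
apply/row_matrixP => i; rewrite !rowE mul_end_mx mul_conv /= hcomulE.
rewrite /conv comp_lfunE comp_lfunE mul_mapE tens_mapE.
by [].
Qed.

Lemma end_mx1 : end_mx \1%VF = 1%:M.
Proof. by apply/row_matrixP => i; rewrite !rowE mul_end_mx id_lfunE r2vK mulmx1. Qed.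

Lemma end_mx_conv1 : end_mx (conv1 hH) = convm1 T.
Proof.
have lin : linear (fun x : H => (counit hH x : k)%:A : H).
  by move=> a x y; rewrite linearP scalerDl scalerA.
pose F := HB.pack_for {linear H -> H} (fun x : H => (counit hH x : k)%:A : H)
  (GRing.isLinear.Build k H H _ _ lin).
have E x : conv1 hH x = (counit hH x : k)%:A.
  by rewrite /conv1 -[fun _ => _]/(F : H -> H) lfunE.
apply/row_matrixP => i; rewrite !rowE mul_end_mx E /convm1 mulmxA mul_dot mul_scalar_mx.
by rewrite linearZ dotC /= hevE.
Qed.

Lemma antip_coords : antip T (end_mx (antipode hH)).
Proof.
split; rewrite -end_mx1 -end_mx_conv -end_mx_conv1; first by rewrite antipodel.
by rewrite antipoder.
Qed.

Lemma end_mx_sweedler z : end_mx (sweedler_power hH z) = sweedler_mx T (end_mx (antipode hH)) z.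
Proof.
have E (f : 'End(H)) m : end_mx (iter m (conv hH f) (conv1 hH)) = iter m (convm T (end_mx f)) (convm1 T).
  by elim: m => [|m IHm]; rewrite ?end_mx_conv1 // !iterS end_mx_conv IHm.
case: z => m; last exact: E.
by have := E \1%VF m; rewrite end_mx1.
Qed.

(** The trace is computed in one chosen basis of H and the coordinates refer to
    another; P and Q are the matrices of the change of basis. *)
Lemma ltraceE (f : 'End(H)) : ltrace f = \tr (end_mx f).
Proof.
pose e := vbasis {:H}; have eP : basis_of {:H} e := vbasisP _.
pose P : 'M[k]_(\dim {:H}, n) := \matrix_i v2r e`_i.
pose Q : 'M[k]_(n, \dim {:H}) := \matrix_i passmx.rVof e (r2v (delta_mx 0 i)).
have vP (v : 'rV_(\dim {:H})) : v *m P = v2r (passmx.vecof e v).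
  rewrite mulmx_sum_row linear_sum; apply: eq_bigr => i _.
  by rewrite linearZ rowK.
have vQ (v : V) : v *m Q = passmx.rVof e (r2v v).
  move: v; apply: linear_ext => [x a b|x a b|i].
  - by rewrite mulmxDl scalemxAl.
  - by rewrite linearP passmx.rVof_linear.
  by rewrite -rowE rowK.
have PQ : P *m Q = 1%:M.
  apply/row_matrixP => i; rewrite !rowE mulmxA vP vQ v2rK passmx.vecofK //.
  by rewrite mulmx1.
have -> : end_mx f = Q *m passmx.mxof e e f *m P.
  apply/row_matrixP => i; rewrite !rowE !mulmxA mul_end_mx vQ passmx.mul_mxof vP.
  by rewrite !passmx.rVofK.
by rewrite mxtrace_mulC mulmxA PQ mul1mx.
Qed.

Lemma indicatorE z : indicator hH z = indic T (end_mx (antipode hH)) z.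
Proof. by rewrite /indicator ltraceE end_mx_comp end_mx_sweedler. Qed.

End Coordinates.

(** * The two Chevalley properties *)

Section Chevalley.
Variables (k : fieldType) (H : falgType k) (hH : hopf_algebra H).
Notation n := (dim H).
Notation V := 'rV[k]_n.
Notation T := (hopf_coords hH).

(** The exhaustiveness of the coradical filtration of C, transported to a space
    of functionals on H along a map pi: H -> C compatible with contractions. *)
Lemma chain_nilpot (C : vectType k) (cC : coalgebra C) (pi : 'Hom(H, C))
    (P W : V -> Prop) :
  (forall f, P f -> exists2 phi, corad_perp cC phi &
     forall x, pi (contractl hH (functional f) x) = contractl cC phi (pi x)) ->
  (forall f, W f -> forall x, pi x = 0 -> functional f x = 0) ->
  nilpot (dc T) P W.
Proof.
move=> Pphi W0; have [N NP] := contraction_chain_nilpotent cC.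
have fD f g x : functional (f + g) x = functional f x + functional g x.
  by rewrite !functionalE -{1}[f]scale1r dotDl mul1r.
have claim s f : prod_chain (dc T) P W s f ->
    forall t x, contraction_chain cC t (pi x) -> (s + t = N)%N -> functional f x = 0.
  elim=> [{}f Wf|j|j a b c Pa _ IHb _ IHc] t x cx st.
  - by apply: W0 => //; apply: NP; rewrite -st.
  - by rewrite functionalE dotC dot0r.
  rewrite fD (IHc t x cx st) addr0 functional_hmul comp_lfunE.
  have [phi pphi E] := Pphi a Pa.
  apply: (IHb t.+1); last by rewrite addnS -addSn.
  by rewrite E -[contractl _ _ _]addr0; apply: hc_step => //; apply: hc_zero.
exists N => f /claim H0; apply: dot_inj => a; rewrite -[a]r2vK -functionalE.
by rewrite (H0 0%N) ?addn0 //; [rewrite dotC dot0r|apply: hc_base].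
Qed.

Lemma memNfn (U : {vspace H}) (a : V) :
  (forall f : V, (forall x, x \in U -> functional f x = 0) -> dot a f = 0) -> r2v a \in U.
Proof.
move=> aP; apply/negPn/negP => /separate[phi pU /eqP]; apply.
by rewrite (functional_surj phi) functionalE r2vK dotC; apply: aP => x xU; rewrite -functional_surj pU.
Qed.

Section LocalDual.
Hypothesis Hsub : hopf_subalgebra hH (coradical hH).
Hypothesis Hloc : local_algebra (coradical hH).
Notation B := (coradical hH).
Let K (f : V) := forall x, x \in B -> functional f x = 0.

Lemma corad_biideal : biideal (dual T) K.
Proof.
have [Bl Br] := coradical_stable hH; have [B1 BB _ _] := Hsub.
split=> /=.
- split=> [x _|c f g fK gK x xB]; first by rewrite functionalE dotC dot0r.
  by rewrite functionalE dotDl -!functionalE fK // gK // mulr0 addr0.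
- by move=> a f fK x xB; rewrite functional_hmul comp_lfunE fK ?Bl.
- by move=> a f fK x xB; rewrite functional_hmul comp_lfunE (perp_kill fK) ?linear0.
- by move=> f fK; rewrite dotC -(fK 1) // functionalE.
move=> a b aK bK f fK; rewrite dotC hmulE -functionalE; apply: fK.
apply/(subvP BB)/memv_mul; apply: memNfn => g gB; [exact: aK|exact: bK].
Qed.

Lemma corad_nilK : nilpot (mc (dual T)) K (@full_pred k n).
Proof.
apply: (@chain_nilpot H hH \1%VF) => [f fK|f _ x].
  by exists (functional f) => // x; rewrite !id_lfunE.
by rewrite id_lfunE => ->; rewrite linear0.
Qed.

(** The kernel of the counit on the coradical has codimension one, so by locality
    it is the only maximal left ideal. *)
Lemma corad_nilB : nilpot (dc (dual T))
    (fun f => (forall x, K x -> dot f x = 0) /\ dot (uv (dual T)) f = 0)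
    (fun f => forall x, K x -> dot f x = 0).
Proof.
have [B1 BB _ _] := Hsub.
pose J := (B :&: lker (counit hH))%VS.
have JE x : x \in J <-> x \in B /\ counit hH x = 0.
  by rewrite memv_cap memv_ker; split=> [/andP[-> /eqP]|[-> /eqP]].
have JB : (J <= B)%VS by apply: capvSl.
have BJ : (B * J <= J)%VS.
  apply/prodvP => a x aB /JE[xB ex]; apply/JE; split.
    by apply/(subvP BB)/memv_mul.
  by rewrite counitM ex mulr0.
have JBr : (J * B <= J)%VS.
  apply/prodvP => x a /JE[xB ex] aB; apply/JE; split.
    by apply/(subvP BB)/memv_mul.
  by rewrite counitM ex mul0r.
have maxJ : max_left_ideal B J.
  split=> [||I /andP[IB BI] JI]; first by rewrite /left_ideal JB BJ.
    move=> E; have : 1 \in J by rewrite E.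
    by move/JE=> [_]; rewrite counit1 => /eqP; rewrite oner_eq0.
  have [->|nIJ] := eqVneq I J; [by left|right].
  have [i iI iJ] : exists2 i, i \in I & i \notin J.
    by apply/subvPn; apply: contra nIJ => IJ; rewrite eqEsubv IJ.
  have ei : counit hH i != 0.
    by apply: contraNneq iJ => ei; apply/JE; split=> //; apply: (subvP IB).
  apply/eqP; rewrite eqEsubv IB; apply/subvP => a aB.
  rewrite -(subrK ((counit hH a / counit hH i : k) *: i) a) memvD ?memvZ //.
  apply/(subvP JI)/JE; split; first by rewrite memvB ?memvZ //; apply: (subvP IB).
  by rewrite linearB linearZ /= -[_ *: _]/(_ * _) divfK // subrr.
have Jmax M : max_left_ideal B M -> (J <= M)%VS.
  by case: Hloc => M0 [_ uM0] /uM0 <-; rewrite -(uM0 _ maxJ).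
have [N NP] := radical_nilpotent B1 BB JB BJ JBr Jmax.
exists N => v pv; apply: (can_inj r2vK); rewrite linear0.
suff : r2v v \in jpow B J N by rewrite NP memv0 => /eqP.
elim: pv => {v} [v vK|j|j x y z [xK ex] _ IHy _ IHz] /=.
- by apply: memNfn => g gB; apply: vK.
- by rewrite linear0 mem0v.
rewrite linearD /= hmulE v2rK memvD // memv_mul //; apply/JE; split.
  by apply: memNfn => g gB; apply: xK.
by rewrite -hevE.
Qed.

End LocalDual.

Section Connected.
Notation J := (jacobson_radical H).
Hypothesis HJ : hopf_ideal hH J.
Variable coJ : coideal hH J.
Hypothesis conn : connected_coalgebra (quo_coalgebra coJ).
Let K (a : V) := r2v a \in J.
Notation C := (quo_coalgebra coJ).
Notation pi := (quo_proj J).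

Lemma J_counit x : x \in J -> counit hH x = 0.
Proof. by have /andP[_ /subvP H0] := coJ => /H0; rewrite memv_ker => /eqP. Qed.

Lemma jac_biideal : biideal T K.
Proof.
have [HJl JHr _ _] := HJ; rewrite /K; split=> /=.
- by split=> [|c x y xJ yJ]; rewrite ?linear0 ?mem0v // linearP memvD ?memvZ.
- by move=> a x xJ; rewrite hmulE v2rK; apply/(subvP HJl)/memv_mul; rewrite ?memvf.
- by move=> a x xJ; rewrite hmulE v2rK; apply/(subvP JHr)/memv_mul; rewrite ?memvf.
- by move=> x xJ; rewrite hevE J_counit.
move=> f g fJ gJ x xJ.
have fJ' y : y \in J -> functional f y = 0 by move=> yJ; rewrite functionalE; apply: fJ; rewrite v2rK.
have gJ' y : y \in J -> functional g y = 0 by move=> yJ; rewrite functionalE; apply: gJ; rewrite v2rK.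
rewrite -[x]r2vK dot_hmul /contractl comp_lfunE.
pose F := (functional g \o tlift (fun a b : H => (functional f a : k) *: b))%VF.
suff /subvP FJ : (tens_sub J fullv + tens_sub fullv J <= lker F)%VS.
  have : comul hH (r2v x) \in lker F.
    have /andP[/subvP H0 _] := coJ; apply/FJ/H0/memv_img.
    exact: xJ.
  by rewrite memv_ker comp_lfunE => /eqP.
rewrite subv_add; apply/andP; split; apply/span_subvP => w;
  case/allpairsP=> -[u v] /= [/vbasis_mem uI /vbasis_mem vI ->];
  rewrite memv_ker comp_lfunE tliftl linearZ /=.
  by rewrite fJ' // scale0r.
by rewrite gJ' // scaler0.
Qed.

Lemma jac_nilK : nilpot (mc T) K (@full_pred k n).
Proof.
have [HJl JHr _ _] := HJ.
have Jmax M : max_left_ideal {:H} M -> (J <= M)%VS.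
  by move=> maxM; apply/subvP => x /mem_capv_family; apply.
have [N NP] := radical_nilpotent (memvf 1) (subvf _) (subvf _) HJl JHr Jmax.
exists N => v pv; apply: (can_inj r2vK); rewrite linear0.
suff : r2v v \in jpow {:H} J N by rewrite NP memv0 => /eqP.
elim: pv => {v} [v _|j|j x y z xK _ IHy _ IHz] /=; first exact: memvf.
  by rewrite linear0 mem0v.
by rewrite linearD /= hmulE v2rK memvD // memv_mul.
Qed.

(** The class of 1 is grouplike, so it spans a simple subcoalgebra, which is the
    whole coradical of a connected coalgebra. *)
Lemma coradical_quo x : x \in coradical C -> exists c : k, x = c *: pi 1.
Proof.
pose g := pi 1.
have p1 : comul C (g) = g \ox g.
  have /lfunP/(_ 1) := quo_comulE coJ.
  by rewrite /g comp_lfunE [RHS]comp_lfunE comul1 tens_map_tpure.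
have e1 : counit C (g) = 1.
  have /lfunP/(_ 1) := quo_counitE coJ.
  by rewrite comp_lfunE counit1.
have n1 : g != 0.
  by apply: contra_eq_neq e1 => ->; rewrite linear0 eq_sym oner_eq0.
have d1 : \dim <[g]> = 1%N by rewrite dim_vline n1.
have sim : simple_subcoalgebra C <[g]>%VS.
  split.
  - apply/subvP => _ /memv_imgP[_ /vlineP[c ->] ->]; rewrite linearZ memvZ //= p1.
    by apply: mem_tens_sub; apply: memv_line.
  - by move=> E; move: d1; rewrite E dimv0.
  move=> E _ EL; have := dimvS EL; rewrite d1.
  case: (posnP (\dim E)) => [/eqP|E0 E1]; first by rewrite dimv_eq0 => /eqP->; left.
  by right; apply/eqP; rewrite eqEdim EL d1.
have LC : (<[g]> <= coradical C)%VS.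
  apply/subvP => y yL; apply/mem_sumv_family; exists [:: <[g]>%VS].
    by move=> D; rewrite inE => /eqP->.
  by rewrite big_seq1.
have -> : coradical C = <[g]>%VS.
  by apply/esym/eqP; rewrite eqEdim LC d1 conn.
by move=> /vlineP.
Qed.

(** Functionals on H that vanish on J are functionals on H / J, and those that also
    vanish at 1 vanish on the coradical of H / J. *)
Lemma jac_nilB : nilpot (dc T)
    (fun f => (forall x, K x -> dot f x = 0) /\ dot (uv T) f = 0)
    (fun f => forall x, K x -> dot f x = 0).
Proof.
have fJ f : (forall x, K x -> dot f x = 0) -> forall y, y \in J -> functional f y = 0.
  by move=> fK y yJ; rewrite functionalE; apply: fK; rewrite /K v2rK.
apply: (@chain_nilpot _ C pi) => [f [fK f1]|f fK x px].
  pose phi := (functional f \o quo_repr J)%VF.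
  have phiE x : phi (pi x) = functional f x.
    rewrite comp_lfunE; apply/esym/eqP; rewrite -subr_eq0 -linearB; apply/eqP.
    exact/(fJ f fK)/quo_projB.
  exists phi => [x /coradical_quo[c ->]|x].
    by rewrite linearZ /= phiE functionalE dotC f1 scaler0.
  rewrite /contractl [RHS]comp_lfunE [in LHS]comp_lfunE.
  have /lfunP/(_ x) := quo_comulE coJ; rewrite comp_lfunE [in RHS]comp_lfunE => ->.
  suff /lfunP/(_ (comul hH x)) : (pi \o tlift (fun a b : H => (functional f a : k) *: b)
     = tlift (fun a b => (phi a : k) *: b) \o tens_map pi pi)%VF.
    by rewrite comp_lfunE [in RHS]comp_lfunE.
  apply: tens_ext => a b.
  by rewrite comp_lfunE [RHS]comp_lfunE tens_map_tpure !tliftl linearZ phiE.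
by apply: fJ => //; rewrite -(quo_proj_ker J) memv_ker px.
Qed.

End Connected.
End Chevalley.

Theorem theorem3p6 (k : fieldType) (p : nat) (charp : p \in [pchar k])
  (H : falgType k) (hH : hopf_algebra H) (ntH : (1 < \dim {:H})%N)
  (chevH : local_dual_chevalley hH \/ connected_chevalley hH) :
  forall n : int, indicator hH n = (pertinent_seq p n)%:R.
Proof.
move=> z; rewrite indicatorE /pertinent_seq.
have dimH : dim H != 1%N by rewrite -dimvf neq_ltn ntH orbT.
have -> : ((if (p%:Z %| z)%Z then 0%N else 1%N)%:R : k)
    = if z%:~R == 0 :> k then 0 else 1.
  by rewrite (dvdz_pcharf charp); case: ifP.
have aS := antip_coords hH.
case: chevH => [[Hsub Hloc]|[HJ [coJ conn]]].
  rewrite -indic_dual; apply: (core_indic charp z dimH (antip_dual aS)).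
  - exact: corad_biideal Hsub.
  - exact: corad_nilK.
  exact: corad_nilB Hsub Hloc.
apply: (core_indic charp z dimH aS).
- exact: jac_biideal HJ coJ.
- exact: jac_nilK HJ.
exact: jac_nilB conn.
Qed.
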